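(* Let $\mathbf{S_{n,n}}=(S_{1,n},\dots,S_{n,n})^*$ be uniformly distributed on the complex moment space $\mathcal{M}_n(\mathbb{C})$. Then the corresponding symmetric canonical moments $U_{1,n},\dots,U_{n,n}$ are independent and, for $k=1,\dots,n$, $U_{k,n}\sim\mathrm{Beta}^{(2)}_p\big(p(n-k+1),p(n-k+1)\big)$.
   Context: $\mathcal{S}_p(\mathbb{C})$: complex hermitian $p\times p$ matrices, with Lebesgue measure $dX=\prod_{i}dx_{ii}\prod_{i<j}d\operatorname{Re}x_{ij}\,d\operatorname{Im}x_{ij}$; $A^*$ is the conjugate transpose. A complex matrix measure on $[0,1]$ is a $p\times p$ matrix of complex Borel measures with $\mu(B)$ hermitian nonnegative definite for every Borel $B$ and $\mu([0,1])=I_p$; moments $S_k=\int_0^1x^kd\mu$, $S_0=I_p$. $\mathcal{M}_n(\mathbb{C})\subset(\mathcal{S}_p(\mathbb{C}))^n$ is the set of moment vectors $(S_1,\dots,S_n)^*$ of such measures; the uniform distribution has density proportional to its indicator. With block Hankel matrices $\underline H_{2m}=(S_{i+j})_{i,j=0}^m$, $\overline H_{2m}=(S_{i+j+1}-S_{i+j+2})_{i,j=0}^{m-1}$, $\underline H_{2m+1}=(S_{i+j+1})_{i,j=0}^m$, $\overline H_{2m+1}=(S_{i+j}-S_{i+j+1})_{i,j=0}^m$ and block vectors $\underline h_{2m}=(S_{m+1},\dots,S_{2m})^T$, $\underline h_{2m-1}=(S_m,\dots,S_{2m-1})^T$, $\bar h_{2m}=(S_m-S_{m+1},\dots,S_{2m-1}-S_{2m})^T$,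 $\bar h_{2m-1}=(S_m-S_{m+1},\dots,S_{2m-2}-S_{2m-1})^T$, set $S_1^-=0_p$, $S_1^+=I_p$, $S_2^+=S_1$, $S^-_{n+1}=\underline h_n^*\underline H_{n-1}^{-1}\underline h_n$, $S^+_{n+1}=S_n-\bar h_n^*\overline H_{n-1}^{-1}\bar h_n$; the interior of $\mathcal{M}_n(\mathbb{C})$ is $\{S_k^-<S_k<S_k^+\ \forall k\}$ and there the canonical moments are $U_k=(S_k^+-S_k^-)^{-1/2}(S_k-S_k^-)(S_k^+-S_k^-)^{-1/2}$. $\mathrm{Beta}^{(2)}_p(a,b)$ ($a,b>p-1$) has density $B_p^{(2)}(a,b)^{-1}(\det X)^{a-p}\det(I_p-X)^{b-p}\mathbf{1}_{\{0_p<X<I_p\}}$ with $B^{(2)}_p(a,b)=\Gamma^{(2)}_p(a)\Gamma^{(2)}_p(b)/\Gamma^{(2)}_p(a+b)$, $\Gamma^{(2)}_p(a)=\pi^{p(p-1)/2}\prod_{i=1}^p\Gamma(a-i+1)$. *)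

(* Defs.v *)
From HB Require Import structures.
From mathcomp Require Import all_boot all_order all_algebra.
From mathcomp Require Import all_classical all_reals all_analysis.
From mathcomp Require Import complex.
Set Implicit Arguments.
Unset Strict Implicit.
Unset Printing Implicit Defensive.
Import Order.TTheory GRing.Theory Num.Theory.
Local Open Scope classical_set_scope.
Local Open Scope ring_scope.

Section Defs.
Variable R : realType.
Local Notation C := R[i].

Definition ctr m n (A : 'M[C]_(m, n)) : 'M[C]_(n, m) := (map_mx (@conjc R) A)^T.

Definition herm_mx p (A : 'M[C]_p) := ctr A = A.

Definition psd p (A : 'M[C]_p) :=
  herm_mx A /\ forall v : 'cV[C]_p, 0 <= (ctr v *m A *m v) 0 0.
Definition pd p (A : 'M[C]_p) :=
  herm_mx A /\ forall v : 'cV[C]_p, v != 0 -> 0 < (ctr v *m A *m v) 0 0.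

Definition lowner_lt p (A B : 'M[C]_p) := pd (B - A).

Definition msqrt p (A : 'M[C]_p) : 'M[C]_p :=
  xget 0 [set X | psd X /\ X *m X = A].
Definition minvsqrt p (A : 'M[C]_p) : 'M[C]_p := invmx (msqrt A).

(* coordinate (i,i) = x_ii, (i,j) with i<j = Re x_ij, (j,i) with i<j = Im x_ij *)
Definition herm p (x : 'I_p * 'I_p -> R) : 'M[C]_p :=
  \matrix_(i, j)
    if i == j then Complex (x (i, i)) 0
    else if (i < j)%N then Complex (x (i, j)) (x (j, i))
    else Complex (x (j, i)) (- x (i, j)).

Definition upd (I : eqType) (x : I -> R) (i : I) (t : R) : I -> R :=
  fun j => if j == i then t else x j.

Fixpoint itint (I : eqType) (s : seq I) (f : (I -> R) -> \bar R) (x : I -> R)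
  : \bar R :=
  match s with
  | [::] => f x
  | i :: s' => (\int[@lebesgue_measure R]_t itint s' f (upd x i t))%E
  end.

(* \int_{R^I} f(x) dx  (Lebesgue measure on R^I = product of Lebesgue measures) *)
Definition lebint (I : finType) (f : (I -> R) -> \bar R) : \bar R :=
  itint (enum I) f (fun _ => 0).

(* Borel sets of R^I: product sigma-algebra (= Borel sigma-algebra, I finite) *)
Definition borelI (I : finType) (A : set (I -> R)) : Prop :=
  <<s [set E | exists i (A0 : set R), measurable A0 /\
               E = (fun x : I -> R => x i) @^-1` A0] >> A.

Definition herm_borel p (B : set 'M[C]_p) : Prop := borelI (@herm p @^-1` B).

(* Each complex measure mu_ij is represented as
   (nu 0 i j - nu 1 i j) + i (nu 2 i j - nu 3 i j) with finite measures nu;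
   integrals against mu_ij are defined accordingly. *)
Definition cmeas p (nu : 'I_4 -> 'I_p -> 'I_p -> {finite_measure set R -> \bar R})
  (B : set R) : 'M[C]_p :=
  \matrix_(i, j) Complex (fine (nu 0 i j B) - fine (nu 1 i j B))
                         (fine (nu 2 i j B) - fine (nu 3 i j B)).

Definition cmoment p (nu : 'I_4 -> 'I_p -> 'I_p -> {finite_measure set R -> \bar R})
  (k : nat) : 'M[C]_p :=
  let I r i j := fine (\int[nu r i j]_(x in `[0%R, 1%R]) (x ^+ k)%:E)%E in
  \matrix_(i, j) Complex (I 0 i j - I 1 i j) (I 2 i j - I 3 i j).

Definition matrix_measure p
  (nu : 'I_4 -> 'I_p -> 'I_p -> {finite_measure set R -> \bar R}) : Prop :=
  (forall B : set R, measurable B -> B `<=` `[0%R, 1%R] -> psd (cmeas nu B)) /\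
  cmeas nu `[0%R, 1%R] = 1%:M.

Definition momS p n (x : 'I_n * ('I_p * 'I_p) -> R) (k : 'I_n) : 'M[C]_p :=
  herm (fun ij => x (k, ij)).

Definition moment_space p n : set ('I_n * ('I_p * 'I_p) -> R) :=
  [set x | exists nu, matrix_measure nu /\
           forall k : 'I_n, momS x k = cmoment nu k.+1].

(* the full sequence S_0 = I, S_1, ..., S_n (and 0 beyond, never used) *)
Definition Sseq p n (x : 'I_n * ('I_p * 'I_p) -> R) (k : nat) : 'M[C]_p :=
  match k with
  | 0 => 1%:M
  | k'.+1 => if insub k' is Some k'' then momS x k'' else 0
  end.

Section Hankel.
Variables (p : nat) (S : nat -> 'M[C]_p).
(* For k >= 0:  Hlow k  = underline H_k  (k./2.+1 blocks; entries S_{i+j+odd k}),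
                hlow k  = underline h_{k+1} = (S_{k+1-k./2}, ..., S_{k+1}),
                Hup k   = overline H_k  (uphalf k blocks; S_{i+j+e}-S_{i+j+e+1},
                          e = 1 if k even, 0 if k odd),
                hup k   = overline h_{k+1}
                        = (S_c - S_{c+1}, ..., ) with c = uphalf (k+1),
                          (k+1)./2 = uphalf k blocks. *)
Definition Hlow (k : nat) : 'M[C]_(\sum_(i < k./2.+1) p) :=
  \mxblock_(i < k./2.+1, j < k./2.+1) S (i + j + odd k).
Definition hlow (k : nat) : 'M[C]_(\sum_(i < k./2.+1) p, p) :=
  \mxcol_(i < k./2.+1) S (k.+1 - k./2 + i).
Definition Hup (k : nat) : 'M[C]_(\sum_(i < uphalf k) p) :=
  \mxblock_(i < uphalf k, j < uphalf k)
     (S (i + j + ~~ odd k) - S (i + j + ~~ odd k).+1).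
Definition hup (k : nat) : 'M[C]_(\sum_(i < uphalf k) p, p) :=
  \mxcol_(i < uphalf k) (S (uphalf k.+1 + i) - S (uphalf k.+1 + i).+1).

Definition Sminus (k : nat) : 'M[C]_p :=
  match k with
  | 0 | 1 => 0
  | k'.+2 => ctr (hlow k') *m invmx (Hlow k') *m hlow k'
  end.
Definition Splus (k : nat) : 'M[C]_p :=
  match k with
  | 0 | 1 => 1%:M
  | k'.+2 => S k'.+1 - ctr (hup k') *m invmx (Hup k') *m hup k'
  end.

Definition canU (k : nat) : 'M[C]_p :=
  let D := Splus k - Sminus k in
  minvsqrt D *m (S k - Sminus k) *m minvsqrt D.
End Hankel.

Definition interior_moments p n (x : 'I_n * ('I_p * 'I_p) -> R) : Prop :=
  forall k : 'I_n, lowner_lt (Sminus (Sseq x) k.+1) (Sseq x k.+1) /\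
                   lowner_lt (Sseq x k.+1) (Splus (Sseq x) k.+1).

Definition canonical_moments p n (x : 'I_n * ('I_p * 'I_p) -> R) (k : 'I_n)
  : 'M[C]_p := canU (Sseq x) k.+1.

Definition unif_moment_prob p n (E : set ('I_n * ('I_p * 'I_p) -> R)) : R :=
  fine (lebint (fun x => (\1_(E `&` @moment_space p n) x)%:E)) /
  fine (lebint (fun x => (\1_(@moment_space p n) x)%:E)).

Definition Gamma (a : R) : R :=
  fine (\int[@lebesgue_measure R]_(t in `]0%R, +oo[) (t `^ (a - 1) * expR (- t))%:E)%E.

Definition Gamma2 (p : nat) (a : R) : R :=
  pi `^ ((p * (p - 1))%:R / 2) * \prod_(i < p) Gamma (a - i%:R).

Definition Beta2const (p : nat) (a b : R) : R :=
  Gamma2 p a * Gamma2 p b / Gamma2 p (a + b).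

Definition beta2_density (p : nat) (a b : R) (X : 'M[C]_p) : R :=
  (complex.Re (\det X) `^ (a - p%:R) * complex.Re (\det (1%:M - X)) `^ (b - p%:R)) /
  Beta2const p a b.

Definition beta2_prob (p : nat) (a b : R) (B : set 'M[C]_p) : R :=
  fine (lebint (fun y : 'I_p * 'I_p -> R =>
    (\1_[set y | B (herm y) /\ lowner_lt 0 (herm y) /\ lowner_lt (herm y) 1%:M] y
     * beta2_density a b (herm y))%:E)).

End Defs.

(* Main.v *)
Require Import Defs.
From HB Require Import structures.
From mathcomp Require Import all_boot all_order all_algebra.
From mathcomp Require Import all_classical all_reals all_analysis.
From mathcomp Require Import complex measurable_realfun zify ring lra.
Set Implicit Arguments.
Unset Strict Implicit.
Unset Printing Implicit Defensive.
Import Order.TTheory GRing.Theory Num.Theory.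
Import numFieldNormedType.Exports.
Local Open Scope classical_set_scope.
Local Open Scope ring_scope.

(* The moments of a matrix measure on [0, 1] have nonnegative definite block
   Hankel matrices; conversely, if these are positive definite then, after a
   possible extension by a midpoint, diagonalizing the associated block Jacobi
   matrix represents the sequence by finitely many atoms.  Hence the moment
   space lies between the interior and every dilation of the interior, of
   ratio greater than 1, about one of its points, and both have the same volume.

   On the interior, D_k = S_k^+ - S_k^- satisfies
     D_(k+1)^-1 = (S_k - S_k^-)^-1 + (S_k^+ - S_k)^-1,
   a parallel sum, so that det D_(k+1) = det D_k det U_k det (1 - U_k).
   Integrating S_n, S_(n-1), ... one after the other with the substitution
   S_k = S_k^- + D_k^(1/2) U_k D_k^(1/2), whose Jacobian is (det D_k)^p, each
   step turns (det D_(k+1))^(p (n-k)) into (det D_k)^(p (n-k+1)) times the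
   integral of (det U_k det (1 - U_k))^(p (n-k)): the U_k are independent with
   the announced beta densities. *)

(** * Positive definite matrices and Schur complements *)

(** Three obstacles shape the proof. The moment space is not shown to be measurable: its indicator
    is only compared with that of the interior, by monotonicity of the integral as a supremum over
    simple functions, while the changes of variables act on functions whose measurability follows
    from minors. Next, [lebint] is an iterated one-dimensional integral, so every substitution is
    reduced to triangular ones, one affine substitution per coordinate. The congruence by D_k^(1/2)
    is not triangular in the coordinates of [herm]; writing D_k^(1/2) = L L^* with L lower
    triangular splits it into congruences by L^* and by L, each triangular for a suitable order of
    the coordinates. Finally the beta constants come from bordering: integrating over the last row
    and column of a matrix leaves a matrix of smaller size, raises both exponents by one and
    contributes the integral of a power over a ball. The volume of the interior is then a finite
    positive product of such constants, which also provides the interior point needed for the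
    dilations. *)

Section ConjTranspose.
Variable R : realType.
Local Notation C := R[i].

Lemma ctrE m n (A : 'M[C]_(m, n)) i j : ctr A i j = conjc (A j i).
Proof. by rewrite /ctr !mxE. Qed.

Lemma conjcM (x y : C) : conjc (x * y) = conjc x * conjc y.
Proof. exact: rmorphM. Qed.

Lemma ctrK m n (A : 'M[C]_(m, n)) : ctr (ctr A) = A.
Proof. by apply/matrixP => i j; rewrite !ctrE conjcK. Qed.

Lemma ctrM m n k (A : 'M[C]_(m, n)) (B : 'M[C]_(n, k)) :
  ctr (A *m B) = ctr B *m ctr A.
Proof. by rewrite /ctr map_mxM trmx_mul. Qed.

Lemma ctrD m n (A B : 'M[C]_(m, n)) : ctr (A + B) = ctr A + ctr B.
Proof. by rewrite /ctr map_mxD linearD. Qed.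

Lemma ctrN m n (A : 'M[C]_(m, n)) : ctr (- A) = - ctr A.
Proof. by rewrite /ctr map_mxN linearN. Qed.

Lemma ctrB m n (A B : 'M[C]_(m, n)) : ctr (A - B) = ctr A - ctr B.
Proof. by rewrite ctrD ctrN. Qed.

Lemma ctr0 m n : ctr (0 : 'M[C]_(m, n)) = 0.
Proof. by rewrite /ctr map_mx0 trmx0. Qed.

Lemma ctr1 n : ctr (1%:M : 'M[C]_n) = 1%:M.
Proof. by rewrite /ctr map_mx1 trmx1. Qed.

Lemma ctrZ m n (a : R) (A : 'M[C]_(m, n)) : ctr (a%:C%C *: A) = a%:C%C *: ctr A.
Proof.
by apply/matrixP => i j; rewrite !(ctrE, mxE) conjcM conjc_real.
Qed.

Lemma ctr_inv n (A : 'M[C]_n) : ctr (invmx A) = invmx (ctr A).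
Proof. by rewrite /ctr map_invmx trmx_inv. Qed.

Lemma ctr_eq0 m n (A : 'M[C]_(m, n)) : (ctr A == 0) = (A == 0).
Proof.
apply/eqP/eqP => [h|->]; last exact: ctr0.
by rewrite -[A]ctrK h ctr0.
Qed.

Lemma det_ctr n (A : 'M[C]_n) : \det (ctr A) = conjc (\det A).
Proof. by rewrite /ctr det_tr det_map_mx. Qed.

Definition qform n (A : 'M[C]_n) (v : 'cV[C]_n) : C := (ctr v *m A *m v) 0 0.

Lemma qformD n (A B : 'M[C]_n) v : qform (A + B) v = qform A v + qform B v.
Proof. by rewrite /qform mulmxDr mulmxDl mxE. Qed.

Lemma qformZ n a (A : 'M[C]_n) v : qform (a *: A) v = a * qform A v.
Proof. by rewrite /qform -scalemxAr -scalemxAl mxE. Qed.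

Lemma qform_congr m n (M : 'M[C]_(m, n)) (A : 'M[C]_m) v :
  qform (ctr M *m A *m M) v = qform A (M *m v).
Proof. by rewrite /qform ctrM !mulmxA. Qed.

Lemma qform1E n (v : 'cV[C]_n) :
  qform 1%:M v = \sum_i v i 0 * conjc (v i 0).
Proof.
by rewrite /qform mulmx1 mxE; apply: eq_bigr => i _; rewrite ctrE mulrC.
Qed.

Lemma herm_inv n (A : 'M[C]_n) : herm_mx A -> herm_mx (invmx A).
Proof. by rewrite /herm_mx ctr_inv => ->. Qed.

Lemma herm_congr m n (M : 'M[C]_(m, n)) (A : 'M[C]_m) :
  herm_mx A -> herm_mx (ctr M *m A *m M).
Proof. by rewrite /herm_mx => h; rewrite !ctrM h ctrK mulmxA. Qed.

Lemma hermD n (A B : 'M[C]_n) : herm_mx A -> herm_mx B -> herm_mx (A + B).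
Proof. by rewrite /herm_mx ctrD => -> ->. Qed.

Lemma hermB n (A B : 'M[C]_n) : herm_mx A -> herm_mx B -> herm_mx (A - B).
Proof. by rewrite /herm_mx ctrB => -> ->. Qed.

Lemma hermZ n (a : R) (A : 'M[C]_n) : herm_mx A -> herm_mx (a%:C%C *: A).
Proof. by rewrite /herm_mx ctrZ => ->. Qed.

Lemma herm1 n : herm_mx (1%:M : 'M[C]_n).
Proof. exact: ctr1. Qed.

Lemma herm0 n : herm_mx (0 : 'M[C]_n).
Proof. exact: ctr0. Qed.

Lemma psd0 n : psd (0 : 'M[C]_n).
Proof. by split=> [|v]; [exact: herm0 | rewrite mulmx0 mul0mx mxE]. Qed.

Lemma psdD n (A B : 'M[C]_n) : psd A -> psd B -> psd (A + B).
Proof.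
move=> [hA pA] [hB pB]; split=> [|v]; first exact: hermD.
rewrite -/(qform _ _) qformD; apply: addr_ge0; [exact: pA|exact: pB].
Qed.

Lemma psdZ n (a : R) (A : 'M[C]_n) : 0 <= a -> psd A -> psd (a%:C%C *: A).
Proof.
move=> a0 [hA pA]; split=> [|v]; first exact: hermZ.
by rewrite -/(qform _ _) qformZ; apply: mulr_ge0; [rewrite ler0c|exact: pA].
Qed.

Lemma psd_congr m n (M : 'M[C]_(m, n)) (A : 'M[C]_m) :
  psd A -> psd (ctr M *m A *m M).
Proof.
move=> [hA pA]; split=> [|v]; first exact: herm_congr.
by rewrite -/(qform _ _) qform_congr; exact: pA.
Qed.

Lemma pd_psd n (A : 'M[C]_n) : pd A -> psd A.
Proof.
move=> [hA pA]; split=> // v.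
have [->|v0] := eqVneq v 0; first by rewrite mulmx0 mxE.
exact/ltW/pA.
Qed.

Lemma pdD n (A B : 'M[C]_n) : pd A -> psd B -> pd (A + B).
Proof.
move=> [hA pA] [hB pB]; split=> [|v v0]; first exact: hermD.
rewrite -/(qform _ _) qformD; apply: ltr_wpDr; [exact: pB|exact: pA].
Qed.

Lemma pdZ n (a : R) (A : 'M[C]_n) : 0 < a -> pd A -> pd (a%:C%C *: A).
Proof.
move=> a0 [hA pA]; split=> [|v v0]; first exact: hermZ.
by rewrite -/(qform _ _) qformZ; apply: mulr_gt0; [rewrite ltcR|exact: pA].
Qed.

Lemma pd1 n : pd (1%:M : 'M[C]_n).
Proof.
split=> [|v v0]; first exact: herm1.
rewrite -/(qform _ _) qform1E lt_neqAle sumr_ge0 ?andbT; last first.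
  by move=> i _; exact: mulcJ_ge0.
apply: contra v0; rewrite eq_sym psumr_eq0; last by move=> i _; exact: mulcJ_ge0.
move=> /allP h; apply/eqP/matrixP => i j; rewrite (ord1 j) mxE.
have := h i (mem_index_enum i); rewrite implyTb -sqr_normc.
by rewrite expf_eq0 /= normr_eq0 => /eqP.
Qed.

Lemma unitmx_ker0 n (A : 'M[C]_n) :
  (forall v : 'cV_n, A *m v = 0 -> v = 0) -> A \in unitmx.
Proof.
move=> h; rewrite -unitmx_tr -row_free_unit -kermx_eq0.
apply/eqP/row_matrixP => i; rewrite row0.
have hk : row i (kermx A^T) *m A^T = 0 by rewrite -row_mul mulmx_ker row0.
apply: trmx_inj; rewrite trmx0; apply: h.
by apply: trmx_inj; rewrite trmx_mul trmxK hk trmx0.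
Qed.

Lemma pd_unit n (A : 'M[C]_n) : pd A -> A \in unitmx.
Proof.
move=> [_ pA]; apply: unitmx_ker0 => v Av.
apply/eqP/negPn/negP => /pA.
by rewrite -mulmxA Av mulmx0 mxE ltxx.
Qed.

Lemma pd_congr m n (M : 'M[C]_(m, n)) (A : 'M[C]_m) :
  (forall v : 'cV_n, M *m v = 0 -> v = 0) -> pd A -> pd (ctr M *m A *m M).
Proof.
move=> hM [hA pA]; split=> [|v v0]; first exact: herm_congr.
by rewrite -/(qform _ _) qform_congr; apply: pA; apply: contra v0 => /eqP/hM/eqP.
Qed.

Lemma unitmx_inj n k (M : 'M[C]_n) (v : 'M[C]_(n, k)) :
  M \in unitmx -> M *m v = 0 -> v = 0.
Proof. by move=> uM h; rewrite -[v](mulKmx uM) h mulmx0. Qed.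

Lemma pd_congr_unit n (M A : 'M[C]_n) :
  M \in unitmx -> pd (ctr M *m A *m M) <-> pd A.
Proof.
move=> uM; split=> [h|]; last by apply: pd_congr => v; exact: unitmx_inj.
have uMi : invmx M \in unitmx by rewrite unitmx_inv.
have E : ctr (invmx M) *m (ctr M *m A *m M) *m invmx M = A.
  rewrite -(mulmxA (ctr M)) (mulmxA (ctr (invmx M))) -(ctrM M) (mulmxV uM) ctr1.
  by rewrite mul1mx -mulmxA (mulmxV uM) mulmx1.
by rewrite -E; apply: pd_congr h => v; exact: unitmx_inj.
Qed.

Lemma pd_inv n (A : 'M[C]_n) : pd A -> pd (invmx A).
Proof.
move=> pA; have uA := pd_unit pA.
have [hA _] := pA.
by rewrite -(pd_congr_unit (invmx A) uA) hA (mulmxV uA) mul1mx.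
Qed.

Lemma pd0 (A : 'M[C]_0) : pd A.
Proof.
split; first by apply/matrixP => -[].
by move=> v; rewrite (flatmx0 v) eqxx.
Qed.

End ConjTranspose.

Section Schur.
Variables (R : realType) (N N' p : nat).
Local Notation C := R[i].
Variables (J : 'M[C]_(N', N)) (E : 'M[C]_(N, p)).

(* J and ctr E are the projections of a splitting of C^N into C^N' and C^p; this
   replaces block matrices, whose dimensions would have to be cast. *)
Record split_frame : Prop := SplitFrame {
  frame_JJ : J *m ctr J = 1%:M;
  frame_EE : ctr E *m E = 1%:M;
  frame_JE : J *m E = 0;
  frame_sum : ctr J *m J + E *m ctr E = 1%:M }.

Hypothesis fr : split_frame.

Definition schur (H : 'M[C]_N) : 'M[C]_p :=
  ctr E *m H *m E - ctr (J *m H *m E) *m invmx (J *m H *m ctr J) *m (J *m H *m E).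

Lemma frame_EJ : ctr E *m ctr J = 0.
Proof. by rewrite -ctrM frame_JE // ctr0. Qed.

(** [E] corrected by a term in the range of [ctr J] so that [H] sends the result back into the range
    of [E]; congruence by it produces the Schur complement. *)
Definition schur_vec (H : 'M[C]_N) : 'M[C]_(N, p) :=
  E - ctr J *m invmx (J *m H *m ctr J) *m (J *m H *m E).

Lemma frame_split k (A : 'M[C]_(N, k)) : A = ctr J *m (J *m A) + E *m (ctr E *m A).
Proof. by rewrite !mulmxA -mulmxDl frame_sum // mul1mx. Qed.

Lemma frame_eq k (A B : 'M[C]_(N, k)) :
  J *m A = J *m B -> ctr E *m A = ctr E *m B -> A = B.
Proof. by move=> h1 h2; rewrite (frame_split A) (frame_split B) h1 h2. Qed.

Lemma E_schur_vec H : ctr E *m schur_vec H = 1%:M.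
Proof.
by rewrite /schur_vec mulmxBr frame_EE // !mulmxA frame_EJ !mul0mx subr0.
Qed.

Variable H : 'M[C]_N.
Hypothesis hH : herm_mx H.
Hypothesis uJ : J *m H *m ctr J \in unitmx.

Lemma mul_schur_vec : H *m schur_vec H = E *m schur H.
Proof.
apply: frame_eq.
  rewrite mulmxA [in RHS]mulmxA frame_JE // mul0mx /schur_vec mulmxBr.
  by rewrite !mulmxA mulmxV // mul1mx subrr.
rewrite [in RHS]mulmxA frame_EE // mul1mx /schur_vec /schur mulmxBr mulmxBr.
by rewrite !ctrM hH !mulmxA.
Qed.

Lemma congr_schur_vec : ctr (schur_vec H) *m H *m schur_vec H = schur H.
Proof.
have zE : ctr (schur_vec H) *m E = 1%:M.
  by rewrite -[LHS]ctrK ctrM ctrK E_schur_vec ctr1.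
by rewrite -mulmxA mul_schur_vec mulmxA zE mul1mx.
Qed.

(** Apply [invmx H] to [mul_schur_vec] and project by [ctr E]: the corner of the inverse inverts the
    Schur complement. *)
Lemma schur_inv : H \in unitmx ->
  schur H \in unitmx /\ invmx (schur H) = ctr E *m invmx H *m E.
Proof.
move=> uH.
have h : ctr E *m invmx H *m E *m schur H = 1%:M.
  by rewrite -mulmxA -mul_schur_vec mulmxA -[_ *m H]mulmxA mulVmx // mulmx1 E_schur_vec.
have [h1 h2] := mulmx1_unit h.
by split=> //; rewrite -[RHS]mulmx1 -(mulmxV h2) mulmxA h mul1mx.
Qed.

Lemma pd_schur : pd H <-> pd (J *m H *m ctr J) /\ pd (schur H).
Proof.
split=> [pH|[pJ pS]].
  split.
    have := @pd_congr _ _ _ (ctr J) H; rewrite ctrK; apply => // v h.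
    by rewrite -[v]mul1mx -(frame_JJ fr) -mulmxA h mulmx0.
  rewrite -congr_schur_vec; apply: pd_congr => // v h.
  by rewrite -[v]mul1mx -(E_schur_vec H) -mulmxA h mulmx0.
split=> // v v0.
(* In the coordinates [a], [b] the form [H] is block diagonal, because [schur_vec H] is
   [H]-orthogonal to the range of [ctr J]. *)
pose b := ctr E *m v; pose a := J *m (v - schur_vec H *m b).
have Ev : v = ctr J *m a + schur_vec H *m b.
  apply: frame_eq.
    by rewrite mulmxDr mulmxA frame_JJ // mul1mx /a mulmxBr addrNK.
  by rewrite mulmxDr !mulmxA frame_EJ E_schur_vec mul1mx !mul0mx add0r.
have cross : ctr (ctr J *m a) *m H *m (schur_vec H *m b) = 0.
  by rewrite ctrM ctrK -!mulmxA (mulmxA H) mul_schur_vec !(mulmxA J) frame_JE //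
             !mul0mx !mulmx0.
have cross' : ctr (schur_vec H *m b) *m H *m (ctr J *m a) = 0.
  apply/eqP; rewrite -ctr_eq0; apply/eqP.
  by rewrite -cross ctrM (ctrM _ H) hH ctrK mulmxA.
have fv : qform H v = qform (J *m H *m ctr J) a + qform (schur H) b.
  have -> : qform (J *m H *m ctr J) a = qform H (ctr J *m a).
    by rewrite -qform_congr ctrK.
  rewrite -congr_schur_vec qform_congr {1}Ev.
  move: (schur_vec H *m b) (ctr J *m a) cross cross' => y x cross cross'.
  by rewrite /qform ctrD mulmxDl mulmxDl !(mulmxDr (_ *m H)) cross cross' addr0 add0r mxE.
rewrite -/(qform _ _) fv.
have [b0|b0] := eqVneq b 0.
  apply: ltr_wpDr; first exact: (pd_psd pS).2.
  apply: pJ.2; apply: contra v0 => /eqP a0.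
  by rewrite Ev a0 b0 !mulmx0 addr0.
by apply: ltr_pwDr; [exact: pS.2|exact: (pd_psd pJ).2].
Qed.

End Schur.

Section BlockFrame.
Variables (R : realType) (m q : nat).
Local Notation C := R[i].

Definition topJ : 'M[C]_(m, m + q) := row_mx 1%:M 0.
Definition botE : 'M[C]_(m + q, q) := col_mx 0 1%:M.

Lemma ctr_row n k l (A : 'M[C]_(n, k)) (B : 'M[C]_(n, l)) :
  ctr (row_mx A B) = col_mx (ctr A) (ctr B).
Proof. by rewrite /ctr map_row_mx tr_row_mx. Qed.

Lemma ctr_col n k l (A : 'M[C]_(k, n)) (B : 'M[C]_(l, n)) :
  ctr (col_mx A B) = row_mx (ctr A) (ctr B).
Proof. by rewrite /ctr map_col_mx tr_col_mx. Qed.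

Lemma ctr_block n k n' k' (A : 'M[C]_(n, k)) (B : 'M[C]_(n, k'))
    (D : 'M[C]_(n', k)) (F : 'M[C]_(n', k')) :
  ctr (block_mx A B D F) = block_mx (ctr A) (ctr D) (ctr B) (ctr F).
Proof. by rewrite /ctr map_block_mx tr_block_mx. Qed.

Lemma block_frame : split_frame topJ botE.
Proof.
rewrite /topJ /botE; split.
- by rewrite ctr_row mul_row_col ctr1 ctr0 mulmx1 mulmx0 addr0.
- by rewrite ctr_col mul_row_col ctr1 ctr0 mulmx1 mulmx0 add0r.
- by rewrite mul_row_col mulmx1 mulmx0 addr0.
- rewrite ctr_row ctr_col ctr1 !ctr0 !mul_col_row !mulmx0 !mul0mx !mulmx1.
  by rewrite add_block_mx !add0r addr0 ctr1 mulmx1 -scalar_mx_block.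
Qed.

Variables (A : 'M[C]_m) (B : 'M[C]_(m, q)) (D : 'M[C]_q).

Definition hblock : 'M[C]_(m + q) := block_mx A B (ctr B) D.

Lemma topJ_block : topJ *m hblock *m ctr topJ = A.
Proof.
rewrite /topJ ctr_row ctr1 ctr0 /hblock mul_row_block mul_row_col.
by rewrite !mulmx0 !mul0mx !mul1mx mulmx1 !addr0.
Qed.

Lemma topJ_block_E : topJ *m hblock *m botE = B.
Proof.
rewrite /topJ /botE /hblock mul_row_block mul_row_col.
by rewrite !mulmx0 !mul0mx !mul1mx mulmx1 !addr0 add0r.
Qed.

Lemma botE_block : ctr botE *m hblock *m botE = D.
Proof.
rewrite /topJ /botE ctr_col ctr1 ctr0 /hblock mul_row_block mul_row_col.
by rewrite !mulmx0 !mul0mx !mul1mx mulmx1 !add0r.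
Qed.

Lemma schur_block : schur topJ botE hblock = D - ctr B *m invmx A *m B.
Proof. by rewrite /schur topJ_block topJ_block_E botE_block. Qed.

Lemma herm_hblock : herm_mx A -> herm_mx D -> herm_mx hblock.
Proof. by rewrite /herm_mx /hblock ctr_block ctrK => -> ->. Qed.

Lemma pd_hblock : herm_mx A -> herm_mx D ->
  pd hblock <-> pd A /\ pd (D - ctr B *m invmx A *m B).
Proof.
move=> hA hD; have hH := herm_hblock hA hD.
split=> [pH|[pA pS]].
  have pA : pd A.
    rewrite -topJ_block; have := @pd_congr _ _ _ (ctr topJ) hblock.
    rewrite ctrK; apply => // v h.
    by rewrite -[v]mul1mx -(frame_JJ block_frame) -mulmxA h mulmx0.
  split=> //; rewrite -schur_block.
  have uA : topJ *m hblock *m ctr (topJ) \in unitmx.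
    by rewrite topJ_block; exact: pd_unit.
  by have [_] := (pd_schur block_frame hH uA).1 pH.
apply/(pd_schur block_frame hH).
  by rewrite topJ_block; exact: pd_unit.
by rewrite topJ_block schur_block.
Qed.

Lemma det_hblock : A \in unitmx ->
  \det hblock = \det A * \det (D - ctr B *m invmx A *m B).
Proof.
move=> uA; have -> : hblock = block_mx A 0 (ctr B) 1%:M *m
    block_mx 1%:M (invmx A *m B) 0 (D - ctr B *m invmx A *m B).
  rewrite mulmx_block !mulmx1 !mulmx0 !mul0mx !mul1mx !addr0 mulmxA.
  by rewrite mulmxV // mul1mx mulmxA addrC subrK.
by rewrite det_mulmx det_lblock det_ublock !det1 mulr1 mul1r.
Qed.

End BlockFrame.

(** * Cholesky factorization, spectral theorem and square roots *)

Section Cholesky.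
Variable R : realType.
Local Notation C := R[i].

Lemma pd_scalar (A : 'M[C]_1) : pd A -> 0 < A 0 0.
Proof.
move=> [_ /(_ 1%:M)].
rewrite ctr1 mul1mx mulmx1; apply.
by apply/eqP => /matrixP/(_ 0 0); rewrite !mxE => /eqP; rewrite oner_eq0.
Qed.

Lemma pd_scalarP (A : 'M[C]_1) : pd A <-> 0 < A 0 0.
Proof.
split=> [|A0]; first exact: pd_scalar.
have -> : A = (complex.Re (A 0 0))%:C%C *: 1%:M.
  apply/matrixP => i j; rewrite !ord1 !mxE mulr1.
  by rewrite RRe_real // realE ltW.
apply: pdZ; last exact: pd1.
by rewrite -ltcR /= RRe_real // realE ltW.
Qed.

Definition lower_pos n (L : 'M[C]_n) :=
  is_trig_mx L /\ forall i, 0 < L i i.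

Lemma lower_pos_det n (L : 'M[C]_n) : lower_pos L ->
  0 < \det L.
Proof.
by move=> [tL pL]; rewrite det_trig //; apply: prodr_gt0 => i _; exact: pL.
Qed.

Lemma cholesky n (A : 'M[C]_n) : pd A ->
  exists L : 'M[C]_n, lower_pos L /\ A = L *m ctr L.
Proof.
elim: n A => [|n IH] A pA.
  exists 0; split; last by apply/matrixP => -[].
  by split=> [|[]//]; apply/is_trig_mxP => -[].
pose A1 : 'M[C]_(1 + n) := A.
pose a := ulsubmx A1; pose b := ursubmx A1; pose D := drsubmx A1.
have hA1 : ctr A1 = A1 by case: pA.
have EA : A1 = hblock a b D.
  rewrite -[LHS]submxK /hblock; congr block_mx.
  by rewrite /b -{1}hA1; apply/matrixP => i j; rewrite !(mxE, ctrE).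
have ha : herm_mx a.
  by rewrite /herm_mx /a -{2}hA1; apply/matrixP => i j; rewrite !(mxE, ctrE).
have hD : herm_mx D.
  by rewrite /herm_mx /D -{2}hA1; apply/matrixP => i j; rewrite !(mxE, ctrE).
have [pa pS] : pd a /\ pd (D - ctr b *m invmx a *m b).
  by apply (pd_hblock b ha hD).1; rewrite -EA.
have [L [[tL dL] EL]] := IH _ pS.
pose s : C := sqrtC (a 0 0).
have a0 := pd_scalar pa.
have s0 : 0 < s by rewrite sqrtC_gt0.
have sc : conjc s = s.
  by apply/CrealP; rewrite realE ltW.
have ss : s * s = a 0 0 by rewrite -expr2 sqrtCK.
(* The first column of the factor is forced by the first column of [A1]; the remaining block must
   factor the Schur complement. *)
pose L1 : 'M[C]_(1 + n) := block_mx s%:M 0 (s^-1 *: ctr b) L.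
suff EA1 : A1 = L1 *m ctr L1; first exists L1; first split => //; first split.
- rewrite (@is_trig_block_mx _ 1 n 1 n) //= eqxx tL andbT.
  by apply/is_trig_mxP => i j; rewrite !ord1.
- move=> i; have [k ->|k ->] := @split_ordP 1 n i.
    by rewrite [X in 0 < X](block_mxEul s%:M) mxE eqxx.
  by rewrite [X in 0 < X](block_mxEdr s%:M).
rewrite EA /hblock /L1 ctr_block mulmx_block ctr0.
rewrite !mul0mx !mulmx0 !addr0.
have cs : ctr (s%:M : 'M[C]_1) = s%:M.
  by apply/matrixP => i j; rewrite !(ctrE, mxE) !ord1 sc.
have cb : ctr (s^-1 *: ctr b) = s^-1 *: b.
  by apply/matrixP => i j; rewrite ctrE !mxE conjcM conjcK conjc_inv sc.
rewrite cs cb.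
have sV : s * s^-1 = 1 by rewrite mulfV // gt_eqF.
have ea : a = (s * s)%:M.
  by apply/matrixP => i j; rewrite !ord1 ss [a]mx11_scalar !mxE.
have ia : invmx a = (s^-1 * s^-1)%:M.
  by rewrite ea invmx_scalar invfM.
congr block_mx.
- by rewrite -scalar_mxM.
- by rewrite mul_scalar_mx scalerA sV scale1r.
- by rewrite mul_mx_scalar scalerA sV scale1r.
- rewrite -EL ia mul_mx_scalar -!scalemxAl -!scalemxAr scalerA.
  by rewrite addrC subrK.
Qed.

Lemma pd_det n (A : 'M[C]_n) : pd A -> 0 < \det A.
Proof.
move=> /cholesky[L [pL ->]]; rewrite det_mulmx det_ctr -sqr_normc.
by rewrite exprn_gt0 // normr_gt0 gt_eqF // lower_pos_det.
Qed.

End Cholesky.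

Section Spectral.
Variable R : realType.
Local Notation C := R[i].

Definition rdiag n (d : 'I_n -> R) : 'M[C]_n := diag_mx (\row_i (d i)%:C%C).

Lemma rdiagM n (d e : 'I_n -> R) :
  rdiag d *m rdiag e = rdiag (fun i => d i * e i).
Proof.
rewrite /rdiag mulmx_diag; congr diag_mx; apply/rowP => i.
by rewrite !mxE rmorphM.
Qed.

Lemma ctr_rdiag n (d : 'I_n -> R) : ctr (rdiag d) = rdiag d.
Proof.
apply/matrixP => i j; rewrite !(ctrE, mxE) eq_sym.
by case: eqVneq => [->|_]; rewrite ?mulr1n ?mulr0n ?conjc_real ?conjc0.
Qed.

Lemma qform_rdiag n (d : 'I_n -> R) v :
  qform (rdiag d) v = \sum_i (d i)%:C%C * (v i 0 * conjc (v i 0)).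
Proof.
rewrite /qform mxE; apply: eq_bigr => i _.
rewrite mul_mx_diag !mxE mulrAC mulrC.
by rewrite [conjc _ * _]mulrC.
Qed.

Lemma pd_rdiag n (d : 'I_n -> R) : (forall i, 0 < d i) -> pd (rdiag d).
Proof.
move=> d0.
have -> : rdiag d = ctr (rdiag (fun i => Num.sqrt (d i))) *m 1%:M *m
                    rdiag (fun i => Num.sqrt (d i)).
  rewrite ctr_rdiag mulmx1 rdiagM; congr rdiag; apply/funext => i.
  by rewrite -expr2 sqr_sqrtr // ltW.
apply: pd_congr (pd1 _ _) => v; apply: unitmx_inj.
rewrite unitmxE /rdiag det_diag unitfE; apply/prodf_neq0 => i _.
by rewrite mxE gt_eqF // ltcR sqrtr_gt0.
Qed.

(** The eigenvalues are taken in [R] rather than [C]: later they become atoms of measures on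
    [0, 1]. *)
Lemma herm_spectral n (A : 'M[C]_n) : herm_mx A ->
  exists (U : 'M[C]_n) (d : 'I_n -> R),
    [/\ U *m ctr U = 1%:M, ctr U *m U = 1%:M & A = ctr U *m rdiag d *m U].
Proof.
move=> hA.
have ctrEs k (M : 'M[C]_k) : map_mx Num.conj_op M^T = ctr M.
  by apply/matrixP => i j; rewrite ctrE !mxE.
have hA' : A \is hermsymmx.
  by apply/is_hermitianmxP; rewrite expr0 scale1r -[in LHS]hA ctrEs.
have /hermitian_normalmx /orthomx_spectralP EA := hA'.
have /mxOverP rd := hermitian_spectral_diag_real hA'.
have uU := spectral_unitarymx A.
set U := spectralmx A in EA uU.
have iU : invmx U = ctr U by rewrite invmx_unitary // ctrEs.
have uuU : U \in unitmx by exact: unitarymx_unit.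
exists U, (fun i => complex.Re (spectral_diag A 0 i)); split.
- by rewrite -iU mulmxV.
- by rewrite -iU mulVmx.
- rewrite {1}EA iU; congr (_ *m diag_mx _ *m _); apply/rowP => i.
  by rewrite mxE RRe_real.
Qed.

Lemma spectral_ge0 n (U : 'M[C]_n) (d : 'I_n -> R) : U *m ctr U = 1%:M ->
  psd (ctr U *m rdiag d *m U) -> forall i, 0 <= d i.
Proof.
move=> UU [_ h] i.
(* The test vector is the [i]-th eigenvector. *)
have := h (ctr U *m delta_mx i 0).
rewrite -/(qform _ _) qform_congr mulmxA UU mul1mx qform_rdiag (bigD1 i) //=.
rewrite big1 ?addr0 => [|j ji]; last by rewrite !mxE (negPf ji) /= mul0r mulr0.
by rewrite !mxE !eqxx conjc_nat /= !mulr1 ler0c.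
Qed.

Lemma psd_unit_pd n (A : 'M[C]_n) : psd A -> A \in unitmx -> pd A.
Proof.
move=> pA uA; have [U [d [UU U'U EA]]] := herm_spectral pA.1.
have d0 : forall i, 0 <= d i.
  by apply: (spectral_ge0 UU); rewrite -EA; exact: pA.
rewrite EA; apply: pd_congr => [v h|].
  by rewrite -[v]mul1mx -U'U -mulmxA h mulmx0.
apply: pd_rdiag => i; rewrite lt_neqAle d0 andbT eq_sym.
move: uA; rewrite EA unitmxE !det_mulmx /rdiag det_diag !unitrM => /andP[/andP[_ +] _].
rewrite unitfE => /prodf_neq0/(_ i isT); rewrite mxE.
by apply: contra => /eqP ->.
Qed.

Lemma pd_sqrt n (A : 'M[C]_n) : pd A -> exists X, psd X /\ X *m X = A.
Proof.
move=> pA; have [U [d [UU U'U EA]]] := herm_spectral pA.1.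
have d0 : forall i, 0 <= d i.
  by apply: (spectral_ge0 UU); rewrite -EA; exact: (pd_psd pA).
exists (ctr U *m rdiag (fun i => Num.sqrt (d i)) *m U); split.
  split=> [|v]; first by apply: herm_congr; rewrite /herm_mx ctr_rdiag.
  rewrite -/(qform _ _) qform_congr qform_rdiag sumr_ge0 // => i _.
  by rewrite mulr_ge0 ?mulcJ_ge0 // ler0c sqrtr_ge0.
rewrite EA -!mulmxA (mulmxA U) UU mul1mx (mulmxA (rdiag _)) rdiagM.
congr (_ *m (rdiag _ *m _)); apply/funext => i.
by rewrite -expr2 sqr_sqrtr.
Qed.

(** [msqrt] is a choice among nonnegative roots, which exist by [pd_sqrt]; any root of an invertible
    matrix is invertible, hence positive definite. *)
Lemma msqrt_pd n (A : 'M[C]_n) : pd A ->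
  pd (msqrt A) /\ msqrt A *m msqrt A = A.
Proof.
move=> pA; have [X PX] := pd_sqrt pA.
have [pS ES] := @xgetI _ 0 [set X | psd X /\ X *m X = A] X PX.
split; last exact: ES.
apply: (psd_unit_pd pS).
by have := pd_unit pA; rewrite -{1}ES unitmx_mul => /andP[].
Qed.

Lemma det_msqrt n (A : 'M[C]_n) : pd A -> \det (msqrt A) ^+ 2 = \det A.
Proof. by move=> /msqrt_pd[_ E]; rewrite -[in RHS]E det_mulmx. Qed.

End Spectral.

(** * Block Hankel matrices and the gap recursion *)

Section Pencil.
Variables (F : fieldType) (N p : nat).
Variables (E : 'M[F]_(N, p)) (E' : 'M[F]_(p, N)).
Variables (G H K Q : 'M[F]_N).
Hypotheses (uG : G \in unitmx) (uH : H \in unitmx) (uK : K \in unitmx).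
Hypotheses (EK : K = G - H) (EQ : Q = H - H *m invmx G *m H).

Lemma cornerD (M M' : 'M[F]_N) :
  E' *m (M + M') *m E = E' *m M *m E + E' *m M' *m E.
Proof. by rewrite mulmxDr mulmxDl. Qed.

Lemma cornerB (M M' : 'M[F]_N) :
  E' *m (M - M') *m E = E' *m M *m E - E' *m M' *m E.
Proof. by rewrite mulmxBr mulmxBl. Qed.

(** The hypothesis cancels [invmx G]. For Hankel matrices, where [J1] and [J2] drop the last and the
    first block row, it identifies rows of [Q] with rows of a Hankel matrix of differences. *)
Lemma shift_parallel N' (J1 J2 : 'M[F]_(N', N)) : J1 *m H = J2 *m G ->
  J1 *m Q = (J1 - J2) *m H.
Proof.
move=> sG.
by rewrite EQ mulmxBr mulmxBl !mulmxA sG -(mulmxA J2) (mulmxV uG) mulmx1.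
Qed.

(** For three consecutive Hankel matrices [G], [H], [X] the defect is thus concentrated in the last
    block row. *)
Lemma shift_defect N' (J1 J2 : 'M[F]_(N', N)) (X : 'M[F]_N) :
  J1 *m H = J2 *m G -> J1 *m X = J2 *m H -> J1 *m (X - H *m invmx G *m H) = 0.
Proof.
move=> sG sH.
by rewrite mulmxBr !mulmxA sG -(mulmxA J2) (mulmxV uG) mulmx1 sH subrr.
Qed.

Lemma corner_only N' (J : 'M[F]_(N', N)) (J' : 'M[F]_(N, N')) (Y : 'M[F]_N) :
  J' *m J + E *m E' = 1%:M -> J *m Y = 0 -> Y *m J' = 0 ->
  Y = E *m (E' *m Y *m E) *m E'.
Proof.
move=> sum1 JY YJ; rewrite -[LHS]mulmx1 -sum1 mulmxDr mulmxA YJ mul0mx add0r.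
rewrite -[Y in LHS]mul1mx -sum1 mulmxDl -(mulmxA J') JY mulmx0 add0r.
by rewrite !mulmxA.
Qed.

(** Since [G] is the sum of [H] and [K], [Q] equals [H *m invmx G *m K], the parallel sum of [H] and
    [K]. *)
Lemma parallel_unit : Q \in unitmx /\ invmx Q = invmx H + invmx K.
Proof.
have EQK : Q = H *m invmx G *m K.
  by rewrite EQ EK mulmxBr -(mulmxA H (invmx G) G) (mulVmx uG) mulmx1.
have h : Q *m (invmx H + invmx K) = 1%:M.
  rewrite mulmxDr {2}EQK -(mulmxA _ K (invmx K)) (mulmxV uK) mulmx1 EQ mulmxBl.
  by rewrite -(mulmxA _ H (invmx H)) (mulmxV uH) mulmx1 subrK.
have [uQ _] := mulmx1_unit h.
by split=> //; rewrite -[LHS]mulmx1 -h mulKmx.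
Qed.

Variables (X W Y : 'M[F]_N) (A B : 'M[F]_p).
Hypotheses (EW : W = H - X) (EY : Y = X - H *m invmx G *m H).
Hypotheses (EE : E' *m E = 1%:M) (EYA : Y = E *m A *m E').
Hypotheses (uW : W \in unitmx) (uA : A \in unitmx).
Hypothesis (iB : invmx B = E' *m invmx W *m E).

(** With c the corner of Q^-1, one finds D = A - A c A, while W = Q - E A E' gives the resolvent
    identity B^-1 - c = c A B^-1. Multiplying D by A^-1 + B^-1 then leaves the identity. *)
Lemma gap_inv (D := E' *m X *m E - E' *m X *m invmx H *m (X *m E)
      - (E' *m (H - X)) *m invmx K *m ((H - X) *m E)) :
  D \in unitmx /\ invmx D = invmx A + invmx B.
Proof.
have [uQ iQ] := parallel_unit.
have [c Ec] : exists c, c = E' *m invmx Q *m E by eexists.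
have [t Et] : exists t, t = invmx G *m (H *m E) by eexists.
have [t' Et'] : exists t', t' = E' *m H *m invmx G by eexists.
have GHK : G = H + K by rewrite EK addrC subrK.
have EX : X = Y + H *m invmx G *m H by rewrite EY subrK.
(* Both columns [X *m E] and [(H - X) *m E] are expressed by [t] and [A], with opposite signs in
   [A], so that the cross terms of the two quadratic expressions cancel. *)
have XE : X *m E = E *m A + H *m t.
  by rewrite EX mulmxDl EYA -(mulmxA (E *m A)) EE mulmx1 Et !mulmxA.
have XE' : E' *m X = A *m E' + t' *m H.
  by rewrite EX mulmxDr EYA !mulmxA EE mul1mx Et'.
have Gt : G *m t = H *m E by rewrite Et (mulKVmx uG).
have Gt' : t' *m G = E' *m H by rewrite Et' (mulmxKV uG).
have KE : (H - X) *m E = K *m t - E *m A.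
  by rewrite mulmxBl XE -Gt GHK mulmxDl opprD [- _ + _]addrC addrACA subrr add0r.
have KE' : E' *m (H - X) = t' *m K - A *m E'.
  by rewrite mulmxBr XE' -Gt' GHK mulmxDr opprD [- _ + _]addrC addrACA subrr add0r.
have q1 : E' *m X *m invmx H *m (X *m E) =
    A *m (E' *m invmx H *m E) *m A + A *m (E' *m t) + (t' *m E *m A + t' *m H *m t).
  rewrite XE XE' mulmxDl mulmxDl !(mulmxDr (_ *m invmx H)).
  rewrite -(mulmxA (A *m _) (invmx H) (H *m t)) (mulKmx uH) (mulmxK uH).
  by rewrite !mulmxA.
have q2 : E' *m (H - X) *m invmx K *m ((H - X) *m E) =
    A *m (E' *m invmx K *m E) *m A - A *m (E' *m t) + (t' *m K *m t - t' *m E *m A).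
  rewrite KE KE' mulmxBl mulmxBl !(mulmxBr (_ *m invmx K)).
  rewrite -(mulmxA (A *m _) (invmx K) (K *m t)) (mulKmx uK) (mulmxK uK).
  by rewrite !mulmxA opprB addrC.
have AE : A = E' *m X *m E - t' *m G *m t.
  rewrite XE' mulmxDl -(mulmxA A) EE mulmx1 -!mulmxA Gt.
  by rewrite addrK.
have DE : D = A - A *m c *m A.
  rewrite /D -addrA -opprD q1 q2.
  have -> : forall a b d e f h : 'M[F]_p,
      a + b + (d + e) + (f - b + (h - d)) = (a + f) + (e + h).
    move=> a b d e f h; rewrite addrACA (addrACA a) subrr addr0; congr (_ + _).
    by rewrite [h - d]addrC addrACA subrr add0r.
  rewrite -mulmxDl -mulmxDr -mulmxDl -mulmxDr -iQ -Ec.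
  rewrite -mulmxDl -mulmxDr -GHK opprD addrA [LHS]addrAC.
  by congr (_ - _); rewrite AE.
have WQ : W = Q - Y by rewrite EW EQ EY opprB addrA subrK.
(* Corner of W^-1 - Q^-1 = Q^-1 (Q - W) W^-1, where Q - W = Y = E A E'. *)
have key : invmx B - c = c *m A *m invmx B.
  have e1 : invmx W - invmx Q = invmx Q *m Y *m invmx W.
    have -> : Y = Q - W by rewrite WQ opprB addrC subrK.
    by rewrite mulmxBr (mulVmx uQ) mulmxBl mul1mx -mulmxA (mulmxV uW) mulmx1.
  by rewrite iB Ec -mulmxBl -mulmxBr e1 EYA !mulmxA.
have h : D *m (invmx A + invmx B) = 1%:M.
  rewrite DE mulmxBl !mulmxDr (mulmxV uA) -(mulmxA _ A (invmx A)) (mulmxV uA) mulmx1.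
  rewrite -(mulmxA A c A) -(mulmxA A (c *m A) (invmx B)) -key mulmxBr.
  by rewrite [A *m c + _]addrC subrK addrK.
have [uD _] := mulmx1_unit h.
by split=> //; rewrite -[LHS]mulmx1 -h mulKmx.
Qed.
End Pencil.

Section ShiftedPencil.
Variables (R : realType) (N N' p : nat).
Local Notation C := R[i].
Variables (J1 J2 : 'M[C]_(N', N)) (E : 'M[C]_(N, p)).
Hypothesis fr : split_frame J1 E.
Variables (G H K : 'M[C]_N).
Hypothesis EK : K = G - H.
Hypotheses (pG : pd G) (pH : pd H) (pK : pd K).
Hypothesis shiftG : J1 *m H = J2 *m G.

Lemma inv_schur_pd (M : 'M[C]_N) : pd M ->
  schur J1 E M \in unitmx /\ invmx (schur J1 E M) = ctr E *m invmx M *m E.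
Proof.
move=> pM; apply: (schur_inv fr pM.1 _ (pd_unit pM)).
apply: pd_unit; have := @pd_congr _ _ _ (ctr J1) M; rewrite ctrK; apply => // v h.
by rewrite -[v]mul1mx -(frame_JJ fr) -mulmxA h mulmx0.
Qed.

Lemma herm_HGH : herm_mx (H *m invmx G *m H).
Proof.
have [[hH _] [hG _]] := (pH, pG).
by have := herm_congr H (herm_inv hG); rewrite hH.
Qed.

(** Corner of [parallel_unit]. By [shift_parallel] the positivity hypothesis concerns the leading
    block of [Q], whose invertibility [schur_inv] requires. *)
Lemma schur_parallel (Q : 'M[C]_N) : Q = H - H *m invmx G *m H ->
  pd ((J1 - J2) *m H *m ctr J1) ->
  schur J1 E Q \in unitmx /\
  invmx (schur J1 E Q) = invmx (schur J1 E H) + invmx (schur J1 E K).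
Proof.
move=> EQ pW.
have [uQ iQ] := parallel_unit (pd_unit pG) (pd_unit pH) (pd_unit pK) EK EQ.
have uW : J1 *m Q *m ctr J1 \in unitmx.
  by rewrite (shift_parallel (pd_unit pG) EQ shiftG); exact: pd_unit.
have hQ : herm_mx Q by rewrite EQ; apply: hermB herm_HGH; case: pH.
have [u1 e1] := schur_inv fr hQ uW uQ.
split=> //; apply: (etrans e1).
rewrite iQ (cornerD E (ctr E) (invmx H) (invmx K)).
by congr (_ + _); symmetry; [exact: (inv_schur_pd pH).2|exact: (inv_schur_pd pK).2].
Qed.

Variables (X W : 'M[C]_N) (A D : 'M[C]_p).
Hypotheses (hX : herm_mx X) (shiftH : J1 *m X = J2 *m H).
Hypothesis EW : W = H - X.
Hypothesis pW : pd W.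
Hypothesis EA :
  A = ctr E *m X *m E - ctr E *m H *m invmx G *m (H *m E).
Hypothesis uA : A \in unitmx.
Hypothesis ED : D = ctr E *m X *m E - ctr E *m X *m invmx H *m (X *m E)
      - (ctr E *m (H - X)) *m invmx K *m ((H - X) *m E).

(** The two shift relations and hermitian symmetry confine X - H G^-1 H to its last corner, which is
    [A]; this is what [gap_inv] needs. *)
Lemma schur_gap :
  D \in unitmx /\ invmx D = invmx A + invmx (schur J1 E W).
Proof.
have [uB iB] := inv_schur_pd pW.
have [Y EY] : exists Y, Y = X - H *m invmx G *m H by eexists.
have JY : J1 *m Y = 0.
  by rewrite EY; exact: (shift_defect (pd_unit pG) shiftG shiftH).
have hY : ctr Y = Y by rewrite EY; apply: hermB herm_HGH.
have YJ : Y *m ctr J1 = 0 by rewrite -hY -ctrM JY ctr0.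
have AY : A = ctr E *m Y *m E.
  by rewrite EY cornerB EA !mulmxA.
have EYA : Y = E *m A *m ctr E.
  by rewrite AY; exact: (corner_only (frame_sum fr) JY YJ).
rewrite ED.
exact: (gap_inv (pd_unit pG) (pd_unit pH) (pd_unit pK) EK erefl EW EY
  (frame_EE fr) EYA (pd_unit pW) uA iB).
Qed.

End ShiftedPencil.

Section BlockShift.
Variables (F : fieldType) (p : nat).
Implicit Type S : nat -> 'M[F]_p.

(** Selects the block rows c, ..., c + m - 1 among [n]. With m = n - 1, the values c = 0 and c = 1
    drop the last and the first block, and so relate consecutive Hankel matrices. *)
Definition shmx c m n : 'M[F]_(\sum_(i < m) p, \sum_(j < n) p) :=
  \mxblock_(i < m, j < n) (if j == (i + c)%N :> nat then 1%:M else 0 : 'M[F]_p).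

Definition lastE m : 'M[F]_(\sum_(i < m.+1) p, p) :=
  \mxcol_(i < m.+1) (if i == m :> nat then 1%:M else 0 : 'M[F]_p).

(* Hlow S k is the case m = n = k./2.+1, e = odd k of hankr, and Hup S k is a
   Hankel matrix of the differences dS S defined below. *)
Definition hankr m n e S : 'M[F]_(\sum_(i < m) p, \sum_(j < n) p) :=
  \mxblock_(i < m, j < n) S (i + j + e)%N.

Definition hcol m c S : 'M[F]_(\sum_(i < m) p, p) :=
  \mxcol_(i < m) S (c + i)%N.

Lemma sum_delta q n (j0 : nat) (B : 'I_n -> 'M[F]_(p, q)) (b : 'M[F]_(p, q)) :
  (j0 < n)%N -> (forall j : 'I_n, j = j0 :> nat -> B j = b) ->
  \sum_(j < n) (if j == j0 :> nat then 1%:M else 0) *m B j = b.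
Proof.
move=> lt h; rewrite (bigD1 (Ordinal lt)) //= eqxx mul1mx (h (Ordinal lt)) //.
rewrite big1 ?addr0 // => j nj; rewrite ifF ?mul0mx //.
by apply: contraNF nj => /eqP e; apply/eqP/val_inj.
Qed.

Lemma sum_deltar q n (j0 : nat) (B : 'I_n -> 'M[F]_(q, p)) (b : 'M[F]_(q, p)) :
  (j0 < n)%N -> (forall j : 'I_n, j = j0 :> nat -> B j = b) ->
  \sum_(j < n) B j *m (if j == j0 :> nat then 1%:M else 0) = b.
Proof.
move=> lt h; rewrite (bigD1 (Ordinal lt)) //= eqxx mulmx1 (h (Ordinal lt)) //.
rewrite big1 ?addr0 // => j nj; rewrite ifF ?mulmx0 //.
by apply: contraNF nj => /eqP e; apply/eqP/val_inj.
Qed.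

Lemma tr_shmx c m n : (shmx c m n)^T =
  \mxblock_(j < n, i < m) (if j == (i + c)%N :> nat then 1%:M else 0 : 'M[F]_p).
Proof.
rewrite /shmx tr_mxblock; apply: eq_mxblock => i j.
by case: ifP; rewrite ?trmx1 ?trmx0.
Qed.

Lemma tr_lastE m : (lastE m)^T =
  \mxrow_(i < m.+1) (if i == m :> nat then 1%:M else 0 : 'M[F]_p).
Proof.
rewrite /lastE tr_mxcol; apply: eq_mxrow => i.
by case: ifP; rewrite ?trmx1 ?trmx0.
Qed.

Lemma shmx_hankr c m n k e S : (m + c <= n)%N ->
  shmx c m n *m hankr n k e S = hankr m k (e + c) S.
Proof.
move=> le; rewrite /shmx /hankr mul_mxblock; apply: eq_mxblock => i l.
apply: sum_delta => [|j ->].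
  by apply: leq_trans le; rewrite ltn_add2r.
by congr S; rewrite -!addnA; congr addn; rewrite addnC addnA.
Qed.

Lemma hankr_shmx c m n k e S : (m + c <= n)%N ->
  hankr k n e S *m (shmx c m n)^T = hankr k m (e + c) S.
Proof.
move=> le; rewrite tr_shmx /hankr mul_mxblock; apply: eq_mxblock => i l.
apply: sum_deltar => [|j ->].
  by apply: leq_trans le; rewrite ltn_add2r.
by congr S; rewrite -!addnA; congr (_ + (_ + _))%N; rewrite addnC.
Qed.

Lemma hankr_lastE m n e S : hankr m n.+1 e S *m lastE n = hcol m (n + e) S.
Proof.
rewrite /hankr /lastE mul_mxblock_mxrow; apply: eq_mxcol => i.
by apply: sum_deltar => // j ->; congr S; rewrite -addnA addnC.
Qed.

Lemma lastE_hcol m c S : (lastE m)^T *m hcol m.+1 c S = S (c + m)%N.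
Proof.
rewrite tr_lastE /hcol mul_mxrow_mxcol.
by apply: sum_delta => // j ->.
Qed.

Lemma shmx_trK m n : (m <= n)%N -> shmx 0 m n *m (shmx 0 m n)^T = shmx 0 m m.
Proof.
move=> le; rewrite tr_shmx /shmx mul_mxblock; apply: eq_mxblock => i l.
apply: sum_delta => [|j ->].
  by rewrite addn0 (leq_trans (ltn_ord i)).
by rewrite !addn0 eq_sym.
Qed.

Lemma lastE_trK m : (lastE m)^T *m lastE m = 1%:M.
Proof.
rewrite tr_lastE /lastE mul_mxrow_mxcol.
by apply: sum_delta => // j ->; rewrite eqxx.
Qed.

Lemma shmx_lastE m : shmx 0 m m.+1 *m lastE m = 0.
Proof.
rewrite /shmx /lastE mul_mxblock_mxrow -mxcol0; apply: eq_mxcol => i.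
apply: sum_delta => [|j ->]; rewrite addn0.
  by rewrite ltnS ltnW.
by rewrite ltn_eqF.
Qed.

Lemma shmx0E m : shmx 0 m m = 1%:M.
Proof.
apply/mxblockP => i j; rewrite mxblockK; apply/matrixP => k l.
rewrite !mxE addn0 -[tagnat.Rank _ _ == _]val_eqE tagnat.eq_Rank (inj_eq val_inj).
rewrite [j == i]eq_sym.
by have [/= ij|ij] := eqVneq i j; rewrite !mxE.
Qed.

Lemma shmx_sum m :
  (shmx 0 m m.+1)^T *m shmx 0 m m.+1 + lastE m *m (lastE m)^T = 1%:M.
Proof.
rewrite -shmx0E tr_shmx tr_lastE /shmx /lastE mul_mxblock mul_mxcol_mxrow.
rewrite -mxblockD; apply: eq_mxblock => i j; rewrite addn0.
have [ltm|gem] := ltnP i m; last first.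
  have em : i = m :> nat by apply/anti_leq; rewrite gem -ltnS ltn_ord.
  rewrite em eqxx mul1mx big1 ?add0r 1?eq_sym // => l _.
  by rewrite addn0 gtn_eqF // mul0mx.
rewrite (ltn_eqF ltm) mul0mx addr0.
under eq_bigr do rewrite addn0 eq_sym.
by apply: sum_delta => // l ->; rewrite eq_sym.
Qed.

End BlockShift.

Lemma addrB_cancel (V : zmodType) (a b x y : V) :
  (a - x) + (b - a - y) = b - x - y.
Proof. by rewrite addrACA [a + _]addrC subrK addrA. Qed.

Section HankelGaps.
Variables (R : realType) (p : nat).
Local Notation C := R[i].
Implicit Type S : nat -> 'M[C]_p.

Definition dS S k : 'M[C]_p := S k - S k.+1.

(** The Schur complement of the leading [m] blocks in [hankr m.+1 m.+1 e S] (see [schurHE]). *)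
Definition schurH m e S : 'M[C]_p :=
  S (m + e + m)%N -
  ctr (hcol m (m + e) S) *m invmx (hankr m m e S) *m hcol m (m + e) S.

Lemma ctr_shmx c m n : ctr (shmx C p c m n) = (shmx C p c m n)^T.
Proof.
apply/matrixP => i j; rewrite ctrE [in RHS]mxE /shmx mxE.
by case: ifP => _; rewrite mxE ?conjc_nat ?conjc0.
Qed.

Lemma ctr_lastE m : ctr (lastE C p m) = (lastE C p m)^T.
Proof.
apply/matrixP => i j; rewrite ctrE [in RHS]mxE /lastE mxE.
by case: ifP => _; rewrite mxE ?conjc_nat ?conjc0.
Qed.

Lemma shift_frame m : split_frame (shmx C p 0 m m.+1) (lastE C p m).
Proof.
split; rewrite ?ctr_shmx ?ctr_lastE.
- by rewrite shmx_trK // shmx0E.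
- exact: lastE_trK.
- exact: shmx_lastE.
- exact: shmx_sum.
Qed.

Lemma ctr_hankr m n e S : (forall k, herm_mx (S k)) ->
  ctr (hankr m n e S) = hankr n m e S.
Proof.
move=> hS; rewrite /hankr /ctr.
have -> : map_mx (@conjc R) (\mxblock_(i < m, j < n) S (i + j + e)%N) =
    \mxblock_(i < m, j < n) map_mx (@conjc R) (S (i + j + e)%N).
  by apply/matrixP => i j; rewrite !mxE.
rewrite tr_mxblock; apply: eq_mxblock => i j.
by rewrite [(j + i)%N]addnC; exact: hS.
Qed.

Lemma herm_dS S : (forall k, herm_mx (S k)) -> forall k, herm_mx (dS S k).
Proof. by move=> hS k; apply: hermB. Qed.

Lemma schurHE m e S : (forall k, herm_mx (S k)) ->
  schur (shmx C p 0 m m.+1) (lastE C p m) (hankr m.+1 m.+1 e S) = schurH m e S.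
Proof.
move=> hS; have le : (m + 0 <= m.+1)%N by rewrite addn0.
rewrite /schur /schurH ctr_shmx ctr_lastE (shmx_hankr _ _ _ le).
rewrite (hankr_shmx _ _ _ le) hankr_lastE !addn0.
congr (_ - _); rewrite -mulmxA hankr_lastE.
by rewrite lastE_hcol addnAC.
Qed.

Lemma pd_hank m e S : (forall k, herm_mx (S k)) ->
  pd (hankr m.+1 m.+1 e S) <-> pd (hankr m m e S) /\ pd (schurH m e S).
Proof.
move=> hS; have hH : herm_mx (hankr m.+1 m.+1 e S) by exact: ctr_hankr.
have EJ : shmx C p 0 m m.+1 *m hankr m.+1 m.+1 e S *m ctr (shmx C p 0 m m.+1) =
          hankr m m e S.
  have le : (m + 0 <= m.+1)%N by rewrite addn0.
  by rewrite ctr_shmx (shmx_hankr _ _ _ le) (hankr_shmx _ _ _ le) !addn0.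
rewrite -(schurHE m e hS) -EJ; split=> [pH|[pJ pS]].
  have pJ : pd (hankr m m e S).
    rewrite -EJ; have := @pd_congr _ _ _ (ctr (shmx C p 0 m m.+1)) (hankr m.+1 m.+1 e S).
    rewrite ctrK; apply => // v h.
    by rewrite -[v]mul1mx -(frame_JJ (shift_frame m)) -mulmxA h mulmx0.
  apply (pd_schur (shift_frame m) hH) => //.
  by rewrite EJ; exact: pd_unit.
by apply/(pd_schur (shift_frame m) hH) => //; exact: pd_unit.
Qed.

(** The size is an empty sum, equal to 0 only by rewriting, hence the generalization of the matrix
    first. *)
Lemma pd_hank0 e S : pd (hankr 0 0 e S).
Proof. by rewrite /hankr; move: (\mxblock_(_, _) _); rewrite big_ord0; exact: pd0. Qed.

Lemma mulmx_sum0 (M : 'M[C]_(p, \sum_(i < 0) p)) (N : 'M[C]_(\sum_(i < 0) p, p)) :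
  M *m N = 0.
Proof. by move: M N; rewrite big_ord0 => M N; rewrite thinmx0 mul0mx. Qed.

Lemma schurH0 e S : schurH 0 e S = S e.
Proof. by rewrite /schurH mulmx_sum0 subr0 addn0. Qed.

(** The special cases [k = 0, 1] of [Sminus] become Schur complements over an empty Hankel
    matrix. *)
Lemma SminusE S k : S k - Sminus S k = schurH k./2 (odd k) S.
Proof.
case: k => [|[|k]]; [by rewrite schurH0 subr0|by rewrite schurH0 subr0|].
have ek : k = (odd k + k./2.*2)%N by rewrite odd_double_half.
rewrite /= negbK /schurH; congr (S _ - _).
  lia.
have -> : (k./2.+1 + odd k)%N = (k.+1 - k./2)%N.
  lia.
by [].
Qed.

(** The differences play for the upper bound the role of the moments for the lower one; the index
    drops by one because [dS S k] already involves [S k.+1]. *)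
Lemma SplusE S k : S 0 = 1%:M -> Splus S k.+1 - S k.+1 = schurH k./2 (odd k) (dS S).
Proof.
move=> S0; case: k => [|k]; first by rewrite schurH0 /dS S0.
have ek : k = (odd k + k./2.*2)%N by rewrite odd_double_half.
rewrite /Splus -addrA [- _ + _]addrC addrA /schurH; congr (_ - _).
  rewrite /dS; suff -> : (k.+1./2 + odd k.+1 + k.+1./2)%N = k.+1 by [].
  by rewrite addnAC addnn addnC odd_double_half.
have -> : (k.+1./2 + odd k.+1)%N = uphalf k.+1.
  by rewrite -[k.+1./2]/(uphalf k) uphalf_half /=; case: (odd k); rewrite /= ?addn0 ?addn1.
by [].
Qed.

Definition inter n S := forall k, (k < n)%N ->
  pd (S k.+1 - Sminus S k.+1) /\ pd (Splus S k.+1 - S k.+1).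

Variable S : nat -> 'M[C]_p.
Hypotheses (hS : forall k, herm_mx (S k)) (S0 : S 0 = 1%:M).

Lemma half_bit m (e : bool) : (m.*2 + e)./2 = m.
Proof. by rewrite addnC half_bit_double. Qed.

Lemma odd_bit m (e : bool) : odd (m.*2 + e) = e.
Proof. by rewrite oddD odd_double; case: e. Qed.

(** Induction on [m] through [pd_hank]. The last entry of the Hankel matrix of [S] has index 2m + e,
    and that of its differences involves 2m + e + 1, hence the large and the strict bound. *)
Lemma inter_hankP n : inter n S <->
  (forall m (e : bool), (m.*2 + e <= n)%N -> pd (hankr m.+1 m.+1 e S)) /\
  (forall m (e : bool), (m.*2 + e < n)%N -> pd (hankr m.+1 m.+1 e (dS S))).
Proof.
split=> [int|[hl hu] k kn]; last first.
  split.
    rewrite SminusE; have := hl k.+1./2 (odd k.+1).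
    rewrite addnC odd_double_half => /(_ kn).
    by move=> /(pd_hank _ _ hS)[].
  rewrite SplusE //; have := hu k./2 (odd k).
  rewrite addnC odd_double_half => /(_ kn).
  by move=> /(pd_hank _ _ (herm_dS hS))[].
split=> m e; elim: m => [|m IH] len.
- apply/(pd_hank _ _ hS); split; first exact: pd_hank0.
  rewrite schurH0; case: e len => [|_] /=; last by rewrite S0; exact: pd1.
  by move=> /int[] /=; rewrite subr0.
- apply/(pd_hank _ _ hS); split.
    by apply: IH; apply: leq_trans len; rewrite leq_add2r leq_double.
  have := SminusE S (m.+1.*2 + e); rewrite half_bit odd_bit => <-.
  case E : (m.+1.*2 + e)%N => [|k]; first by rewrite addnC doubleS addnS in E.
  by rewrite E in len; case: (int k len).
- apply/(pd_hank _ _ (herm_dS hS)); split; first exact: pd_hank0.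
  have := SplusE (0.*2 + e) S0; rewrite half_bit odd_bit => <-.
  by case: (int _ len).
- apply/(pd_hank _ _ (herm_dS hS)); split.
    by apply: IH; apply: leq_ltn_trans len; rewrite leq_add2r leq_double.
  have := SplusE (m.+1.*2 + e) S0; rewrite half_bit odd_bit => <-.
  by case: (int _ len).
Qed.

Lemma hankrB m n e : hankr m n e (dS S) = hankr m n e S - hankr m n e.+1 S.
Proof.
rewrite /hankr -mxblockB; apply: eq_mxblock => i j.
by rewrite /dS addnS.
Qed.

Lemma hcolB m c : hcol m c (dS S) = hcol m c S - hcol m c.+1 S.
Proof. by rewrite /hcol -mxcolB; apply: eq_mxcol => i; rewrite /dS addSn. Qed.

Lemma ctr_hcol m n e :
  ctr (hcol m (n + e) S) = ctr (lastE C p n) *m hankr n.+1 m e S.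
Proof. by rewrite -hankr_lastE ctrM ctr_hankr. Qed.

Lemma schurH_dS m e : schurH m e (dS S) = S (m + e + m)%N - S (m + e + m).+1 -
  ctr (hcol m (m + e) (dS S)) *m invmx (hankr m m e (dS S)) *m hcol m (m + e) (dS S).
Proof. by []. Qed.

(* For consecutive Hankel matrices G, H and K = G - H, the matrix
   Q = H - H G^-1 H satisfies Q^-1 = H^-1 + K^-1; the last-block corners of these
   inverses are the inverses of the Schur complements in the statement. *)
Lemma gap_rec k : inter k.+1 S ->
  let D := Splus S k.+2 - Sminus S k.+2 in
  D \in unitmx /\
  invmx D = invmx (S k.+1 - Sminus S k.+1) + invmx (Splus S k.+1 - S k.+1).
Proof.
move=> int D; have [hl hu] := (inter_hankP k.+1).1 int.
have ED : D = schurH k.+2./2 (odd k.+2) S + schurH k.+1./2 (odd k.+1) (dS S).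
  by rewrite -SminusE -SplusE // addrC addrA subrK.
have [uA uB] : S k.+1 - Sminus S k.+1 \in unitmx /\ Splus S k.+1 - S k.+1 \in unitmx.
  by have [pA pB] := int k (ltnSn _); split; exact: pd_unit.
move: uA uB; rewrite SminusE SplusE // => uA uB.
have ek : (k./2.*2 + odd k)%N = k by rewrite addnC odd_double_half.
set m := k./2 in ek *.
have le0 : (m + 0 <= m.+1)%N by rewrite addn0.
have le1 : (m + 1 <= m.+1)%N by rewrite addn1.
case: (boolP (odd k)) => ok; rewrite /= ?ok ?(negPf ok) /= in ek ED uA uB *.
(* Odd [k]: the gap involves the next shift [hankr _ _ 2 S], which is the [X] of [schur_gap]. *)
- have eu : uphalf k = m.+1 by rewrite uphalf_half ok.
  rewrite -/m eu in ED uA uB *; rewrite ED.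
  have pG : pd (hankr m.+1 m.+1 0 S) by apply: (hl m false); lia.
  have pH : pd (hankr m.+1 m.+1 1 S) by apply: (hl m true); lia.
  have pK : pd (hankr m.+1 m.+1 0 (dS S)) by apply: (hu m false); lia.
  have pW : pd (hankr m.+1 m.+1 1 (dS S)) by apply: (hu m true); lia.
  have sG : shmx C p 0 m m.+1 *m hankr m.+1 m.+1 1 S =
            shmx C p 1 m m.+1 *m hankr m.+1 m.+1 0 S.
    by rewrite (shmx_hankr _ _ _ le0) (shmx_hankr _ _ _ le1).
  have sH : shmx C p 0 m m.+1 *m hankr m.+1 m.+1 2 S =
            shmx C p 1 m m.+1 *m hankr m.+1 m.+1 1 S.
    by rewrite (shmx_hankr _ _ _ le0) (shmx_hankr _ _ _ le1).
  have eXE : ctr (lastE C p m) *m hankr m.+1 m.+1 2 S *m lastE C p m = S (m + m).+2.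
    by rewrite -mulmxA hankr_lastE ctr_lastE lastE_hcol addn2 !addSn.
  rewrite -(schurHE m 1 (herm_dS hS)).
  apply: (schur_gap (shift_frame m) (hankrB _ _ _) pG pH pK sG
            (ctr_hankr _ _ _ hS) sH (hankrB _ _ _) pW _ uA).
  + rewrite eXE hankr_lastE -ctr_hcol /schurH addn0 addSn addnS addn1.
    by [].
  + rewrite eXE mulmxBr -!ctr_hcol -ctrB hankr_lastE.
    rewrite mulmxBl !hankr_lastE addn2 addn1 -hcolB.
    rewrite schurH_dS /schurH addn0 addn1 !addSn !addnS.
    exact: addrB_cancel.
(* Even [k]: the gap is the Schur complement of [Q] itself, so [schur_parallel] applies. *)
- have eu : uphalf k = m by rewrite uphalf_half (negPf ok).
  rewrite -/m eu in ED uA uB *; rewrite ED.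
  have pG : pd (hankr m.+1 m.+1 0 S) by apply: (hl m false); lia.
  have pH : pd (hankr m.+1 m.+1 1 S) by apply: (hl m true); lia.
  have pK : pd (hankr m.+1 m.+1 0 (dS S)) by apply: (hu m false); lia.
  have pW : pd (hankr m m 1 (dS S)).
    by case: m ek {le0 le1 eu ED uA uB pG pH pK} => [_|m ek];
      [exact: pd_hank0|apply: (hu m true); lia].
  have sG : shmx C p 0 m m.+1 *m hankr m.+1 m.+1 1 S =
            shmx C p 1 m m.+1 *m hankr m.+1 m.+1 0 S.
    by rewrite (shmx_hankr _ _ _ le0) (shmx_hankr _ _ _ le1).
  have eJ : (shmx C p 0 m m.+1 - shmx C p 1 m m.+1) *m hankr m.+1 m.+1 1 S =
            hankr m m.+1 1 (dS S).
    by rewrite mulmxBl (shmx_hankr _ _ _ le0) (shmx_hankr _ _ _ le1) hankrB.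
  have eJJ : hankr m m.+1 1 (dS S) *m ctr (shmx C p 0 m m.+1) = hankr m m 1 (dS S).
    by rewrite ctr_shmx (hankr_shmx _ _ _ le0).
  have [Q EQ] : exists Q, Q = hankr m.+1 m.+1 1 S - hankr m.+1 m.+1 1 S *m
      invmx (hankr m.+1 m.+1 0 S) *m hankr m.+1 m.+1 1 S by eexists.
  have eJQ := shift_parallel (pd_unit pG) EQ sG.
  rewrite -(schurHE m 1 hS) -(schurHE m 0 (herm_dS hS)).
  suff -> : schurH m.+1 0 S + schurH m 1 (dS S) =
      schur (shmx C p 0 m m.+1) (lastE C p m) Q.
    apply: (schur_parallel (shift_frame m) (hankrB _ _ _) pG pH pK sG EQ).
    by rewrite eJ eJJ.
  have e1 : ctr (lastE C p m) *m hankr m.+1 m.+1 1 S *m lastE C p m = S (m + m).+1.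
    by rewrite -mulmxA hankr_lastE ctr_lastE lastE_hcol addn1 addSn.
  rewrite /schur eJQ eJ eJJ hankr_lastE EQ cornerB e1.
  rewrite (mulmxA (ctr _) (_ *m _)) (mulmxA (ctr _) (hankr _ _ _ _)) -ctr_hcol.
  rewrite -(mulmxA (_ *m _) (hankr _ _ _ _)) hankr_lastE.
  rewrite schurH_dS /schurH addn0 addn1 !addSn !addnS.
  exact: addrB_cancel.
Qed.

End HankelGaps.

(** Determinants in A + B = A D^-1 B. *)
Lemma det_parallel (F : fieldType) n (A B D : 'M[F]_n) :
  A \in unitmx -> B \in unitmx -> D \in unitmx ->
  invmx D = invmx A + invmx B -> \det D * \det (A + B) = \det A * \det B.
Proof.
move=> uA uB uD eD.
have -> : A + B = A *m invmx D *m B.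
  by rewrite eD mulmxDr mulmxDl (mulmxV uA) mul1mx -mulmxA (mulVmx uB) mulmx1 addrC.
by rewrite !det_mulmx det_inv -mulrA mulrCA mulVKr // -unitmxE.
Qed.

Section Extension.
Variables (R : realType) (p : nat).
Local Notation C := R[i].
Implicit Type S : nat -> 'M[C]_p.

Lemma eq_Sminus S S' k : (forall j, (j < k)%N -> S j = S' j) ->
  Sminus S k = Sminus S' k.
Proof.
case: k => [|[|k]] h; [by []|by []|].
have eH : Hlow S k = Hlow S' k.
  rewrite /Hlow; apply: eq_mxblock => i j; apply: h.
  by have := (ltn_ord i, ltn_ord j, odd_double_half k) => -[[]]; lia.
have eh : hlow S k = hlow S' k.
  rewrite /hlow; apply: eq_mxcol => i; apply: h.
  by have := (ltn_ord i, odd_double_half k) => -[]; lia.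
by rewrite /Sminus eH eh.
Qed.

Lemma eq_Splus S S' k : (forall j, (j < k)%N -> S j = S' j) ->
  Splus S k = Splus S' k.
Proof.
case: k => [|[|k]] h; [by []|by []|].
have eH : Hup S k = Hup S' k.
  rewrite /Hup; apply: eq_mxblock => i j.
  have := (ltn_ord i, ltn_ord j, odd_double_half k, uphalf_half k) => -[[[]]] *.
  by congr (_ - _); apply: h; lia.
have eh : hup S k = hup S' k.
  rewrite /hup; apply: eq_mxcol => i.
  have := (ltn_ord i, odd_double_half k, uphalf_half k, uphalf_half k.+1) => -[[[]]] *.
  by congr (_ - _); apply: h; move: (oddS k) => *; lia.
by rewrite /Splus eH eh h.
Qed.

Lemma eq_inter n S S' : (forall j, (j <= n)%N -> S j = S' j) ->
  inter n S -> inter n S'.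
Proof.
move=> h int k kn; have [] := int k kn.
rewrite (@eq_Sminus S S') ?(@eq_Splus S S') ?h // => j jk; apply: h; lia.
Qed.

Variable S : nat -> 'M[C]_p.
Hypotheses (hS : forall k, herm_mx (S k)) (S0 : S 0 = 1%:M).

Lemma herm_Sminus k : herm_mx (Sminus S k).
Proof.
have -> : Sminus S k = S k - schurH k./2 (odd k) S.
  by rewrite -SminusE opprB addrC subrK.
apply: hermB (hS _) _; apply: hermB (hS _) _.
by apply: herm_congr; apply: herm_inv; exact: ctr_hankr.
Qed.

(** By [gap_rec] the inverse of the gap is a sum of positive definite matrices. *)
Lemma gap_pd n : inter n S -> pd (Splus S n.+1 - Sminus S n.+1).
Proof.
case: n => [|n] int; first by rewrite /= subr0; exact: pd1.
have [uD eD] := gap_rec hS S0 int.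
rewrite -[_ - _]invmxK; apply: pd_inv; rewrite eD.
have [pA pB] := int n (ltnSn n).
by apply: pdD; [exact: pd_inv|exact/pd_psd/pd_inv].
Qed.

Lemma gap_det n : inter n.+1 S ->
  \det (Splus S n.+2 - Sminus S n.+2) * \det (Splus S n.+1 - Sminus S n.+1) =
  \det (S n.+1 - Sminus S n.+1) * \det (Splus S n.+1 - S n.+1).
Proof.
move=> int; have [uD] := gap_rec hS S0 int.
have [/pd_unit uA /pd_unit uB] := int n (ltnSn n).
move=> eD; have -> : Splus S n.+1 - Sminus S n.+1 =
   (S n.+1 - Sminus S n.+1) + (Splus S n.+1 - S n.+1).
  by rewrite [RHS]addrC addrA subrK.
exact: (det_parallel uA uB uD eD).
Qed.

(** The midpoint of the admissible interval makes the last index odd, the case in which [atoms_odd]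
    finds both Hankel matrices [G] and [H] within the data. *)
Definition midext n k : 'M[C]_p :=
  if k == n.+1 then
    Sminus S n.+1 + (2^-1 : R)%:C%C *: (Splus S n.+1 - Sminus S n.+1)
  else S k.

Lemma midextE n k : (k <= n)%N -> midext n k = S k.
Proof. by move=> kn; rewrite /midext ifF //; apply/eqP; lia. Qed.

Lemma half_pd (D : 'M[C]_p) : pd D -> pd ((2^-1 : R)%:C%C *: D).
Proof. by apply: pdZ; rewrite invr_gt0. Qed.

Lemma half_compl (D : 'M[C]_p) : D - (2^-1 : R)%:C%C *: D = (2^-1 : R)%:C%C *: D.
Proof.
rewrite -{1}[D]scale1r -scalerBl; congr (_ *: _).
by apply/eqP; rewrite eq_complex /= subrr eqxx andbT; apply/eqP; lra.
Qed.

Lemma inter_midext n : inter n S -> inter n.+1 (midext n).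
Proof.
move=> int k; rewrite ltnS leq_eqVlt => /orP[/eqP ->|kn]; last first.
  apply: eq_inter int k kn => j jn; by rewrite midextE.
have eM : Sminus (midext n) n.+1 = Sminus S n.+1.
  by apply: eq_Sminus => j jn; apply: midextE.
have eP : Splus (midext n) n.+1 = Splus S n.+1.
  by apply: eq_Splus => j jn; apply: midextE.
rewrite eM eP /midext eqxx [X in pd X /\ _]addrC addKr; have pD := gap_pd int.
by split; [exact: half_pd | rewrite opprD addrA half_compl; exact: half_pd].
Qed.

Lemma herm_midext n : inter n S -> forall k, herm_mx (midext n k).
Proof.
move=> int k; rewrite /midext; case: eqP => // _.
have pD := gap_pd int; apply: hermD; last exact: (half_pd pD).1.
exact: herm_Sminus.
Qed.

End Extension.

(** * Atomic representation of interior points *)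

(** X^-1 H X^-1 represents multiplication by the variable, and X e_k the monomial of degree k:
    [H *m e = G *m f] says that the Hankel matrices shift e_k to e_(k+1). *)
Lemma jacobi_step (F : fieldType) N q (G H X L U U' : 'M[F]_N) (e f : 'M[F]_(N, q)) :
  X \in unitmx -> X *m X = G -> U *m U' = 1%:M ->
  invmx X *m H *m invmx X = U' *m L *m U -> H *m e = G *m f ->
  L *m (U *m X *m e) = U *m X *m f.
Proof.
move=> uX XX UU eT Hf.
have -> : L *m (U *m X *m e) = U *m (U' *m L *m U) *m (X *m e).
  by rewrite !mulmxA UU mul1mx.
rewrite -eT -!mulmxA (mulmxA (invmx X) X) (mulVmx uX) mul1mx Hf -XX.
by rewrite -!mulmxA (mulKmx uX).
Qed.

Lemma jacobi_form (F : fieldType) N q (H X L U U' : 'M[F]_N) (e : 'M[F]_(N, q))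
    (e' : 'M[F]_(q, N)) :
  X \in unitmx -> invmx X *m H *m invmx X = U' *m L *m U ->
  (e' *m X *m U') *m L *m (U *m X *m e) = e' *m H *m e.
Proof.
move=> uX eT.
have -> : (e' *m X *m U') *m L *m (U *m X *m e) = e' *m X *m (U' *m L *m U) *m X *m e.
  by rewrite !mulmxA.
by rewrite -eT !mulmxA (mulmxK uX) (mulmxKV uX).
Qed.

Lemma mul_sqrt_form (F : fieldType) N q (G X U U' : 'M[F]_N) (e : 'M[F]_(N, q))
    (e' : 'M[F]_(q, N)) :
  U' *m U = 1%:M -> X *m X = G ->
  (e' *m X *m U') *m (U *m X *m e) = e' *m G *m e.
Proof.
by move=> UU <-; rewrite !mulmxA -(mulmxA _ U' U) UU mulmx1.
Qed.

Section Atoms.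
Variables (R : realType) (p : nat).
Local Notation C := R[i].
Variable S : nat -> 'M[C]_p.
Hypotheses (hS : forall k, herm_mx (S k)) (S0 : S 0 = 1%:M).

Definition unitE m k : 'M[C]_(\sum_(i < m) p, p) :=
  \mxcol_(i < m) (if i == k :> nat then 1%:M else 0 : 'M[C]_p).

Lemma hankr_unitE m n e k : (k < n)%N ->
  hankr m n e S *m unitE n k = hcol m (k + e) S.
Proof.
move=> kn; rewrite /hankr /unitE mul_mxblock_mxrow; apply: eq_mxcol => i.
apply: sum_deltar => // j ->; congr S; lia.
Qed.

Lemma unitE_hcol n c k : (k < n)%N ->
  ctr (unitE n k) *m hcol n c S = S (c + k)%N.
Proof.
move=> kn.
have -> : ctr (unitE n k) = \mxrow_(i < n) (if i == k :> nat then 1%:M else 0 : 'M[C]_p).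
  apply/matrixP => i j; rewrite ctrE !mxE.
  case: ifP => _; rewrite !mxE ?conjc_nat ?conjc0 //.
  by rewrite eq_sym.
rewrite /hcol mul_mxrow_mxcol.
by apply: sum_delta => // j ->.
Qed.

Lemma unitE_form n e j k : (j < n)%N -> (k < n)%N ->
  ctr (unitE n j) *m hankr n n e S *m unitE n k = S (k + e + j)%N.
Proof. by move=> jn kn; rewrite -mulmxA hankr_unitE // unitE_hcol. Qed.

Lemma rdiag_rows N q (V : 'M[C]_(N, q)) (f : 'I_N -> R) :
  ctr V *m rdiag f *m V = \sum_j (f j)%:C%C *: (ctr (row j V) *m row j V).
Proof.
apply/matrixP => a b; rewrite mxE summxE; apply: eq_bigr => j _.
rewrite mul_mx_diag !mxE big_ord1 !(ctrE, mxE).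
by rewrite [_ * (f j)%:C%C]mulrC mulrA.
Qed.

Lemma rdiag_sandwich N q (v : 'M[C]_(N, q)) (a b : 'I_N -> R) :
  ctr (rdiag a *m v) *m (rdiag b *m v) = ctr v *m rdiag (fun i => a i * b i) *m v.
Proof. by rewrite ctrM ctr_rdiag -rdiagM !mulmxA. Qed.

(** The atoms are the eigenvalues of T = G^(-1/2) H G^(-1/2), and the weights come from the rows of
    [V 0], the constant monomial in the eigenbasis: moments are the forms V_0^* L^k V_0 with L the
    diagonal matrix of eigenvalues. *)
Lemma atoms_odd m : inter m.*2.+1 S ->
  exists (N : nat) (lam : 'I_N -> R) (A : 'I_N -> 'M[C]_p),
    [/\ forall j, 0 <= lam j <= 1, forall j, psd (A j) &
        forall k, (k <= m.*2.+1)%N -> S k = \sum_j (lam j ^+ k)%:C%C *: A j].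
Proof.
move=> /(inter_hankP hS S0)[hl hu].
have pG : pd (hankr m.+1 m.+1 0 S) by apply: (hl m false); lia.
have pH : pd (hankr m.+1 m.+1 1 S) by apply: (hl m true); lia.
have pK : pd (hankr m.+1 m.+1 0 (dS S)) by apply: (hu m false); lia.
have [pX XX] := msqrt_pd pG.
set G := hankr m.+1 m.+1 0 S in pG pX XX.
set H := hankr m.+1 m.+1 1 S in pH.
set X := msqrt G in pX XX.
have uX := pd_unit pX; have hiX := herm_inv pX.1.
pose T := invmx X *m H *m invmx X.
have pT : psd T.
  by have := psd_congr (invmx X) (pd_psd pH); rewrite hiX.
have [U [lam [UU U'U ET]]] := herm_spectral pT.1.
have l0 : forall j, 0 <= lam j.
  by apply: (spectral_ge0 UU); rewrite -ET.
(* 1 - T is congruent to G - H, the Hankel matrix of the differences. *)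
have l1 : forall j, 0 <= 1 - lam j.
  apply: (spectral_ge0 UU).
  have -> : ctr U *m rdiag (fun j => 1 - lam j) *m U =
            ctr (invmx X) *m hankr m.+1 m.+1 0 (dS S) *m invmx X.
    have -> : rdiag (fun j => 1 - lam j) = 1%:M - rdiag lam.
      apply/matrixP => i j; rewrite !mxE -mulrnBl.
      by rewrite rmorphB rmorph1.
    rewrite mulmxBr mulmx1 mulmxBl U'U -ET hankrB mulmxBr mulmxBl hiX -/G -/H -XX.
    by rewrite (mulKmx uX) (mulmxV uX).
  exact/psd_congr/pd_psd.
pose V k := U *m X *m unitE m.+1 k.
have VS k : (k < m)%N -> rdiag lam *m V k = V k.+1.
  move=> km; apply: (jacobi_step uX XX UU ET).
  by rewrite !hankr_unitE ?addn0 ?addn1 ?ltnS // ltnW.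
have V0 k : (k <= m)%N -> V k = rdiag (fun j => lam j ^+ k) *m V 0.
  elim: k => [|k IH] km.
    rewrite [rdiag _](_ : _ = 1%:M) ?mul1mx //.
    by apply/matrixP => i j; rewrite !mxE expr0.
  rewrite -(VS _ km) (IH (ltnW km)) mulmxA rdiagM; congr (rdiag _ *m _); apply/funext => j.
  by rewrite exprS.
have ctrV k : ctr (V k) = ctr (unitE m.+1 k) *m X *m ctr U.
  by rewrite /V !ctrM pX.1 mulmxA.
have VV j k : (j <= m)%N -> (k <= m)%N ->
    ctr (V 0) *m rdiag (fun i => lam i ^+ (j + k)) *m V 0 = S (j + k)%N.
  move=> jm km.
  have -> : S (j + k)%N = ctr (V j) *m V k.
    rewrite ctrV (mul_sqrt_form _ _ U'U XX) unitE_form //.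
    by rewrite addn0 addnC.
  rewrite (V0 j jm) (V0 k km) rdiag_sandwich.
  by congr (_ *m rdiag _ *m _); apply/funext => i; rewrite exprD.
exists (\sum_(i < m.+1) p)%N, lam, (fun j => ctr (row j (V 0)) *m row j (V 0)); split.
- by move=> j; rewrite l0 -subr_ge0 l1.
- move=> j; have := psd_congr (row j (V 0)) (pd_psd (pd1 R 1)).
  by rewrite mulmx1.
(* The top moment 2m + 1 exceeds every sum of two degrees at most [m]; it is read off the last
   diagonal block of [H]. *)
move=> k; rewrite leq_eqVlt => /orP[/eqP ->|kn].
  rewrite -rdiag_rows.
  have -> : S m.*2.+1 = ctr (V m) *m rdiag lam *m V m.
    rewrite ctrV (jacobi_form _ _ uX ET) unitE_form //.
    by congr S; lia.
  rewrite (V0 m (leqnn m)) -mulmxA (mulmxA (rdiag lam)) rdiagM rdiag_sandwich.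
  congr (_ *m rdiag _ *m _); apply/funext => i.
  by rewrite mulrCA -exprD -exprS; congr (_ ^+ _); lia.
rewrite -rdiag_rows; have -> : k = (minn k m + (k - minn k m))%N by lia.
by rewrite VV //; lia.
Qed.

End Atoms.

Lemma atoms (R : realType) p (S : nat -> 'M[R[i]]_p) n :
  (forall k, herm_mx (S k)) -> S 0 = 1%:M -> inter n S ->
  exists (N : nat) (lam : 'I_N -> R) (A : 'I_N -> 'M[R[i]]_p),
    [/\ forall j, 0 <= lam j <= 1, forall j, psd (A j) &
        forall k, (k <= n)%N -> S k = \sum_j (lam j ^+ k)%:C%C *: A j].
Proof.
move=> hS S0 int; case: (boolP (odd n)) => on.
  have en : n = n./2.*2.+1 by have := odd_double_half n; rewrite on; lia.
  by rewrite en in int *; exact: (atoms_odd hS S0).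
have en : n = n./2.*2 by have := odd_double_half n; rewrite (negPf on); lia.
have := @atoms_odd R p (midext S n) (herm_midext hS S0 int) _ n./2.
rewrite midextE // -en => /(_ S0 (inter_midext hS S0 int)).
move=> [N [lam [A [h1 h2 h3]]]]; exists N, lam, A; split => // k kn.
by rewrite -h3 ?midextE // ltnW.
Qed.

(** * Iterated integrals and linear changes of variables *)

Section LebesgueLine.
Local Open Scope ereal_scope.
Import HBNNSimple.
Variable R : realType.
Local Notation mu := (@lebesgue_measure R).

(** No measurability is assumed: simple functions below [f] are below [g]. This serves for the
    indicator of the moment space. *)
Lemma ge0_integral_le (f g : R -> \bar R) : (forall t, 0 <= f t) ->
  (forall t, f t <= g t) -> \int[mu]_t f t <= \int[mu]_t g t.
Proof.
move=> f0 fg; have g0 t : 0 <= g t by exact: le_trans (f0 t) (fg t).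
rewrite !ge0_integralTE //; apply: ereal_sup_le => _ [h /= hf <-].
by exists h => //= t; exact: le_trans (hf t) (fg t).
Qed.

Lemma measurable_affine (d c : R) :
  measurable_fun setT (fun t : measurableTypeR R => (d * t + c)%R : measurableTypeR R).
Proof.
by apply: measurable_funD; [apply: measurable_funM|].
Qed.

(** [d] times the image of Lebesgue measure under the affine map agrees with Lebesgue measure on
    half-open intervals, hence everywhere. *)
Lemma integral_affine (d c : R) (g : R -> \bar R) : (0 < d)%R ->
  measurable_fun setT g -> (forall t, 0 <= g t) ->
  \int[mu]_t g (d * t + c)%R = (d^-1)%:E * \int[mu]_t g t.
Proof.
move=> d0 mg g0.
pose phi := (fun t : measurableTypeR R => (d * t + c)%R : measurableTypeR R).
have mphi : measurable_fun setT phi := measurable_affine d c.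
pose pm := measure_function_pushforward__canonical__measure_function_Measure mu mphi.
have dnn : (0 <= d)%R by exact: ltW.
have e1 A : measurable A -> mu A = mscale (NngNum dnn) pm A.
  apply: lebesgue_measure_unique => _ [[a b] _ <-].
  change (mu `]a, b]%classic = d%:E * mu (phi @^-1` `]a, b]%classic)).
  have -> : phi @^-1` `]a, b]%classic = `](((a - c) / d)%R), (((b - c) / d)%R)]%classic.
    apply/seteqP; split=> t /=; rewrite !in_itv /= ltr_pdivrMr // ler_pdivlMr //;
    by rewrite /phi ltrBlDr lerBrDr mulrC.
  rewrite !lebesgue_measure_itv /= !lte_fin ltr_pM2r ?invr_gt0 // ltrD2r.
  case: ifP => _; last by rewrite mule0.
  rewrite -EFinB -EFinM; congr EFin.
  by rewrite -mulrBl opprB addrA subrK mulrCA mulfV ?gt_eqF // mulr1.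
have -> : \int[mu]_t g t = d%:E * \int[mu]_t g (phi t).
  transitivity (\int[mscale (NngNum dnn) pm]_t g t).
    by apply: eq_measure_integral => A mA _; exact: e1.
  rewrite ge0_integral_mscale //; congr (_ * _).
  exact: (ge0_integral_pushforward mphi).
rewrite muleA -EFinM mulVf ?gt_eqF // mul1e.
by [].
Qed.

End LebesgueLine.

(** * Measurability, Tonelli and triangular substitutions for iterated integrals *)

Section BorelFunctions.
Local Open Scope ereal_scope.
Variable R : realType.

(* Testing along coordinatewise measurable families makes this stable under
   substitutions without putting a measurable structure on I -> R. *)
Definition bmeas (I : Type) d' (V : measurableType d') (f : (I -> R) -> V) : Prop :=
  forall d (W : measurableType d) (phi : W -> I -> R),
    (forall i, measurable_fun setT (fun w => phi w i)) ->
    measurable_fun setT (fun w => f (phi w)).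

Definition bset (I : Type) (A : set (I -> R)) : Prop :=
  forall d (W : measurableType d) (phi : W -> I -> R),
    (forall i, measurable_fun setT (fun w => phi w i)) ->
    measurable [set w | A (phi w)].

Lemma bset_borelI (I : finType) (A : set (I -> R)) : borelI A -> bset A.
Proof.
move=> bA d W phi mphi.
apply: (bA [set A | measurable [set w | A (phi w)]]); split; first split.
- exact: measurable0.
- move=> B /= mB; rewrite (_ : [set w | _] = ~` [set w | B (phi w)]).
    exact: measurableC.
  by apply/seteqP; split=> w /= => [[]|].
- move=> F mF /=; rewrite (_ : [set w | _] = \bigcup_k [set w | F k (phi w)]).
    by apply: bigcupT_measurable => k; exact: mF.
  by apply/seteqP; split=> w /= [k _ h]; exists k.
- move=> _ [i [A0 [mA0 ->]]] /=.
  by have := mphi i measurableT A0 mA0; rewrite setTI.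
Qed.

Lemma bmeas_indic (I : Type) (A : set (I -> R)) : bset A ->
  bmeas (fun x => (\1_A x)%:E : \bar R).
Proof.
move=> bA d W phi mphi; apply/measurable_EFinP.
rewrite (_ : (fun _ => _) = \1_[set w | A (phi w)]); last first.
  by apply/funext => w; rewrite !indicE; congr (_%:R); rewrite !inE.
exact/measurable_indic/bA.
Qed.

Variable I : eqType.

Lemma measurable_upd d (W : measurableType d) (phi : W -> I -> R) i :
  (forall j, measurable_fun setT (fun w => phi w j)) ->
  forall j, measurable_fun setT
    (fun w : W * measurableTypeR R => upd (phi w.1) i w.2 j).
Proof.
move=> mphi j; rewrite /upd; case: eqP => _; first exact: measurable_snd.
exact: (measurableT_comp (mphi j) measurable_fst).
Qed.

Lemma bmeas_int i (f : (I -> R) -> \bar R) : bmeas f -> (forall x, 0 <= f x) ->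
  bmeas (fun x => \int[@lebesgue_measure R]_t f (upd x i t)).
Proof.
move=> mf f0 d W phi mphi.
have mF : measurable_fun setT
    (fun w : W * measurableTypeR R => f (upd (phi w.1) i w.2)).
  by apply: mf; exact: measurable_upd.
exact: (@measurable_fun_fubini_tonelli_F _ _ _ _ _ (@lebesgue_measure R) _ mF).
Qed.

Lemma bmeas_line (f : (I -> R) -> \bar R) x i : bmeas f ->
  measurable_fun setT (fun t : measurableTypeR R => f (upd x i t)).
Proof.
move=> mf; apply: mf => j; rewrite /upd.
by case: eqP => _ //; exact: measurable_cst.
Qed.

Lemma itint_ge0 (s : seq I) (f : (I -> R) -> \bar R) :
  (forall x, 0 <= f x) -> forall x, 0 <= itint s f x.
Proof.
by move=> f0; elim: s => //= i s IH x; apply: integral_ge0 => t _.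
Qed.

Lemma bmeas_itint (s : seq I) (f : (I -> R) -> \bar R) : bmeas f ->
  (forall x, 0 <= f x) -> bmeas (itint s f).
Proof.
by move=> mf f0; elim: s => //= i s IH; apply: bmeas_int => //; exact: itint_ge0.
Qed.

Lemma itint_cat (s1 s2 : seq I) (f : (I -> R) -> \bar R) :
  itint (s1 ++ s2) f = itint s1 (itint s2 f).
Proof.
elim: s1 => //= i s IH; apply/funext => x; apply: eq_integral => t _.
by rewrite IH.
Qed.

Lemma eq_itint (s : seq I) (f g : (I -> R) -> \bar R) : f =1 g -> itint s f =1 itint s g.
Proof. by move=> /funext ->. Qed.

Lemma itint_le (s : seq I) (f g : (I -> R) -> \bar R) : (forall x, 0 <= f x) ->
  (forall x, f x <= g x) -> forall x, itint s f x <= itint s g x.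
Proof.
move=> f0 fg; elim: s => //= i s IH x; apply: ge0_integral_le => t //.
exact: itint_ge0.
Qed.

Lemma upd_comm (x : I -> R) i j t u : i != j ->
  upd (upd x i t) j u = upd (upd x j u) i t.
Proof.
move=> ij; apply/funext => k; rewrite /upd.
by case: (eqVneq k j) => [->|//]; rewrite eq_sym (negPf ij).
Qed.

Lemma itint_swap i j (f : (I -> R) -> \bar R) x : bmeas f ->
  (forall x, 0 <= f x) -> itint [:: i; j] f x = itint [:: j; i] f x.
Proof.
move=> mf f0; have [->//|ij] := eqVneq i j.
rewrite /=.
have mF : measurable_fun setT (fun w : measurableTypeR R * measurableTypeR R =>
    f (upd (upd x i w.1) j w.2)).
  apply: mf; apply: (@measurable_upd _ (measurableTypeR R) (upd x i)) => k.
  by rewrite /upd; case: eqP => // _; exact: measurable_cst.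
have /= -> := @fubini_tonelli _ _ _ _ _ (@lebesgue_measure R) (@lebesgue_measure R) _
  mF (fun w => f0 _).
by apply: eq_integral => u _; apply: eq_integral => t _; rewrite upd_comm.
Qed.

Lemma itint_front (s1 s2 : seq I) i (f : (I -> R) -> \bar R) : bmeas f ->
  (forall x, 0 <= f x) -> itint (s1 ++ i :: s2) f = itint (i :: s1 ++ s2) f.
Proof.
move=> mf f0; elim: s1 => //= j s IH; apply/funext => x.
transitivity (itint [:: j; i] (itint (s ++ s2) f) x).
  by rewrite /=; apply: eq_integral => t _; rewrite IH.
rewrite itint_swap //; [exact: bmeas_itint|exact: itint_ge0].
Qed.

Lemma itint_perm (s1 s2 : seq I) (f : (I -> R) -> \bar R) : bmeas f ->
  (forall x, 0 <= f x) -> perm_eq s1 s2 -> itint s1 f = itint s2 f.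
Proof.
move=> mf f0; elim: s1 s2 => [|i s1 IH] s2 h.
  by move: h; rewrite perm_sym => /perm_nilP ->.
have is2 : i \in s2 by rewrite -(perm_mem h) mem_head.
case/splitPr: is2 h => a b h; rewrite itint_front //=.
rewrite (IH (a ++ b)) //.
by move: h; rewrite perm_sym perm_catC /= perm_cons perm_catC perm_sym.
Qed.

Lemma itint_indep (s : seq I) (f : (I -> R) -> \bar R) x y :
  (forall j, j \notin s -> x j = y j) -> itint s f x = itint s f y.
Proof.
elim: s x y => [|i s IH] x y h /=.
  by congr f; apply/funext => j; apply: h.
apply: eq_integral => t _; apply: IH => j js; rewrite /upd.
by case: eqVneq => // ji; apply: h; rewrite inE negb_or ji.
Qed.

Lemma itintZ (s : seq I) (c : (I -> R) -> R) (f : (I -> R) -> \bar R) :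
  bmeas f -> (forall x, 0 <= f x) -> (forall x, 0 <= c x)%R ->
  (forall x i t, i \in s -> c (upd x i t) = c x) ->
  forall x, itint s (fun x => (c x)%:E * f x) x = (c x)%:E * itint s f x.
Proof.
move=> mf f0 c0; elim: s => //= i s IH hc x.
rewrite -ge0_integralZl //; last 2 first.
- by move=> t _; exact: itint_ge0.
- by rewrite lee_fin.
- by apply: eq_integral => t _; rewrite IH ?hc ?mem_head // => y k u ks; rewrite hc // inE ks orbT.
by apply: bmeas_line; exact: bmeas_itint.
Qed.

(** The component T_j depends, apart from its own variable, only on variables of [s] of smaller
    rank. The outermost variable has the least rank, so its component of [T] does not see the inner
    variables: after the inner substitutions one affine substitution remains. *)
Lemma itint_triangular (s : seq I) (r : I -> nat) (d : I -> R) (T : (I -> R) -> I -> R)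
    (f : (I -> R) -> \bar R) : bmeas f -> (forall x, 0 <= f x) ->
  uniq s -> sorted leq (map r s) -> (forall i, 0 < d i)%R ->
  (forall i x t, i \in s -> T (upd x i t) i = d i * t + T (upd x i 0) i)%R ->
  (forall i j x t, i \in s -> j != i -> (j \notin s) || (r j <= r i)%N ->
     T (upd x i t) j = T x j) ->
  forall x, itint s (f \o T) x = (\prod_(i <- s) (d i)^-1)%R%:E * itint s f (T x).
Proof.
move=> mf f0 us rs d0; elim: s us rs => [|i s IH] us rs hd hT x.
  by rewrite big_nil mul1e.
move: us => /= /andP[nis us].
have ris j : j \in s -> (r i <= r j)%N.
  move=> js; have /= := rs; rewrite (path_sortedE leq_trans) => /andP[/allP h _].
  by apply: h; exact: map_f.
have ss : sorted leq (map r s) by move: rs => /= /path_sorted.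
have {}IH := IH us ss.
have e1 t : itint s (f \o T) (upd x i t) =
    (\prod_(i <- s) (d i)^-1)%R%:E *
    itint s f (upd (T x) i (d i * t + T (upd x i 0) i)%R).
  rewrite IH => [|k y u ks|k j y u ks jk jr]; last 2 first.
  - by apply: hd; rewrite inE ks orbT.
  - apply: hT => //; first by rewrite inE ks orbT.
    move: jr; rewrite inE negb_or; case: (eqVneq j i) => [->|_] //=.
    by rewrite ris // orbT.
  (* Only the components of [T] outside [s] matter here, the others being integrated out. *)
  congr (_ * _); apply: itint_indep => j js; rewrite {2}/upd.
  case: eqVneq => [->|ji]; first by rewrite hd ?mem_head.
  by rewrite hT ?mem_head // inE negb_or ji js.
under eq_integral do rewrite e1.
have ml : measurable_fun setT (fun t : measurableTypeR R => itint s f (upd (T x) i t)).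
  by apply: bmeas_line; exact: bmeas_itint.
rewrite ge0_integralZl //; last 3 first.
- apply: (measurableT_comp ml); exact: measurable_affine.
- by move=> t _; exact: itint_ge0.
- by rewrite lee_fin prodr_ge0 // => k _; rewrite invr_ge0 ltW.
rewrite (@integral_affine R (d i) _ (fun t => itint s f (upd (T x) i t))) //; last first.
  by move=> t; exact: itint_ge0.
by rewrite muleA -EFinM big_cons mulrC.
Qed.

End BorelFunctions.

Section Embeddings.
Variable R : realType.

(** Overwrites by [y] the coordinates of [x] in the image of [phi]; integrating over [y] is a
    partial integral over a block of coordinates. *)
Definition ovr (I J : finType) (phi : I -> J) (x : J -> R) (y : I -> R) : J -> R :=
  fun j => if [pick i | phi i == j] is Some i then y i else x j.

Lemma ovr_in (I J : finType) (phi : I -> J) x y i : injective phi ->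
  ovr phi x y (phi i) = y i.
Proof.
move=> phiI; rewrite /ovr; case: pickP => [k /eqP/phiI ->//|/(_ i)].
by rewrite eqxx.
Qed.

Lemma ovr_out (I J : finType) (phi : I -> J) x y j : (forall i, phi i != j) ->
  ovr phi x y j = x j.
Proof.
by move=> h; rewrite /ovr; case: pickP => // k; rewrite (negPf (h k)).
Qed.

Lemma upd_ovr (I J : finType) (phi : I -> J) x y i t : injective phi ->
  upd (ovr phi x y) (phi i) t = ovr phi (upd x (phi i) t) (upd y i t).
Proof.
move=> phiI; apply/funext => j; rewrite {1}/upd /ovr.
case: pickP => [k /eqP <-|h].
  by rewrite /upd (inj_eq phiI).
by rewrite /upd; case: eqVneq => // e; have := h i; rewrite e eqxx.
Qed.

Lemma ovr_base (I J : finType) (phi : I -> J) x x' y :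
  (forall j, (forall i, phi i != j) -> x j = x' j) -> ovr phi x y = ovr phi x' y.
Proof.
move=> h; apply/funext => j; rewrite /ovr; case: pickP => // k.
by apply: h => i; apply/negbT; exact: k.
Qed.

Lemma itint_map (I J : finType) (phi : I -> J) (s : seq I) (g : (J -> R) -> \bar R) x y :
  injective phi ->
  itint (map phi s) g (ovr phi x y) = itint s (fun y => g (ovr phi x y)) y.
Proof.
move=> phiI; elim: s y => //= i s IH y; apply: eq_integral => t _.
rewrite upd_ovr // -IH; congr (itint _ _ _); apply: ovr_base => j h.
by rewrite /upd eq_sym (negPf (h i)).
Qed.

Lemma ovr_id (I J : finType) (phi : I -> J) x : ovr phi x (x \o phi) = x.
Proof.
apply/funext => j; rewrite /ovr; case: pickP => // i /eqP <- //.
Qed.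

Lemma lebintE (I : finType) (f : (I -> R) -> \bar R) y : lebint f = itint (enum I) f y.
Proof. by apply: itint_indep => j; rewrite mem_enum. Qed.

Lemma itint_codom (I J : finType) (phi : I -> J) (g : (J -> R) -> \bar R) x :
  injective phi ->
  itint (map phi (enum I)) g x = lebint (fun y => g (ovr phi x y)).
Proof.
by move=> phiI; rewrite -{1}(ovr_id phi x) itint_map // -lebintE.
Qed.

Lemma lebint_ge0 (I : finType) (f : (I -> R) -> \bar R) :
  (forall x, (0 <= f x)%E) -> (0 <= lebint f)%E.
Proof. by move=> f0; exact: itint_ge0. Qed.

Lemma eq_lebint (I : finType) (f g : (I -> R) -> \bar R) : f =1 g -> lebint f = lebint g.
Proof. by move=> /funext ->. Qed.

Lemma lebint_le (I : finType) (f g : (I -> R) -> \bar R) :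
  (forall x, (0 <= f x)%E) -> (forall x, (f x <= g x)%E) -> (lebint f <= lebint g)%E.
Proof. by move=> f0 fg; exact: itint_le. Qed.

Lemma lebintZ (I : finType) (c : R) (f : (I -> R) -> \bar R) : bmeas f ->
  (forall x, (0 <= f x)%E) -> 0 <= c ->
  lebint (fun x => c%:E * f x)%E = (c%:E * lebint f)%E.
Proof.
by move=> mf f0 c0; exact: (@itintZ R I (enum I) (fun=> c) f mf f0 (fun=> c0)).
Qed.

Lemma lebint_split (I1 I2 J : finType) (phi1 : I1 -> J) (phi2 : I2 -> J)
    (g : (J -> R) -> \bar R) :
  injective phi1 -> injective phi2 -> (forall i1 i2, phi1 i1 != phi2 i2) ->
  (forall j, (exists i, phi1 i = j) \/ (exists i, phi2 i = j)) ->
  bmeas g -> (forall x, (0 <= g x)%E) ->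
  lebint g = lebint (fun y1 => lebint (fun y2 => g (ovr phi2 (ovr phi1 (fun=> 0) y1) y2))).
Proof.
move=> i1 i2 dis cov mg g0.
rewrite /lebint (@itint_perm _ _ (enum J) (map phi1 (enum I1) ++ map phi2 (enum I2))) //.
  rewrite itint_cat itint_codom //; apply: eq_lebint => y1.
  by rewrite itint_codom.
apply: uniq_perm; first exact: enum_uniq.
  rewrite cat_uniq (map_inj_uniq i1) (map_inj_uniq i2) !enum_uniq andbT andTb.
  apply/hasPn => _ /mapP[k _ ->]; apply/negP => /mapP[l _ /esym/eqP].
  by rewrite (negPf (dis l k)).
move=> j; rewrite mem_enum inE mem_cat; apply/esym.
by case: (cov j) => -[i <-]; rewrite map_f ?mem_enum ?orbT.
Qed.

(** Tonelli allows the coordinates to be sorted by rank first. *)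
Lemma lebint_triangular (I : finType) (r : I -> nat) (d : I -> R) (T : (I -> R) -> I -> R)
    (f : (I -> R) -> \bar R) : bmeas f -> (forall x, (0 <= f x)%E) ->
  bmeas (f \o T) -> (forall i, 0 < d i) ->
  (forall i x t, T (upd x i t) i = d i * t + T (upd x i 0) i) ->
  (forall i j x t, j != i -> (r j <= r i)%N -> T (upd x i t) j = T x j) ->
  lebint (f \o T) = ((\prod_i (d i)^-1)%:E * lebint f)%E.
Proof.
move=> mf f0 mfT d0 hd hT.
pose s := sort (fun i j => r i <= r j)%N (enum I).
have ps : perm_eq (enum I) s by rewrite perm_sym; apply/permPl/perm_sort.
rewrite /lebint (itint_perm mfT _ ps); last by move=> x; exact: f0.
rewrite (@itint_triangular R I s r d T f mf f0) //.
- rewrite (itint_perm mf _ ps) //; congr (_ * _)%E; last first.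
    by apply: itint_indep => j; rewrite mem_sort mem_enum.
  congr EFin; rewrite -(perm_big _ ps) /= big_enum //.
- by rewrite sort_uniq enum_uniq.
- rewrite sorted_map; apply: sort_sorted => i j; exact: leq_total.
- by move=> i j x t _ ji; rewrite mem_sort mem_enum /= => h; exact: hT.
Qed.

End Embeddings.

(** * Measurability of matrix functions and of positive definiteness *)

Section ComplexMeasurable.
Variable R : realType.
Local Notation C := R[i].
Context d (W : measurableType d).

Definition cmf (F : W -> C) : Prop :=
  measurable_fun setT (fun w => complex.Re (F w)) /\
  measurable_fun setT (fun w => complex.Im (F w)).

Definition mmf m n (M : W -> 'M[C]_(m, n)) : Prop :=
  forall i j, cmf (fun w => M w i j).

Lemma cmf_cst c : cmf (fun=> c).
Proof. by split; exact: measurable_cst. Qed.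

Lemma cmfD F G : cmf F -> cmf G -> cmf (fun w => F w + G w).
Proof.
move=> [F1 F2] [G1 G2]; split.
- rewrite (_ : (fun _ => _) = (fun w => complex.Re (F w) + complex.Re (G w))).
    exact: measurable_funD.
  by apply/funext => w; case: (F w) (G w) => [a b] [a' b'].
- rewrite (_ : (fun _ => _) = (fun w => complex.Im (F w) + complex.Im (G w))).
    exact: measurable_funD.
  by apply/funext => w; case: (F w) (G w) => [a b] [a' b'].
Qed.

Lemma cmfM F G : cmf F -> cmf G -> cmf (fun w => F w * G w).
Proof.
move=> [F1 F2] [G1 G2]; split.
- rewrite (_ : (fun _ => _) = (fun w => complex.Re (F w) * complex.Re (G w)
                                        - complex.Im (F w) * complex.Im (G w))).
    by apply: measurable_funB; apply: measurable_funM.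
  by apply/funext => w; case: (F w) (G w) => [a b] [a' b'].
- rewrite (_ : (fun _ => _) = (fun w => complex.Re (F w) * complex.Im (G w)
                                        + complex.Im (F w) * complex.Re (G w))).
    by apply: measurable_funD; apply: measurable_funM.
  by apply/funext => w; case: (F w) (G w) => [a b] [a' b'].
Qed.

Lemma cmfN F : cmf F -> cmf (fun w => - F w).
Proof.
move=> hF; rewrite (_ : (fun _ => _) = (fun w => (-1) * F w)).
  by apply: cmfM hF; exact: cmf_cst.
by apply/funext => w; rewrite mulN1r.
Qed.

Lemma cmf_conj F : cmf F -> cmf (fun w => conjc (F w)).
Proof.
move=> [F1 F2]; split.
- rewrite (_ : (fun _ => _) = (fun w => complex.Re (F w))) //.
  by apply/funext => w; case: (F w).
- rewrite (_ : (fun _ => _) = (fun w => - complex.Im (F w))).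
    exact: measurable_funN.
  by apply/funext => w; case: (F w).
Qed.

Lemma cmf_sum (I : Type) (s : seq I) (P : pred I) (F : I -> W -> C) :
  (forall i, cmf (F i)) -> cmf (fun w => \sum_(i <- s | P i) F i w).
Proof.
move=> h; elim: s => [|i s IH].
  by under eq_fun do rewrite big_nil; exact: cmf_cst.
under eq_fun do rewrite big_cons.
by case: (P i) => //; exact: cmfD.
Qed.

Lemma cmf_prod (I : Type) (s : seq I) (P : pred I) (F : I -> W -> C) :
  (forall i, cmf (F i)) -> cmf (fun w => \prod_(i <- s | P i) F i w).
Proof.
move=> h; elim: s => [|i s IH].
  by under eq_fun do rewrite big_nil; exact: cmf_cst.
under eq_fun do rewrite big_cons.
by case: (P i) => //; exact: cmfM.
Qed.

Lemma mmf_cst m n (A : 'M[C]_(m, n)) : mmf (fun=> A).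
Proof. by move=> i j; exact: cmf_cst. Qed.

Lemma mmfD m n (A B : W -> 'M[C]_(m, n)) : mmf A -> mmf B -> mmf (fun w => A w + B w).
Proof.
by move=> hA hB i j; under eq_fun do rewrite mxE; exact: cmfD.
Qed.

Lemma mmfN m n (A : W -> 'M[C]_(m, n)) : mmf A -> mmf (fun w => - A w).
Proof. by move=> hA i j; under eq_fun do rewrite mxE; exact: cmfN. Qed.

Lemma mmfB m n (A B : W -> 'M[C]_(m, n)) : mmf A -> mmf B -> mmf (fun w => A w - B w).
Proof. by move=> hA hB; apply: mmfD hA _; exact: mmfN. Qed.

Lemma mmfM m n q (A : W -> 'M[C]_(m, n)) (B : W -> 'M[C]_(n, q)) :
  mmf A -> mmf B -> mmf (fun w => A w *m B w).
Proof.
move=> hA hB i j; under eq_fun do rewrite mxE.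
by apply: cmf_sum => k; exact: cmfM.
Qed.

Lemma cmf_det n (A : W -> 'M[C]_n) : mmf A -> cmf (fun w => \det (A w)).
Proof.
move=> hA; rewrite /determinant; apply: cmf_sum => s; apply: cmfM.
  exact: cmf_cst.
by apply: cmf_prod => i; exact: hA.
Qed.

Lemma hblockE m q (A : 'M[C]_(m + q)) : herm_mx A ->
  A = hblock (ulsubmx A) (ursubmx A) (drsubmx A) /\
  herm_mx (ulsubmx A) /\ herm_mx (drsubmx A).
Proof.
move=> hA; split.
  rewrite -[LHS]submxK /hblock; congr block_mx.
  by rewrite -{1}hA; apply/matrixP => i j; rewrite !(mxE, ctrE).
by split; rewrite /herm_mx -{2}hA; apply/matrixP => i j; rewrite !(mxE, ctrE).
Qed.

Lemma pd_minors n (A : 'M[C]_(n + 1)) : herm_mx A ->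
  pd A <-> pd (ulsubmx A) /\ 0 < complex.Re (\det A).
Proof.
move=> hA; have [EA [hul hdr]] := hblockE hA.
split=> [pA|[pul dA]].
  split; first by move: pA; rewrite {1}EA => /(pd_hblock _ hul hdr)[].
  by have := pd_det pA; rewrite ltcE => /andP[].
rewrite EA; apply/(pd_hblock _ hul hdr); split=> //.
apply/pd_scalarP; move: dA; rewrite {1}EA det_hblock ?pd_unit // det_mx11.
(* The Schur complement is a scalar, real by hermitian symmetry, and has the sign of the full
   determinant. *)
set S := _ - _; have hS : herm_mx S.
  by apply: hermB => //; apply/herm_congr/herm_inv.
have /matrixP/(_ 0 0) := hS; rewrite ctrE.
have := pd_det pul; rewrite !ltcE /=.
case: (\det _) (S 0 0) => [a a'] [b b'] /= /andP[/eqP -> a0] [] /eqP.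
rewrite eq_sym -subr_eq0 opprK -mulr2n mulrn_eq0 /= => /eqP ->.
by rewrite mulr0 subr0 eqxx pmulr_rgt0.
Qed.

(** Leading principal minors replace the quantification over all vectors by finitely many measurable
    conditions. *)
Lemma measurable_pd n (A : W -> 'M[C]_n) : mmf A -> (forall w, herm_mx (A w)) ->
  measurable [set w | pd (A w)].
Proof.
elim: n A => [|n IH].
  move=> A mA hA; rewrite (_ : [set _ | _] = setT) //.
  by apply/seteqP; split=> // w _; exact: pd0.
rewrite -addn1 => A mA hA.
have -> : [set w | pd (A w)] =
    [set w | pd (ulsubmx (A w))] `&` [set w | 0 < complex.Re (\det (A w))].
  by apply/seteqP; split=> w /= /(pd_minors (hA w)).
apply: measurableI.
  apply: IH => [i j|w]; last by have [_ []] := hblockE (hA w).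
  by have := mA (lshift 1 i) (lshift 1 j); under [in X in X -> _]eq_fun do rewrite /=;
     under [in X in _ -> X]eq_fun do rewrite !mxE.
have [mRe _] := cmf_det mA.
rewrite -[X in measurable X]setTI.
rewrite (_ : [set w | _] = (fun w => complex.Re (\det (A w))) @^-1` `]0, +oo[%classic).
  by apply: mRe => //; exact: measurable_itv.
by apply/seteqP; split=> w /=; rewrite in_itv /= andbT.
Qed.

End ComplexMeasurable.

(** * Real coordinates of hermitian matrices and the Jacobian of a congruence *)

Section HermCoordinates.
Variables (R : realType) (p : nat).
Local Notation C := R[i].
Local Notation IJ := ('I_p * 'I_p)%type.
Implicit Types (x y : IJ -> R) (M : 'M[C]_p).

Definition unherm M : IJ -> R := fun ij =>
  if (ij.1 <= ij.2)%N then complex.Re (M ij.1 ij.2) else complex.Im (M ij.2 ij.1).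

Lemma herm_herm x : herm_mx (herm x).
Proof.
apply/matrixP => i j; rewrite ctrE !mxE [j == i]eq_sym.
case: eqVneq => [->|ij]; first by apply/eqP; rewrite eq_complex /= oppr0 !eqxx.
case: ltngtP => //; last by move=> /val_inj e; rewrite e eqxx in ij.
by move=> _; apply/eqP; rewrite eq_complex /= opprK !eqxx.
Qed.

Lemma unhermK M : herm_mx M -> herm (unherm M) = M.
Proof.
move=> hM; apply/matrixP => i j; rewrite mxE /unherm /=.
have hij : conjc (M j i) = M i j by rewrite -ctrE hM.
case: eqVneq => [<-|ij].
  rewrite leqnn; have := hij; rewrite -{1}hij.
  have := hM => /matrixP/(_ i i); rewrite ctrE.
  case: (M i i) => a b [] /eqP; rewrite eq_sym -subr_eq0 opprK -mulr2n mulrn_eq0 /=.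
  by move=> /eqP ->.
case: ltngtP => h.
- by case: (M i j).
- by rewrite -hij; case: (M j i).
- by rewrite (val_inj h) eqxx in ij.
Qed.

Lemma hermK x : unherm (herm x) = x.
Proof.
apply/funext => -[i j]; rewrite /unherm /= !mxE.
case: eqVneq => [->|ij]; first by rewrite leqnn.
case: ltngtP => // h; by rewrite (val_inj h) eqxx in ij.
Qed.

Definition basis (ab : IJ) : 'M[C]_p := herm (upd (fun=> 0) ab 1).

Lemma herm_upd x ab t : herm (upd x ab t) = herm (upd x ab 0) + t%:C%C *: basis ab.
Proof.
apply/matrixP => i j; rewrite !mxE /upd.
have H (u v : IJ) (s : R): (if u == ab then t else s) =
   (if u == ab then 0 else s) + t * (if u == ab then 1 else 0).
  by case: ifP => _; rewrite ?mulr1 ?mulr0 ?add0r ?addr0.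
by case: eqVneq => _; [|case: ifP => _]; apply/eqP; rewrite eq_complex /=
  !(mul0r, mulr0, subr0, addr0, oppr0, add0r) ?eqxx ?andbT /=;
  repeat case: ifP => _; rewrite ?(mulr1, mulr0, add0r, addr0, oppr0, mulrN, mul0r, subr0, eqxx).
Qed.

Lemma basis_eq0 a b k l : basis (a, b) k l != 0 -> (k, l) = (a, b) \/ (k, l) = (b, a).
Proof.
rewrite /basis mxE /upd; case: (eqVneq k l) => [->|kl].
  by case: (eqVneq (l, l) (a, b)) => [[<- <-]|_]; [left|rewrite eqxx].
case: ifP => _.
- case: (eqVneq (k, l) (a, b)) => [->|_]; first by left.
  case: (eqVneq (l, k) (a, b)) => [[-> ->]|_]; first by right.
  by rewrite eqxx.
- case: (eqVneq (l, k) (a, b)) => [[-> ->]|_]; first by right.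
  case: (eqVneq (k, l) (a, b)) => [->|_]; first by left.
  by rewrite oppr0 eqxx.
Qed.

Lemma unhermD M (t : R) M' : unherm (M + t%:C%C *: M') = fun ij => unherm M ij + t * unherm M' ij.
Proof.
apply/funext => ij; rewrite /unherm !mxE; case: ifP => _.
  by case: (M _ _) (M' _ _) => [? ?] [? ?] /=; rewrite mul0r subr0.
by case: (M _ _) (M' _ _) => [? ?] [? ?] /=; rewrite mul0r addr0.
Qed.

(* [rho] orders the indices so that [L] is triangular with positive diagonal:
   [rho i = i] for a lower and [rho i = p - i] for an upper triangular [L]. *)
Definition tri_pos (rho : 'I_p -> nat) (L : 'M[C]_p) :=
  (forall i j, L i j != 0 -> j = i \/ (rho j < rho i)%N) /\ (forall i, 0 < L i i).

Variables (rho : 'I_p -> nat) (L A0 : 'M[C]_p).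
Hypotheses (tL : tri_pos rho L) (hA0 : herm_mx A0).

Let l i := complex.Re (L i i).

Lemma tri_pos_diag i : L i i = (l i)%:C%C.
Proof. by rewrite /l RRe_real // realE ltW ?tL.2. Qed.

Lemma tri_pos_diag_gt0 i : 0 < l i.
Proof. by have := tL.2 i; rewrite tri_pos_diag ltcR. Qed.

(** A nonzero term L_cj B_jk conj(L_dk) forces rho j <= rho c, rho k <= rho d and {j, k} = {a, b};
    the bound on the ranks then leaves only j = c, k = d. *)
Lemma congr_basis a b c d : (rho c + rho d <= rho a + rho b)%N ->
  (L *m basis (a, b) *m ctr L) c d = (l a * l b)%:C%C * basis (a, b) c d.
Proof.
move=> le; rewrite mxE (bigD1 d) //= [X in _ + X]big1 ?addr0; last first.
  move=> k kd; rewrite mxE mulr_suml big1 // => j _.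
  rewrite ctrE; apply/eqP; apply: contraNT kd => nz.
  have [n1 [n2 n3]] : L c j != 0 /\ basis (a, b) j k != 0 /\ L d k != 0.
    move: nz; rewrite !mulf_eq0 conjc_eq0 !negb_or -andbA => /and3P[]; by [].
  have [k0|k1] := tL.1 _ _ n3; first by rewrite k0.
  have [j0|j1] := tL.1 _ _ n1; have [[ej ek]|[ej ek]] := basis_eq0 n2.
  + by move: le; rewrite -ej -ek -j0 leqNgt ltn_add2l k1.
  + by move: le; rewrite -ej -ek -j0 addnC leq_add2r leqNgt k1.
  + by move: le; rewrite -ej -ek leqNgt -addnS leq_add // ltnW.
  + by move: le; rewrite -ej -ek [(rho k + _)%N]addnC leqNgt -addnS leq_add // ltnW.
rewrite mxE (bigD1 c) //= [X in _ + X]big1 ?addr0; last first.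
  move=> j jc; apply/eqP; apply: contraNT jc.
  rewrite mulf_eq0 negb_or => /andP[n1 n2].
  have [j0|j1] := tL.1 _ _ n1; first by rewrite j0.
  have [[ej ek]|[ej ek]] := basis_eq0 n2.
  + by move: le; rewrite -ej -ek leq_add2r leqNgt j1.
  + by move: le; rewrite -ej -ek addnC leq_add2l leqNgt j1.
rewrite ctrE !tri_pos_diag conjc_real.
have [->|nz] := eqVneq (basis (a, b) c d) 0; first by rewrite mulr0 mul0r mulr0.
have [[-> ->]|[-> ->]] := basis_eq0 nz; rewrite rmorphM /=.
  by rewrite mulrAC.
by rewrite mulrAC [X in X * _]mulrC.
Qed.

Definition congr_map (y : IJ -> R) : IJ -> R := unherm (L *m herm y *m ctr L + A0).

Lemma herm_congr_map y : herm (congr_map y) = L *m herm y *m ctr L + A0.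
Proof.
rewrite unhermK //; apply: hermD => //.
by have := herm_congr (ctr L) (herm_herm y); rewrite ctrK.
Qed.

Lemma congr_map_upd y ab t cd : congr_map (upd y ab t) cd =
  congr_map (upd y ab 0) cd + t * unherm (L *m basis ab *m ctr L) cd.
Proof.
rewrite /congr_map herm_upd mulmxDr mulmxDl -scalemxAr -scalemxAl addrAC.
by rewrite unhermD.
Qed.

Lemma unherm_congr_basis a b cd : (rho cd.1 + rho cd.2 <= rho a + rho b)%N ->
  unherm (L *m basis (a, b) *m ctr L) cd = l a * l b * (cd == (a, b))%:R.
Proof.
move=> le; have le' : (rho cd.2 + rho cd.1 <= rho a + rho b)%N by rewrite addnC.
transitivity (unherm ((l a * l b)%:C%C *: basis (a, b)) cd).
  by rewrite /unherm !congr_basis // !mxE.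
rewrite -[_ *: _]add0r unhermD hermK /unherm !mxE /= if_same add0r /upd.
by case: eqP.
Qed.

(** Each index occurs 2p times among the entries of all pairs. *)
Lemma prod_pairs :
  \prod_(ij : IJ) (l ij.1 * l ij.2)^-1 = \prod_i (l i) ^- (p.*2).
Proof.
rewrite -(pair_bigA _ (fun i j => (l i * l j)^-1)) /=.
transitivity (\prod_i ((l i)^-1 ^+ p * \prod_j (l j)^-1)).
  apply: eq_bigr => i _; under eq_bigr do rewrite invfM.
  by rewrite big_split /= prodr_const card_ord.
rewrite big_split /= prodr_const card_ord -prodrXl -big_split /=.
by apply: eq_bigr => i _; rewrite -exprD addnn exprVn.
Qed.

Lemma mmf_herm d (W : measurableType d) (phi : W -> IJ -> R) :
  (forall ij, measurable_fun setT (fun w => phi w ij)) ->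
  mmf (fun w => herm (phi w)).
Proof.
move=> h i j.
rewrite (_ : (fun w => herm (phi w) i j) = fun w =>
    if i == j then Complex (phi w (i, i)) 0
    else if (i < j)%N then Complex (phi w (i, j)) (phi w (j, i))
    else Complex (phi w (j, i)) (- phi w (i, j))); last first.
  by apply/funext => w; rewrite mxE.
case: (i == j); first by split; [exact: h|exact: measurable_cst].
case: (i < j)%N; first by split; exact: h.
by split; [exact: h|exact: (measurable_funN (h (i, j)))].
Qed.

Lemma measurable_unherm d (W : measurableType d) (M : W -> 'M[C]_p) : mmf M ->
  forall ij, measurable_fun setT (fun w => unherm (M w) ij).
Proof.
move=> h [i j]; rewrite /unherm /=; case: (i <= j)%N; [exact: (h i j).1|exact: (h j i).2].
Qed.

(** Ranking the coordinate (a, b) by [rho a + rho b] makes the congruence triangular, with slope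
    [l a * l b] ([congr_basis]). *)
Lemma lebint_congr (Psi : 'M[C]_p -> \bar R) :
  bmeas (Psi \o @herm R p) -> (forall M, (0 <= Psi M)%E) ->
  lebint (fun y => Psi (L *m herm y *m ctr L + A0)) =
  ((\prod_i (l i) ^- (p.*2))%:E * lebint (Psi \o @herm R p))%E.
Proof.
move=> mP P0.
rewrite (@eq_lebint _ _ _ ((Psi \o @herm R p) \o congr_map)); last first.
  by move=> y /=; rewrite herm_congr_map.
rewrite -prod_pairs.
apply: (@lebint_triangular R _ (fun ij => rho ij.1 + rho ij.2)%N
   (fun ij => l ij.1 * l ij.2) congr_map (Psi \o @herm R p) mP (fun y => P0 (herm y))).
- move=> d W phi mphi; apply: mP; apply: measurable_unherm.
  by apply: mmfD; [apply: mmfM; [apply: mmfM|]|]; do ?exact: mmf_cst; exact: mmf_herm.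
- by move=> i; rewrite mulr_gt0 ?tri_pos_diag_gt0.
- move=> [a b] x t; rewrite congr_map_upd unherm_congr_basis // eqxx mulr1 addrC.
  by rewrite mulrC.
- move=> [a b] [c d] x t ne le.
  rewrite congr_map_upd unherm_congr_basis // (negPf ne) !mulr0 addr0.
  rewrite -[in RHS](_ : upd x (a, b) (x (a, b)) = x); last first.
    by apply/funext => k; rewrite /upd; case: eqP => [->|].
  by rewrite [in RHS]congr_map_upd unherm_congr_basis // (negPf ne) !mulr0 addr0.
Qed.

End HermCoordinates.

Section SqrtCongruence.
Variables (R : realType) (p : nat).
Local Notation C := R[i].

Lemma lower_tri_pos (L : 'M[C]_p) : lower_pos L -> tri_pos (fun i => nat_of_ord i) L.
Proof.
move=> [/is_trig_mxP tL pL]; split=> // i j.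
case: (ltngtP i j) => [ij|ij|/val_inj ->]; [|by right|by left].
by rewrite tL ?eqxx.
Qed.

Lemma upper_tri_pos (L : 'M[C]_p) : lower_pos L ->
  tri_pos (fun i : 'I_p => p - i)%N (ctr L).
Proof.
move=> [/is_trig_mxP tL pL]; split=> [i j|i]; rewrite ctrE.
  case: (ltngtP i j) => [ij|ij|/val_inj ->]; [|by rewrite tL ?conjc0 ?eqxx|by left].
  by right; rewrite ltn_sub2l // (ltn_trans ij).
by have := pL i; rewrite !ltcE; case: (L i i) => a b /= /andP[/eqP -> ->]; rewrite oppr0 eqxx.
Qed.

Lemma bmeas_congr (Psi : 'M[C]_p -> \bar R) (L A0 : 'M[C]_p) :
  bmeas (Psi \o @herm R p) -> herm_mx A0 ->
  bmeas (fun y => Psi (L *m herm y *m ctr L + A0)).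
Proof.
move=> mP hA0 d W phi mphi.
rewrite (_ : (fun w => _) = (fun w => (Psi \o @herm R p) (congr_map L A0 (phi w)))).
  apply: mP; apply: measurable_unherm.
  by apply: mmfD; [apply: mmfM; [apply: mmfM|]|]; do ?exact: mmf_cst; exact: mmf_herm.
by apply/funext => w /=; rewrite herm_congr_map.
Qed.

Lemma lower_pos_detE (L : 'M[C]_p) : lower_pos L ->
  \det L = (\prod_i complex.Re (L i i))%:C%C.
Proof.
move=> [tL pL]; rewrite det_trig // rmorph_prod; apply: eq_bigr => i _.
by rewrite -[LHS]RRe_real // realE ltW // pL.
Qed.

Lemma lebint_msqrt_congr (Psi : 'M[C]_p -> \bar R) (D A0 : 'M[C]_p) :
  bmeas (Psi \o @herm R p) -> (forall M, (0 <= Psi M)%E) -> pd D -> herm_mx A0 ->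
  lebint (fun y => Psi (msqrt D *m herm y *m msqrt D + A0)) =
  ((complex.Re (\det D) ^- p)%:E * lebint (Psi \o @herm R p))%E.
Proof.
move=> mP P0 pD hA0; have [pX XX] := msqrt_pd pD.
have [L [lL EL]] := cholesky pX.
pose Psi' := fun M : 'M[C]_p => Psi (L *m M *m ctr L + A0).
have -> : lebint (fun y => Psi (msqrt D *m herm y *m msqrt D + A0)) =
    lebint (fun y => Psi' (ctr L *m herm y *m ctr (ctr L) + 0)).
  by apply: eq_lebint => y; rewrite /Psi' addr0 ctrK EL !mulmxA.
rewrite (lebint_congr (upper_tri_pos lL)); last 3 first.
- exact: herm0.
- exact: bmeas_congr.
- by move=> M; exact: P0.
rewrite [X in (_ * X)%E](_ : _ = lebint (fun y => Psi (L *m herm y *m ctr L + A0))) //.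
rewrite (lebint_congr (lower_tri_pos lL)) // muleA -EFinM; congr (EFin _ * _)%E.
(* [D] is the square of [L *m ctr L]. The two congruences contribute the power -2p each of every
   diagonal entry of [L], in total the power -p of [\det D]. *)
have -> : \det D = (\prod_i complex.Re (L i i) ^+ 4)%:C%C.
  rewrite -XX det_mulmx EL det_mulmx det_ctr (lower_pos_detE lL) conjc_real.
  rewrite -!rmorphM -!big_split; congr (_%:C)%C; apply: eq_bigr => i _ /=.
  by rewrite !exprS expr0 mulr1 !mulrA.
rewrite /= -big_split /= -prodrXl -prodfV; apply: eq_bigr => i _.
rewrite ctrE (_ : complex.Re _ = complex.Re (L i i)); last by case: (L i i).
rewrite -invfM -exprD -exprVn -exprM exprVn; congr (_ ^-1); congr (_ ^+ _).
by rewrite -muln2; lia.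
Qed.

End SqrtCongruence.

Section VectorCoordinates.
Variables (R : realType) (m : nat).
Local Notation C := R[i].
Local Notation IB := ('I_m * bool)%type.

Definition cvec (z : IB -> R) : 'cV[C]_m := \col_i Complex (z (i, true)) (z (i, false)).

Definition uncvec (v : 'cV[C]_m) : IB -> R :=
  fun ib => if ib.2 then complex.Re (v ib.1 0) else complex.Im (v ib.1 0).

Lemma uncvecK v : cvec (uncvec v) = v.
Proof.
by apply/matrixP => i j; rewrite ord1 mxE /uncvec /=; case: (v i 0).
Qed.

Lemma cvecK z : uncvec (cvec z) = z.
Proof. by apply/funext => -[i []]; rewrite /uncvec /= mxE. Qed.

Lemma mmf_cvec d (W : measurableType d) (phi : W -> IB -> R) :
  (forall ib, measurable_fun setT (fun w => phi w ib)) -> mmf (fun w => cvec (phi w)).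
Proof.
move=> h i j.
rewrite (_ : (fun w => _) = fun w => Complex (phi w (i, true)) (phi w (i, false))).
  by split; exact: h.
by apply/funext => w; rewrite mxE.
Qed.

Lemma measurable_uncvec d (W : measurableType d) (v : W -> 'cV[C]_m) : mmf v ->
  forall ib, measurable_fun setT (fun w => uncvec (v w) ib).
Proof.
by move=> h [i b]; rewrite /uncvec /=; case: b; [exact: (h i 0).1|exact: (h i 0).2].
Qed.

Lemma cvec_upd z ib t : cvec (upd z ib t) =
  cvec (upd z ib 0) + t%:C%C *: cvec (upd (fun=> 0) ib 1).
Proof.
apply/matrixP => i j; rewrite !mxE /upd.
have H (u v : IB) (s : R): (if u == v then t else s) =
   (if u == v then 0 else s) + t * (if u == v then 1 else 0).
  by case: ifP => _; rewrite ?mulr1 ?mulr0 ?add0r ?addr0.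
by apply/eqP; rewrite eq_complex /= !mul0r subr0 addr0 -!H !eqxx.
Qed.

Lemma uncvecD v (t : R) v' : uncvec (v + t%:C%C *: v') =
  fun ib => uncvec v ib + t * uncvec v' ib.
Proof.
apply/funext => ib; rewrite /uncvec !mxE; case: ifP => _.
  by case: (v _ _) (v' _ _) => [? ?] [? ?] /=; rewrite mul0r subr0.
by case: (v _ _) (v' _ _) => [? ?] [? ?] /=; rewrite mul0r addr0.
Qed.

Variable L : 'M[C]_m.
Hypothesis lL : lower_pos L.
Let l i := complex.Re (L i i).

Lemma uncvec_mul (a : 'I_m) (b : bool) (cd : IB) : (cd.1 <= a)%N ->
  uncvec (L *m cvec (upd (fun=> 0) (a, b) 1)) cd = l a * (cd == (a, b))%:R.
Proof.
move=> le; have [tL pL] := lower_tri_pos lL.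
have e : (L *m cvec (upd (fun=> 0) (a, b) 1)) cd.1 0 =
         (l a)%:C%C * cvec (upd (fun=> 0) (a, b) 1) cd.1 0.
  rewrite mxE (bigD1 cd.1) //= big1 ?addr0 => [|k kc].
    rewrite (tri_pos_diag (lower_tri_pos lL)) !mxE /upd.
    case: (eqVneq cd.1 a) => [->//|ne].
    by rewrite !xpair_eqE (negPf ne) /= mulr0 mulr0.
  apply/eqP; apply: contraNT kc; rewrite mulf_eq0 negb_or => /andP[n1 n2].
  have [->//|kl] := tL _ _ n1.
  move: n2; rewrite mxE /upd !xpair_eqE.
  by case: (eqVneq k a) => [e|]; [rewrite -e leqNgt kl in le|rewrite eqxx].
transitivity (uncvec (0 + (l a)%:C%C *: cvec (upd (fun=> 0) (a, b) 1)) cd).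
  by rewrite add0r /uncvec e !mxE.
rewrite uncvecD cvecK /uncvec !mxE /= if_same add0r /upd.
by case: eqP.
Qed.

(** The real and imaginary parts of a component have the same slope, hence the squares. *)
Lemma lebint_cvec (Phi : 'cV[C]_m -> \bar R) : bmeas (Phi \o cvec) ->
  (forall v, (0 <= Phi v)%E) ->
  lebint (fun z => Phi (L *m cvec z)) =
  ((\prod_i (l i) ^- 2)%:E * lebint (Phi \o cvec))%E.
Proof.
move=> mP P0.
pose T z := uncvec (L *m cvec z).
have TE z ib t cd : T (upd z ib t) cd =
    T (upd z ib 0) cd + t * uncvec (L *m cvec (upd (fun=> 0) ib 1)) cd.
  by rewrite /T cvec_upd mulmxDr -scalemxAr uncvecD.
rewrite (@eq_lebint _ _ _ ((Phi \o cvec) \o T)); last first.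
  by move=> z /=; rewrite /T uncvecK.
have -> : \prod_i (l i) ^- 2 = \prod_(ib : IB) (l ib.1)^-1.
  rewrite -(pair_bigA _ (fun i _ => (l i)^-1)) /=.
  by apply: eq_bigr => i _; rewrite prodr_const card_bool exprVn.
apply: (@lebint_triangular R _ (fun ib => nat_of_ord ib.1) (fun ib => l ib.1) T
   (Phi \o cvec) mP (fun z => P0 (cvec z))).
- move=> d W phi mphi; apply: mP; apply: measurable_uncvec.
  by apply: mmfM; [exact: mmf_cst|exact: mmf_cvec].
- by move=> ib; exact: (tri_pos_diag_gt0 (lower_tri_pos lL)).
- move=> [a b] z t; rewrite TE uncvec_mul // eqxx mulr1 addrC.
  by rewrite mulrC.
- move=> [a b] cd z t ne le.
  rewrite TE uncvec_mul // (negPf ne) !mulr0 addr0.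
  rewrite -[in RHS](_ : upd z (a, b) (z (a, b)) = z); last first.
    by apply/funext => k; rewrite /upd; case: eqP => [->|].
  by rewrite [in RHS]TE uncvec_mul // (negPf ne) !mulr0 addr0.
Qed.

End VectorCoordinates.

(** * The matrix beta integral *)

Section GammaInteger.
Variable R : realType.
Local Notation mu := (@lebesgue_measure R).

(** The exponential dominates its Taylor term of degree k + 1, leaving a bound (k + 1)! / t. *)
Lemma cvg_xn_expRN (k : nat) : (fun t : R => t ^+ k * expR (- t)) x @[x --> +oo%R] --> 0.
Proof.
apply/cvgrPdist_lt => e e0; near=> t.
have t0 : 0 < t by near: t; exact: nbhs_pinfty_gt.
have te : k.+1`!%:R / e < t by near: t; apply: nbhs_pinfty_gt; exact: num_real.
rewrite sub0r normrN ger0_norm ?mulr_ge0 ?exprn_ge0 ?expR_ge0 ?ltW //.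
rewrite expRN ltr_pdivrMr ?expR_gt0 //.
have h := expR_ge1Dxn k (ltW t0).
have f0 : 0 < k.+1`!%:R :> R by rewrite ltr0n fact_gt0.
have h2 : t ^+ k.+1 < k.+1`!%:R * expR t.
  by rewrite mulrC -ltr_pdivrMr //; apply: lt_le_trans h; rewrite ltrDr ltr01.
move: te; rewrite ltr_pdivrMr // => te.
rewrite -(ltr_pM2l t0) -exprS; apply: (lt_trans h2).
by rewrite mulrA ltr_pM2r // expR_gt0.
Unshelve. all: by end_near. Qed.

(** The primitive of t^n exp(-t) that vanishes at infinity, by integration by parts. *)
Fixpoint gamma_prim (n : nat) : R -> R := match n with
  | 0 => fun t => - expR (- t)
  | n'.+1 => fun t => - (t ^+ n'.+1 * expR (- t)) + n'.+1%:R * gamma_prim n' t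
  end.

Lemma is_derive_gamma_prim n (t : R) :
  is_derive t 1 (gamma_prim n) (t ^+ n * expR (- t)).
Proof.
elim: n => [|n IH] /=.
  by apply: is_derive_eq; rewrite expr0 mul1r mulrN1 opprK.
have H1 : is_derive t 1 (fun u : R => u ^+ n.+1 * expR (- u))
    (n.+1%:R * t ^+ n * expR (- t) - t ^+ n.+1 * expR (- t)).
  have A : is_derive t 1 (fun u : R => u ^+ n.+1) (n.+1%:R * t ^+ n).
    have := @is_deriveX _ _ _ n.+1 _ _ _ (is_derive_id t 1);
       rewrite /GRing.scale /= mulr1 exprfctE; apply.
  have B : is_derive t 1 (fun u : R => expR (- u)) (- expR (- t)).
    by apply: is_derive_eq; rewrite mulrN1.
  apply: is_derive_eq (is_deriveM A B) _.
  by rewrite /GRing.scale /=; ring.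
have H2 := @is_deriveZ _ _ _ (gamma_prim n) n.+1%:R t 1 _ IH.
have H3 := is_deriveD (is_deriveN H1) H2.
apply: is_derive_eq H3 _.
rewrite /GRing.scale /=; ring.
Qed.

Lemma gamma_prim0 n : gamma_prim n 0 = - n`!%:R.
Proof.
elim: n => [|n IH] /=; first by rewrite oppr0 expR0 fact0.
by rewrite exprS !mul0r oppr0 add0r IH factS natrM mulrN.
Qed.

Lemma cvg_gamma_prim n : gamma_prim n x @[x --> +oo%R] --> 0.
Proof.
elim: n => [|n IH] /=.
  rewrite -oppr0; apply: cvgN.
  have := cvg_xn_expRN 0; under eq_fun do rewrite expr0 mul1r; exact.
rewrite -[0](_ : - 0 + n.+1%:R * 0 = 0); last by rewrite mulr0 oppr0 addr0.
apply: cvgD; first by apply: cvgN; exact: cvg_xn_expRN.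
by apply: cvgM; [exact: cvg_cst|exact: IH].
Qed.

(** Truncated power; it is 0 for [u <= 0] even when [s = 0], so it carries the indicator of its
    domain. *)
Definition pospow (u : R) (s : nat) : R := if 0 < u then u ^+ s else 0.

Lemma pospow_ge0 u s : 0 <= pospow u s.
Proof. by rewrite /pospow; case: ifP => // u0; rewrite exprn_ge0 // ltW. Qed.

Lemma measurable_pospow d (W : measurableType d) (f : W -> R) s :
  measurable_fun setT f -> measurable_fun setT (fun w => pospow (f w) s).
Proof.
move=> mf.
rewrite (_ : (fun _ => _) = (fun w => (\1_[set w | 0 < f w] w) * f w ^+ s)).
  apply: measurable_funM.
    apply: measurable_indic; rewrite -[X in measurable X]setTI.
    rewrite (_ : [set w | _] = f @^-1` `]0, +oo[%classic).
      by apply: mf => //; exact: measurable_itv.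
    by apply/seteqP; split=> w /=; rewrite in_itv /= andbT.
  exact: measurable_funX.
apply/funext => w; rewrite /pospow indicE; case: ifP => h.
  by rewrite mem_set // mul1r.
by rewrite memNset ?mul0r //= h.
Qed.

Lemma measurable_expRN d (W : measurableType d) (f : W -> R) :
  measurable_fun setT f -> measurable_fun setT (fun w => expR (- f w)).
Proof.
move=> mf; apply: (measurableT_comp (@measurable_expR R)).
exact: measurable_funN.
Qed.

Lemma integral_gamma n :
  (\int[mu]_(t in `]0%R, +oo[) (t ^+ n * expR (- t))%:E)%E = (n`!%:R)%:E.
Proof.
have mf : measurable_fun setT (fun t : R => t ^+ n * expR (- t)).
  by apply: measurable_funM; [exact: measurable_funX|exact: measurable_expRN].
rewrite integral_itv_obnd_cbnd; last first.
  by apply/measurable_EFinP; exact: measurable_funTS.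
have dF t : derivable (gamma_prim n) t 1.
  by case: (is_derive_gamma_prim n t).
have cF t : {for t, continuous (gamma_prim n)}.
  by apply: differentiable_continuous; apply/derivable1_diffP.
rewrite (@ge0_continuous_FTC2y _ _ (gamma_prim n) 0 0).
- by rewrite gamma_prim0 -EFinB opprK add0r.
- by move=> x x0; rewrite mulr_ge0 ?exprn_ge0 ?expR_ge0.
- apply: continuous_subspaceT => x; apply: cvgM; first exact: exprn_continuous.
  by apply: continuous_comp; [exact: opp_continuous|exact: continuous_expR].
- exact: cvg_gamma_prim.
- by [].
- exact/cvg_at_right_filter/cF.
- by move=> x _; rewrite derive1E; case: (is_derive_gamma_prim n x).
Qed.

Lemma integral_pospow n :
  (\int[mu]_t (pospow t n * expR (- t))%:E)%E = (n`!%:R)%:E.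
Proof.
rewrite -integral_gamma [RHS]integral_mkcond; apply: eq_integral => t _.
rewrite patchE /pospow; case: ifP => h.
  by rewrite mem_set //= in_itv /= h.
by rewrite memNset ?mul0r //= in_itv /= h.
Qed.

Lemma Gamma_nat n : Gamma (n.+1%:R : R) = n`!%:R.
Proof.
rewrite /Gamma (_ : (\int[_]_(t in _) _)%E = (n`!%:R)%:E) //.
rewrite -integral_gamma; apply: eq_integral => t.
rewrite inE /= in_itv /= andbT => t0.
by rewrite -natr1 addrK powR_mulrn // ltW.
Qed.

Lemma integral_pospow_shift n (c : R) :
  (\int[mu]_t (expR (- t) * pospow (t - c) n)%:E)%E = (expR (- c) * n`!%:R)%:E.
Proof.
have mg : measurable_fun setT (fun t : measurableTypeR R => (pospow t n * expR (- t))%:E).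
  by apply/measurable_EFinP; apply: measurable_funM;
     [exact: measurable_pospow|exact: measurable_expRN].
have g0 (t : R) : (0 <= (pospow t n * expR (- t))%:E)%E.
  by rewrite lee_fin mulr_ge0 ?pospow_ge0 ?expR_ge0.
have := @integral_affine R 1 (- c) _ ltr01 mg g0.
rewrite invr1 mul1e integral_pospow => e.
rewrite EFinM -e -ge0_integralZl_EFin ?expR_ge0 //.
- apply: eq_integral => t _; rewrite mul1r -EFinM; congr EFin.
  by rewrite mulrCA -expRD [RHS]mulrC; congr (expR _ * _); ring.
- exact: (measurableT_comp mg (measurable_affine 1 (- c))).
Qed.

Lemma ge0_integralZ_R (k : R) (f : R -> \bar R) : measurable_fun setT f ->
  (forall t, 0 <= f t)%E -> 0 <= k ->
  (\int[mu]_t (k%:E * f t) = k%:E * \int[mu]_t f t)%E.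
Proof. by move=> mf f0 k0; rewrite ge0_integralZl_EFin. Qed.

Lemma pospowM (k x : R) s : 0 < k -> pospow (k * x) s = k ^+ s * pospow x s.
Proof.
move=> k0; rewrite /pospow pmulr_rgt0 //.
by case: ifP; rewrite ?mulr0 // exprMn.
Qed.

Lemma integral_pospow_beta (a b : nat) :
  (\int[mu]_t (pospow t a * pospow (1 - t) b)%:E)%E = (beta_fun a.+1 b.+1 : R)%:E.
Proof.
have mX : measurable_fun setT (fun x : R => (XMonemX a b x)%:E).
  apply/measurable_EFinP; apply: measurable_funM; apply: measurable_funX => //.
  exact: measurable_funB.
rewrite EFin_beta_fun /=.
transitivity (\int[mu]_(x in `[0%R, 1%R]) (XMonemX a b x)%:E)%E; last first.
  by rewrite integral_mkcond; apply: eq_integral => x _; rewrite restrict_EFin.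
rewrite -integral_itv_obnd_cbnd; last exact: measurable_funTS.
rewrite -integral_itv_bndo_bndc; last exact: measurable_funTS.
rewrite [RHS]integral_mkcond; apply: eq_integral => t _.
rewrite patchE /pospow /XMonemX subr_gt0.
case: (ltP 0 t) => [t0|t0]; last first.
  by rewrite memNset ?mul0r //= in_itv /= ltNge t0.
case: (ltP t 1) => [t1|t1]; last first.
  by rewrite memNset ?mulr0 //= in_itv /= t0 ltNge t1.
by rewrite mem_set //= in_itv /= t0 t1.
Qed.

(* Affine substitution turns this into Euler's beta integral. *)
Lemma integral_beta_interval (a b : nat) (u v : R) :
  (\int[mu]_t (pospow (t - u) a * pospow (v - t) b)%:E)%E =
  (pospow (v - u) (a + b).+1 * (a`! * b`!)%:R / (a + b).+1`!%:R)%:E.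
Proof.
have mg : measurable_fun setT
    (fun t : measurableTypeR R => (pospow (t - u) a * pospow (v - t) b)%:E).
  by apply/measurable_EFinP; apply: measurable_funM; apply: measurable_pospow;
     apply: measurable_funB.
have g0 (t : R) : (0 <= (pospow (t - u) a * pospow (v - t) b)%:E)%E.
  by rewrite lee_fin mulr_ge0 ?pospow_ge0.
have [uv|vu] := ltP u v; last first.
  rewrite integral0_eq; first by rewrite /pospow subr_gt0 ltNge vu /= !mul0r.
  move=> t _; rewrite /pospow !subr_gt0; case: ifP => [ut|]; last by rewrite mul0r.
  case: ifP => [tv|]; last by rewrite mulr0.
  by have := lt_trans ut tv; rewrite ltNge vu.
have d0 : 0 < v - u by rewrite subr_gt0.
have := @integral_affine R (v - u) u _ d0 mg g0.
move=> /(congr1 (fun z => ((v - u)%:E * z)%E)).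
rewrite muleA -EFinM mulfV ?gt_eqF // mul1e => <-.
have -> : (\int[mu]_t (pospow ((v - u) * t + u - u) a * pospow (v - ((v - u) * t + u)) b)%:E
   = ((v - u) ^+ (a + b))%:E * (beta_fun a.+1 b.+1 : R)%:E)%E.
  rewrite -integral_pospow_beta -ge0_integralZ_R; last 3 first.
  - by apply/measurable_EFinP; apply: measurable_funM; apply: measurable_pospow;
      do ?apply: measurable_funB.
  - by move=> t; rewrite lee_fin mulr_ge0 ?pospow_ge0.
  - by rewrite exprn_ge0 // ltW.
  apply: eq_integral => t _; rewrite -EFinM; congr EFin.
  have -> : v - ((v - u) * t + u) = (v - u) * (1 - t) by ring.
  by rewrite addrK !pospowM // exprD mulrACA.
rewrite beta_fun_fact /pospow d0 -!EFinM; congr EFin.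
by rewrite exprS !mulrA.
Qed.

End GammaInteger.

(** * Gaussian integrals and powers integrated over a ball *)

Section BallIntegral.
Variable R : realType.
Local Notation mu := (@lebesgue_measure R).

Lemma lebint_unit (f : (unit -> R) -> \bar R) :
  lebint f = (\int[mu]_t f (fun=> t))%E.
Proof.
rewrite /lebint (_ : enum _ = [:: tt]) /=.
  by apply: eq_integral => t _; congr f; apply/funext => -[].
by rewrite enumT unlock.
Qed.

Definition optv (I : Type) (x : I -> R) (t : R) : option I -> R :=
  fun o => if o is Some i then x i else t.

Lemma lebint_option (I : finType) (g : (option I -> R) -> \bar R) : bmeas g ->
  (forall x, 0 <= g x)%E ->
  lebint g = lebint (fun x => \int[mu]_t g (optv x t))%E /\
  lebint g = (\int[mu]_t lebint (fun x => g (optv x t)))%E.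
Proof.
move=> mg g0.
have iS : injective (@Some I) by move=> i j [].
have iN : injective (fun _ : unit => @None I) by move=> [] [].
have ov1 (x : I -> R) (t : unit -> R) :
    ovr (fun _ : unit => None) (ovr (@Some I) (fun=> 0) x) t = optv x (t tt).
  apply/funext => -[i|] /=; last by rewrite (@ovr_in _ _ _ _ _ _ tt).
  by rewrite ovr_out // ovr_in.
have ov2 (x : I -> R) (t : unit -> R) :
    ovr (@Some I) (ovr (fun _ : unit => None) (fun=> 0) t) x = optv x (t tt).
  apply/funext => -[i|] /=; first by rewrite ovr_in.
  by rewrite ovr_out // (@ovr_in _ _ _ _ _ _ tt).
split.
- rewrite (@lebint_split _ _ _ _ (@Some I) (fun _ : unit => None)) //.
    apply: eq_lebint => x; rewrite lebint_unit; apply: eq_integral => t _.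
    by rewrite ov1.
  by move=> [i|]; [left; exists i|right; exists tt].
- rewrite (@lebint_split _ _ _ _ (fun _ : unit => None) (@Some I)) //.
    rewrite lebint_unit; apply: eq_integral => t _.
    by apply: eq_lebint => x; rewrite ov2.
  by move=> [i|]; [right; exists i|left; exists tt].
Qed.

Lemma itint_prod (I : eqType) (s : seq I) (h : R -> R) (c : R) x :
  uniq s -> measurable_fun setT h -> (forall t, 0 <= h t) ->
  (\int[mu]_t (h t)%:E = c%:E)%E ->
  itint s (fun x => (\prod_(i <- s) h (x i))%:E) x = (c ^+ size s)%:E.
Proof.
move=> us mh h0 hc; elim: s us x => [|i s IH] us x; first by rewrite /= big_nil.
move: us => /= /andP[nis us].
have mp : bmeas (fun x : I -> R => (\prod_(j <- s) h (x j))%:E).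
  move=> d W phi mphi; apply/measurable_EFinP.
  elim: (s) => [|j s' IH'].
    by under eq_fun do rewrite big_nil; exact: measurable_cst.
  under eq_fun do rewrite big_cons.
  by apply: measurable_funM => //; exact: (measurableT_comp mh (mphi j)).
have p0 (y : I -> R) : (0 <= (\prod_(j <- s) h (y j))%:E)%E.
  by rewrite lee_fin prodr_ge0.
transitivity (\int[mu]_t ((c ^+ size s)%:E * (h t)%:E))%E.
  apply: eq_integral => t _.
  rewrite (_ : (fun _ => _) = fun y : I -> R => ((h (y i))%:E * (\prod_(j <- s) h (y j))%:E)%E).
    rewrite (@itintZ R I s (fun y => h (y i))) //; last first.
      move=> y j u js; rewrite /upd; case: eqVneq => // e.
      by rewrite e js in nis.
    by rewrite IH // /upd eqxx muleC.
  by apply/funext => y; rewrite big_cons EFinM.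
have c0 : 0 <= c by rewrite -lee_fin -hc; apply: integral_ge0 => t _; rewrite lee_fin.
rewrite ge0_integralZ_R //; last 2 first.
- exact/measurable_EFinP.
- by rewrite exprn_ge0.
by rewrite hc -EFinM exprS mulrC.
Qed.

Definition sumsq (I : finType) (x : I -> R) : R := \sum_i x i ^+ 2.

Lemma sumsq_ge0 (I : finType) (x : I -> R) : 0 <= sumsq x.
Proof. by apply: sumr_ge0 => i _; exact: sqr_ge0. Qed.

Lemma measurable_sumsq (I : finType) d (W : measurableType d) (phi : W -> I -> R) :
  (forall i, measurable_fun setT (fun w => phi w i)) ->
  measurable_fun setT (fun w => sumsq (phi w)).
Proof.
move=> mphi; rewrite /sumsq; apply: measurable_sum => i.
exact: measurable_funX.
Qed.

Lemma lebint_gauss (I : finType) :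
  lebint (fun x : I -> R => (expR (- sumsq x))%:E) = (Num.sqrt pi ^+ #|I|)%:E.
Proof.
have mh : measurable_fun setT (fun t : R => expR (- t ^+ 2)).
  by apply: measurable_expRN; exact: measurable_funX.
rewrite cardE /lebint -(@itint_prod I (enum I) (fun t => expR (- t ^+ 2)) _ (fun=> 0)) //.
- apply: eq_itint => x; congr EFin; rewrite /sumsq -sumrN expR_sum.
  by rewrite big_enum.
- exact: enum_uniq.
- exact: (@integralT_gauss R).
Qed.

Lemma lebint_scale (I : finType) (c : R) (f : (I -> R) -> \bar R) : 0 < c ->
  bmeas f -> (forall x, 0 <= f x)%E ->
  lebint (fun x => f (fun i => c * x i)) = ((c ^- #|I|)%:E * lebint f)%E.
Proof.
move=> c0 mf f0; rewrite -exprVn -prodr_const.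
apply: (@lebint_triangular R I (fun=> 0%N) (fun=> c) (fun x i => c * x i)) => //.
- move=> d W phi mphi; apply: mf => i.
  by apply: measurable_funM => //; exact: measurable_cst.
- by move=> i x t; rewrite /upd eqxx mulr0 addr0.
- by move=> i j x t ji _; rewrite /upd (negPf ji).
Qed.

Lemma bmeas_ball (I : finType) (t : R) s :
  bmeas (fun x : I -> R => (pospow (t - sumsq x) s)%:E).
Proof.
move=> d W phi mphi; apply/measurable_EFinP/measurable_pospow.
by apply: measurable_funB; [exact: measurable_cst|exact: measurable_sumsq].
Qed.

(* Integrate [expR (- t) * (t - |x|^2)_+ ^ s] over (x, t) in both orders: the
   t-integral gives [s! * expR (- |x|^2)], the x-integral a power of t. *)
Lemma ball_integral (I : finType) (m s : nat) : #|I| = m.*2 ->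
  lebint (fun x : I -> R => (pospow (1 - sumsq x) s)%:E) =
  (s`!%:R * pi ^+ m / (s + m)`!%:R)%:E.
Proof.
move=> cI; set V := lebint _.
pose g (z : option I -> R) : \bar R :=
  (expR (- z None) * pospow (z None - sumsq (fun i => z (Some i))) s)%:E.
have mg : bmeas g.
  move=> d W phi mphi; apply/measurable_EFinP; apply: measurable_funM.
    exact: measurable_expRN.
  by apply: measurable_pospow; apply: measurable_funB => //; exact: measurable_sumsq.
have g0 z : (0 <= g z)%E by rewrite lee_fin mulr_ge0 ?expR_ge0 ?pospow_ge0.
have [e1 e2] := lebint_option mg g0.
have V0 : (0 <= V)%E by apply: lebint_ge0 => x; rewrite lee_fin pospow_ge0.
have E1 : lebint g = (s`!%:R * pi ^+ m)%:E.
  rewrite e1 (@eq_lebint _ _ _ (fun x : I -> R => s`!%:R%:E * (expR (- sumsq x))%:E)%E).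
    rewrite lebintZ; last 3 first.
    - move=> d W phi mphi; apply/measurable_EFinP/measurable_expRN.
      exact: measurable_sumsq.
    - by move=> x; rewrite lee_fin expR_ge0.
    - exact: ler0n.
    by rewrite lebint_gauss cI -muln2 mulnC exprM sqr_sqrtr // pi_ge0.
  by move=> x; rewrite /g /= integral_pospow_shift EFinM muleC.
have E2 : lebint g = ((s + m)`!%:R%:E * V)%E.
  rewrite e2 -integral_pospow -ge0_integralZr //; last 2 first.
  - apply/measurable_EFinP; apply: measurable_funM; first exact: measurable_pospow.
    exact: measurable_expRN.
  - by move=> t _; rewrite lee_fin mulr_ge0 ?pospow_ge0 ?expR_ge0.
  apply: eq_integral => t _; rewrite /g /=.
  rewrite (@eq_lebint _ _ _ (fun x : I -> R => (expR (- t))%:E * (pospow (t - sumsq x) s)%:E)%E) //.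
  rewrite lebintZ ?expR_ge0 //; last 2 first.
  - exact: bmeas_ball.
  - by move=> x; rewrite lee_fin pospow_ge0.
  rewrite [X in (X%:E * V)%E]mulrC EFinM -muleA; congr (_ * _)%E.
  (* For [t <= 0] both sides vanish; for [t > 0] rescaling the 2m coordinates by the square root of
     [t] gives t^(s+m). *)
  have [t0|t0] := ltP 0 t; last first.
    rewrite {2}/pospow ltNge t0 /= mul0e.
    rewrite (@eq_lebint _ _ _ (fun x : I -> R => (0%R%:E * 0)%E)).
      rewrite lebintZ ?mul0e //; exact: measurable_cst.
    move=> x; rewrite mule0 /pospow ifF //; apply/negbTE.
    by rewrite -leNgt subr_le0 (le_trans t0) // sumsq_ge0.
  have st0 : 0 < Num.sqrt t by rewrite sqrtr_gt0.
  have b0 (x : I -> R) : (0 <= (pospow (t - sumsq x) s)%:E)%E.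
    by rewrite lee_fin pospow_ge0.
  have e := lebint_scale st0 (@bmeas_ball I t s) b0.
  rewrite cI -muln2 mulnC exprM sqr_sqrtr in e; last exact: ltW.
  have <- : ((t ^+ m)%:E * lebint (fun x : I -> R =>
     (pospow (t - sumsq (fun i => (Num.sqrt t * x i)%R)) s)%:E) =
     lebint (fun x : I -> R => (pospow (t - sumsq x) s)%:E))%E.
    by rewrite e muleA -EFinM mulfV ?mul1e // expf_neq0 // gt_eqF.
  rewrite (@eq_lebint _ _ _ (fun x : I -> R => (t ^+ s)%:E * (pospow (1 - sumsq x) s)%:E)%E).
    rewrite lebintZ; last 3 first.
    - exact: bmeas_ball.
    - by move=> x; rewrite lee_fin pospow_ge0.
    - by rewrite exprn_ge0 // ltW.
    by rewrite muleA -EFinM -exprD addnC /pospow t0.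
  move=> x; rewrite -EFinM -pospowM //; congr (pospow _ _)%:E.
  rewrite mulrBr mulr1; congr (_ - _); rewrite /sumsq mulr_sumr.
  by apply: eq_bigr => i _; rewrite exprMn sqr_sqrtr // ltW.
have f0 : (s + m)`!%:R != 0 :> R by rewrite pnatr_eq0 -lt0n fact_gt0.
(* [V] is still an extended real, so the factor is removed by multiplying with its inverse;
   finiteness follows from [E1]. *)
have <- : (((s + m)`!%:R^-1)%:E * lebint g = V)%E.
  by rewrite E2 muleA -EFinM mulVf // mul1e.
by rewrite E1 -EFinM mulrC.
Qed.

End BallIntegral.

(** * Recursion on the size for the matrix beta integral *)

Section MatrixBeta.
Variable R : realType.
Local Notation C := R[i].

Definition rdet p (X : 'M[C]_p) : R := complex.Re (\det X).

Lemma rdetE p (X : 'M[C]_p) : pd X -> \det X = (rdet X)%:C%C.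
Proof. by move=> /pd_det d0; rewrite /rdet RRe_real // realE ltW. Qed.

Lemma rdet_gt0 p (X : 'M[C]_p) : pd X -> 0 < rdet X.
Proof. by move=> pX; have := pd_det pX; rewrite rdetE // ltcR. Qed.

Definition bw p (a b : nat) (X : 'M[C]_p) : R :=
  if `[< pd X /\ pd (1%:M - X) >] then rdet X ^+ a * rdet (1%:M - X) ^+ b else 0.

Lemma bwE p a b (X : 'M[C]_p) : pd X -> pd (1%:M - X) ->
  bw a b X = rdet X ^+ a * rdet (1%:M - X) ^+ b.
Proof. by move=> p1 p2; rewrite /bw; case: asboolP => // -[]. Qed.

Lemma bw0 p a b (X : 'M[C]_p) : ~ (pd X /\ pd (1%:M - X)) -> bw a b X = 0.
Proof. by move=> h; rewrite /bw; case: asboolP. Qed.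

Lemma bw_ge0 p a b (X : 'M[C]_p) : 0 <= bw a b X.
Proof.
rewrite /bw; case: asboolP => // -[p1 p2].
by rewrite mulr_ge0 // exprn_ge0 // ltW // rdet_gt0.
Qed.

Lemma measurable_bw p a b d (W : measurableType d) (M : W -> 'M[C]_p) :
  mmf M -> (forall w, herm_mx (M w)) -> measurable_fun setT (fun w => bw a b (M w)).
Proof.
move=> mM hM.
have mM1 : mmf (fun w => 1%:M - M w) by apply: mmfB => //; exact: mmf_cst.
have hM1 w : herm_mx (1%:M - M w) by apply: hermB => //; exact: herm1.
rewrite (_ : (fun _ => _) = (fun w =>
    (\1_([set w | pd (M w)] `&` [set w | pd (1%:M - M w)]) w) *
    (rdet (M w) ^+ a * rdet (1%:M - M w) ^+ b))).
  apply: measurable_funM.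
    by apply: measurable_indic; apply: measurableI; exact: measurable_pd.
  by apply: measurable_funM; apply: measurable_funX;
     [exact: (cmf_det mM).1|exact: (cmf_det mM1).1].
apply/funext => w; rewrite /bw indicE; case: asboolP => h.
  by rewrite mem_set // mul1r.
by rewrite memNset ?mul0r.
Qed.

Lemma bmeas_bw p a b : bmeas (fun y => (bw a b (@herm R p y))%:E).
Proof.
move=> d W phi mphi; apply/measurable_EFinP/measurable_bw; first exact: mmf_herm.
by move=> w; exact: herm_herm.
Qed.

Section Step.
Variables (p a b : nat).
Local Notation IJ q := ('I_q * 'I_q)%type.
Local Notation IB := ('I_p * bool)%type.

Definition emb1 (ij : IJ p) : IJ (p + 1) := (lshift 1 ij.1, lshift 1 ij.2).
(** Coordinates of the border: [true] marks real parts, which [herm] stores above the diagonal,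
    [false] imaginary parts, stored below it, and [None] the corner. *)
Definition emb2 (o : option IB) : IJ (p + 1) := match o with
  | Some (i, true) => (lshift 1 i, rshift p 0)
  | Some (i, false) => (rshift p 0, lshift 1 i)
  | None => (rshift p 0, rshift p 0)
  end.

Lemma emb1_inj : injective emb1.
Proof. by move=> [i j] [k l] [] /val_inj -> /val_inj ->. Qed.

Lemma emb2_inj : injective emb2.
Proof.
have H (i : 'I_p) : lshift 1 i <> rshift p (0 : 'I_1).
  by move=> /(congr1 val) /= e; have := ltn_ord i; rewrite e addn0 ltnn.
move=> [[i c]|] [[j c']|] /= e; last by [].
- move: c c' e => [] [] /=.
  + by move=> [e]; have <- : i = j by apply: val_inj.
  + by move=> [e _]; case: (H i); apply: val_inj.
  + by move=> [e _]; case: (H j); apply: val_inj.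
  + by move=> [e]; have <- : i = j by apply: val_inj.
- by case: (H i); case: c e => [] [e]; apply: val_inj.
- by case: (H j); case: c' e => [] [e]; apply: val_inj.
Qed.

Lemma emb_disj i1 i2 : emb1 i1 != emb2 i2.
Proof.
have H (i : 'I_p) : (lshift 1 i == rshift p (0 : 'I_1)) = false.
  by apply/eqP => /(congr1 val) /= e; have := ltn_ord i; rewrite e addn0 ltnn.
by case: i1 i2 => [i j] [[k []]|] /=; rewrite /emb1 xpair_eqE /= !H ?andbF.
Qed.

Lemma emb_cover j : (exists i, emb1 i = j) \/ (exists i, emb2 i = j).
Proof.
case: j => j k; case: (split_ordP j) => j' ->; case: (split_ordP k) => k' ->.
- by left; exists (j', k').
- by right; exists (Some (j', true)); rewrite (ord1 k').
- by right; exists (Some (k', false)); rewrite (ord1 j').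
- by right; exists None; rewrite (ord1 j') (ord1 k').
Qed.

Lemma herm_glue (y1 : IJ p -> R) (w : option IB -> R) :
  herm (ovr emb2 (ovr emb1 (fun=> 0) y1) w) =
  hblock (herm y1) (cvec (fun ib => w (Some ib))) (w None)%:C%C%:M.
Proof.
pose g := ovr emb2 (ovr emb1 (fun=> 0) y1) w; rewrite -/g.
have g1 i j : g (lshift 1 i, lshift 1 j) = y1 (i, j).
  rewrite /g ovr_out; first by rewrite (@ovr_in _ _ _ emb1 _ _ (i, j)) //; exact: emb1_inj.
  by move=> k; rewrite eq_sym; exact: (emb_disj (i, j)).
have g2 o : g (emb2 o) = w o by rewrite /g ovr_in //; exact: emb2_inj.
have g2a i : g (lshift 1 i, rshift p 0) = w (Some (i, true)) by rewrite -g2.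
have g2b i : g (rshift p 0, lshift 1 i) = w (Some (i, false)) by rewrite -g2.
have g2c : g (rshift p 0, rshift p 0) = w None by rewrite -g2.
have H (i : 'I_p) : (lshift 1 i == rshift p (0 : 'I_1)) = false.
  by apply/eqP => /(congr1 val) /= e; have := ltn_ord i; rewrite e addn0 ltnn.
have H' (i : 'I_p) : (rshift p (0 : 'I_1) == lshift 1 i) = false by rewrite eq_sym.
apply/matrixP => i j; case: (split_ordP i) => i' ->; case: (split_ordP j) => j' ->.
- rewrite block_mxEul !mxE !g1 (inj_eq (@lshift_inj _ _)).
  by [].
- rewrite block_mxEur !mxE (ord1 j') H /= addn0 ltn_ord g2a g2b.
  by [].
- rewrite block_mxEdl ctrE !mxE (ord1 i') H' /= addn0 ltnNge ltnW //= g2a g2b.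
  by [].
- rewrite block_mxEdr !mxE (ord1 j') (ord1 i') eqxx g2c mulr1n.
  by [].
Qed.

Lemma herm_real_entry (S : 'M[C]_1) : herm_mx S -> S 0 0 = (complex.Re (S 0 0))%:C%C.
Proof.
move=> /matrixP/(_ 0 0); rewrite ctrE; case: (S 0 0) => x y [] /eqP.
by rewrite eq_sym -subr_eq0 opprK -mulr2n mulrn_eq0 /= => /eqP ->.
Qed.

Lemma pd_bordered (X : 'M[C]_p) (v : 'cV[C]_p) (t : R) : pd X ->
  let u := complex.Re (qform (invmx X) v) in
  (pd (hblock X v t%:C%C%:M) <-> 0 < t - u) /\
  rdet (hblock X v t%:C%C%:M) = rdet X * (t - u).
Proof.
move=> pX u; have hD : herm_mx (t%:C%C%:M : 'M[C]_1).
  by apply/matrixP => i j; rewrite !(ctrE, mxE) !ord1 conjc_real.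
have hS : herm_mx (ctr v *m invmx X *m v).
  by apply/herm_congr/herm_inv; case: pX.
have eS : (t%:C%C%:M - ctr v *m invmx X *m v) 0 0 = (t - u)%:C%C.
  rewrite mxE [in X in _ + X]mxE (herm_real_entry hS) -/(qform _ _) -/u.
  by rewrite mxE eqxx mulr1n rmorphB.
split.
  rewrite -ltcR -eS; split=> [/(pd_hblock _ pX.1 hD)[_ /pd_scalarP]//|h].
  by apply/(pd_hblock _ pX.1 hD); split=> //; apply/pd_scalarP.
rewrite /rdet det_hblock ?pd_unit // det_mx11 eS (rdetE pX) -rmorphM.
by [].
Qed.

Lemma compl_hblock (X : 'M[C]_p) (v : 'cV[C]_p) (t : R) :
  1%:M - hblock X v t%:C%C%:M = hblock (1%:M - X) (- v) (1 - t)%:C%C%:M.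
Proof.
rewrite /hblock scalar_mx_block opp_block_mx add_block_mx !add0r ctrN.
congr block_mx; apply/matrixP => i j; rewrite !mxE !ord1 eqxx !mulr1n.
by rewrite rmorphB rmorph1.
Qed.

Lemma qform_opp (X : 'M[C]_p) v : qform X (- v) = qform X v.
Proof. by rewrite /qform ctrN mulNmx mulmxN mulNmx opprK. Qed.

(** Schur complements of the bordered matrix and of its complement to 1: the corner [t] ranges over
    the interval from v^* X^-1 v to 1 - v^* (1 - X)^-1 v. *)
Lemma bw_hblock (X : 'M[C]_p) (v : 'cV[C]_p) (t : R) : pd X -> pd (1%:M - X) ->
  bw a b (hblock X v t%:C%C%:M) = bw a b X *
    (pospow (t - complex.Re (qform (invmx X) v)) a *
     pospow (1 - complex.Re (qform (invmx (1%:M - X)) v) - t) b).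
Proof.
move=> p1 p2; rewrite (bwE _ _ p1 p2).
have [c1 d1] := pd_bordered v t p1.
have [c2 d2] := pd_bordered (- v) (1 - t) p2.
rewrite /= qform_opp in c1 d1 c2 d2.
have e : 1 - complex.Re (qform (invmx (1%:M - X)) v) - t =
         1 - t - complex.Re (qform (invmx (1%:M - X)) v) by rewrite addrAC.
rewrite e /bw compl_hblock.
move: (hblock X v _) (hblock (1%:M - X) _ _) c1 d1 c2 d2 => H1 H2 c1 d1 c2 d2.
case: asboolP => [[h1 h2]|h].
  rewrite d1 d2 /pospow (c1.1 h1) (c2.1 h2) !exprMn.
  by rewrite mulrACA.
rewrite /pospow; case: ifP => [/c1 h1|_]; last by rewrite mul0r mulr0.
case: ifP => [/c2 h2|_]; last by rewrite !mulr0.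
by case: h.
Qed.

Lemma qform1_cvec m (z : 'I_m * bool -> R) : qform 1%:M (cvec z) = (sumsq z)%:C%C.
Proof.
rewrite qform1E /sumsq rmorph_sum /=.
transitivity (\sum_i \sum_(c : bool) (z (i, c) ^+ 2)%:C%C); last first.
  by rewrite pair_bigA; apply: eq_bigr => -[].
apply: eq_bigr => i _; rewrite mxE big_bool /=.
by apply/eqP; rewrite eq_complex /=; apply/andP; split; apply/eqP; ring.
Qed.

Lemma mmf_qform d (W : measurableType d) (M : 'M[C]_p) (v : W -> 'cV[C]_p) :
  mmf v -> measurable_fun setT (fun w => complex.Re (qform M (v w))).
Proof.
move=> mv; rewrite /qform.
suff /(_ 0 0)[] : mmf (fun w => ctr (v w) *m M *m v w) by [].
apply: mmfM => //; apply: mmfM; last exact: mmf_cst.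
by move=> i j; under eq_fun do rewrite ctrE; apply: cmf_conj.
Qed.

(** With M^-1 = L L^*, the substitution v = L z turns the form into |z|^2, in 2p real dimensions;
    the Jacobian is the determinant of M^-1. *)
Lemma ellipsoid_integral (M : 'M[C]_p) s : pd M ->
  lebint (fun z : IB -> R => (pospow (1 - complex.Re (qform M (cvec z))) s)%:E) =
  (rdet (invmx M) * (s`!%:R * pi ^+ p / (s + p)`!%:R))%:E.
Proof.
move=> pM; have [L [lL EL]] := cholesky (pd_inv pM).
pose Phi := fun v : 'cV[C]_p => (pospow (1 - complex.Re (qform M v)) s)%:E.
have mPhi : bmeas (Phi \o @cvec R p).
  move=> d W phi mphi; apply/measurable_EFinP/measurable_pospow.
  apply: measurable_funB; first exact: measurable_cst.
  by apply: mmf_qform; exact: mmf_cvec.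
have P0 v : (0 <= Phi v)%E by rewrite lee_fin pospow_ge0.
have := lebint_cvec lL mPhi P0.
have uL : L \in unitmx.
  by have := pd_unit (pd_inv pM); rewrite EL unitmx_mul => /andP[].
have LML : ctr L *m M *m L = 1%:M.
  by apply: mulmx1C; rewrite mulmxA -EL mulVmx // pd_unit.
rewrite (@eq_lebint _ _ (fun z => Phi (L *m cvec z))
    (fun z => (pospow (1 - sumsq z) s)%:E)); last first.
  by move=> z; rewrite /Phi -qform_congr LML qform1_cvec.
rewrite (@ball_integral _ _ p) ?card_prod ?card_bool ?card_ord ?muln2 //.
set l := fun i => complex.Re (L i i).
have l0 i : 0 < l i by have := lL.2 i; rewrite (tri_pos_diag (lower_tri_pos lL)) ltcR.
have -> : rdet (invmx M) = \prod_i (l i) ^+ 2.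
  rewrite /rdet EL det_mulmx det_ctr (lower_pos_detE lL) conjc_real -rmorphM /=.
  by rewrite -big_split; apply: eq_bigr => i _; rewrite expr2.
move=> e; rewrite EFinM e muleA -EFinM -big_split /=.
rewrite big1 ?mul1e // => i _.
by rewrite mulfV // expf_neq0 // gt_eqF.
Qed.

(** The integral over the corner is Euler's and leaves (1 - v^* M v)_+ to the power a + b + 1, with
    M = X^-1 + (1 - X)^-1; the integral over v contributes det M^-1 = det X det (1 - X), which
    raises both exponents by one. *)
Lemma beta_inner (X : 'M[C]_p) : herm_mx X ->
  lebint (fun w : option IB -> R =>
    (bw a b (hblock X (cvec (fun ib => w (Some ib))) (w None)%:C%C%:M))%:E) =
  (a`!%:R * b`!%:R * pi ^+ p / (a + b + p).+1`!%:R * bw a.+1 b.+1 X)%:E.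
Proof.
move=> hX.
have [[p1 p2]|np] := pselect (pd X /\ pd (1%:M - X)); last first.
  rewrite (bw0 _ _ np) mulr0 (@eq_lebint _ _ _ (fun=> (0%R%:E * 0)%E)).
    by rewrite lebintZ ?mul0e //; exact: measurable_cst.
  move=> w; rewrite mul0e bw0 // compl_hblock => -[h1 h2]; apply: np.
  have hD t : herm_mx (t%:C%C%:M : 'M[C]_1).
    by apply/matrixP => i j; rewrite !(ctrE, mxE) !ord1 conjc_real.
  have h1X : herm_mx (1%:M - X) by apply: hermB => //; exact: herm1.
  split; first by case/(pd_hblock _ hX (hD _)): h1.
  by case/(pd_hblock _ h1X (hD _)): h2.
have mg : bmeas (fun w : option IB -> R =>
    (bw a b (hblock X (cvec (fun ib => w (Some ib))) (w None)%:C%C%:M))%:E).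
  move=> d W phi mphi; apply/measurable_EFinP.
  under eq_fun do rewrite bw_hblock //.
  apply: measurable_funM; first exact: measurable_cst.
  have mq M : measurable_fun setT
      (fun w => complex.Re (qform M (cvec (fun ib => phi w (Some ib))))).
    by apply: mmf_qform; apply: (@mmf_cvec _ _ _ _ (fun w ib => phi w (Some ib))).
  apply: measurable_funM; apply: measurable_pospow; apply: measurable_funB => //.
  by apply: measurable_funB => //; exact: measurable_cst.
have g0 (w : option IB -> R) :
    (0 <= (bw a b (hblock X (cvec (fun ib => w (Some ib))) (w None)%:C%C%:M))%:E)%E.
  by rewrite lee_fin bw_ge0.
rewrite (lebint_option mg g0).1.
pose M := invmx X + invmx (1%:M - X).
have pM : pd M by apply: pdD; [exact: pd_inv|exact/pd_psd/pd_inv].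
have dM : rdet (invmx M) = rdet X * rdet (1%:M - X).
  (* Here the two summands [X] and [1%:M - X] add up to the identity. *)
  have := det_parallel (pd_unit p1) (pd_unit p2) (pd_unit (pd_inv pM)) (invmxK M).
  rewrite addrC subrK det1 mulr1 (rdetE p1) (rdetE p2) => e.
  by rewrite {1}/rdet e -rmorphM.
pose s := (a + b).+1.
rewrite (@eq_lebint _ _ _ (fun z : IB -> R =>
   (bw a b X * ((a`! * b`!)%:R / s`!%:R))%:E *
   (pospow (1 - complex.Re (qform M (cvec z))) s)%:E)%E); last first.
  move=> z; under eq_integral do rewrite bw_hblock //= EFinM.
  rewrite ge0_integralZ_R; last 3 first.
  - by apply/measurable_EFinP; apply: measurable_funM; apply: measurable_pospow;
      apply: measurable_funB.
  - by move=> t; rewrite lee_fin mulr_ge0 ?pospow_ge0.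
  - exact: bw_ge0.
  rewrite integral_beta_interval -!EFinM; congr EFin.
  rewrite (_ : _ - _ = 1 - complex.Re (qform M (cvec z))); last first.
    rewrite /M qformD; case: (qform _ _) (qform _ _) => [x x'] [y y'] /=.
    by rewrite opprD addrA addrAC.
  move: (pospow _ _) (bw _ _ _) => P B.
  by rewrite -(mulrA P) (mulrC P) mulrA.
rewrite lebintZ; last 3 first.
- move=> d W phi mphi; apply/measurable_EFinP/measurable_pospow.
  apply: measurable_funB; first exact: measurable_cst.
  by apply: mmf_qform; exact: mmf_cvec.
- by move=> z; rewrite lee_fin pospow_ge0.
- by rewrite mulr_ge0 ?bw_ge0 // mulr_ge0 ?ler0n // invr_ge0 ler0n.
rewrite ellipsoid_integral // dM -EFinM; congr EFin.
rewrite (bwE _ _ p1 p2) (bwE _ _ p1 p2) /s natrM !exprS addSn.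
have f0 : (a + b).+1`!%:R != 0 :> R by rewrite pnatr_eq0 -lt0n fact_gt0.
have g1 : (a + b + p).+1`!%:R != 0 :> R by rewrite pnatr_eq0 -lt0n fact_gt0.
move: f0 g1 (rdet X) (rdet (_ - _)); move: (_ `!%:R) (_ `!%:R) => F G f0 g1 x y.
by field; rewrite f0 g1.
Qed.

Lemma beta_step :
  lebint (fun y : IJ (p + 1) -> R => (bw a b (herm y))%:E) =
  ((a`!%:R * b`!%:R * pi ^+ p / (a + b + p).+1`!%:R)%:E *
   lebint (fun y : IJ p -> R => (bw a.+1 b.+1 (herm y))%:E))%E.
Proof.
rewrite (@lebint_split _ _ _ _ emb1 emb2); last 6 first.
- exact: emb1_inj.
- exact: emb2_inj.
- exact: emb_disj.
- exact: emb_cover.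
- exact: bmeas_bw.
- by move=> y; rewrite lee_fin bw_ge0.
rewrite (@eq_lebint _ _ _ (fun y : IJ p -> R =>
  (a`!%:R * b`!%:R * pi ^+ p / (a + b + p).+1`!%:R)%:E * (bw a.+1 b.+1 (herm y))%:E)%E).
  rewrite lebintZ //; first exact: bmeas_bw.
    by move=> y; rewrite lee_fin bw_ge0.
  by rewrite !mulr_ge0 ?ler0n ?invr_ge0 ?exprn_ge0 ?pi_ge0.
move=> y1; rewrite -EFinM -beta_inner; last exact: herm_herm.
by apply: eq_lebint => w; rewrite herm_glue.
Qed.

End Step.

(** Here [a] and [b] are the exponents of the determinants; the usual beta parameters are [a + p]
    and [b + p]. *)
Definition betaC (p a b : nat) : R :=
  pi ^+ 'C(p, 2) * \prod_(i < p) ((a + i)`!%:R * (b + i)`!%:R / (a + b + p + i)`!%:R).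

Lemma betaC_gt0 p a b : 0 < betaC p a b.
Proof.
apply: mulr_gt0; first by rewrite exprn_gt0 // pi_gt0.
by apply: prodr_gt0 => i _; rewrite !mulr_gt0 ?invr_gt0 ?ltr0n ?fact_gt0.
Qed.

Lemma matrix_beta p a b :
  lebint (fun y : 'I_p * 'I_p -> R => (bw a b (herm y))%:E) = (betaC p a b)%:E.
Proof.
elim: p a b => [|p IH] a b.
  rewrite /lebint (_ : enum _ = [::]) /=; last first.
    by apply/eqP; rewrite -size_eq0 -cardE card_prod card_ord.
  rewrite bwE; [|exact: pd0|exact: pd0].
  by rewrite /rdet !det_mx00 !expr1n mulr1 /betaC big_ord0 mulr1.
rewrite -[p.+1]addn1 beta_step IH -EFinM; congr EFin.
(* The factor [pi ^+ p] of [beta_step] accounts for C(p + 1, 2) = C(p, 2) + p, its factorials for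
   the index 0 of the product. *)
rewrite /betaC addn1 binS bin1 exprD big_ord_recl !addn0.
have -> : \prod_(i < p) ((a + bump 0 i)`!%:R * (b + bump 0 i)`!%:R /
    (a + b + p.+1 + bump 0 i)`!%:R) =
   \prod_(i < p) ((a.+1 + i)`!%:R * (b.+1 + i)`!%:R /
    (a.+1 + b.+1 + p + i)`!%:R) :> R.
  apply: eq_bigr => i _; rewrite /bump /= add1n !addnS !addSn.
  by rewrite -!addnS.
rewrite (addnS (a + b) p); set P := \prod_(i < p) _.
by ring.
Qed.

End MatrixBeta.

(** * The moment space *)

Section DiscretizedPositivity.
Variable R : realType.

Lemma expr_lipschitz (q : nat) (s x t : R) : 0 <= s -> s <= x -> x <= t -> t <= 1 ->
  x ^+ q - s ^+ q <= q%:R * (t - s).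
Proof.
move=> s0 sx xt t1; have x0 := le_trans s0 sx; have x1 := le_trans xt t1.
elim: q => [|q IH]; first by rewrite !expr0 subrr mul0r.
rewrite !exprS.
have -> : x * x ^+ q - s * s ^+ q = x ^+ q * (x - s) + s * (x ^+ q - s ^+ q) by ring.
have h1 : x ^+ q * (x - s) <= t - s.
  apply: (@le_trans _ _ (x - s)); last by rewrite lerD2r.
  by rewrite ler_piMl ?subr_ge0 // exprn_ile1.
have h2 : s * (x ^+ q - s ^+ q) <= q%:R * (t - s).
  apply: le_trans IH; rewrite ler_piMl // ?(le_trans sx) //.
  by rewrite subr_ge0 lerXn2r ?nnegrE.
by rewrite -natr1 mulrDl mul1r addrC lerD.
Qed.

Local Notation "'I01'" := (`[0, 1]%classic : set R).

Lemma integrable_expr (nu : {finite_measure set R -> \bar R}) (B : set R) q :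
  measurable B -> B `<=` I01 -> nu.-integrable B (fun x => (x ^+ q)%:E).
Proof.
move=> mB B01; apply: measurable_bounded_integrable => //.
- by have := fin_num_measure nu B mB; rewrite ge0_fin_numE.
- exists 1; split; first exact: num_real.
  move=> r r1 x /B01 /=; rewrite in_itv /= => /andP[x0 x1].
  rewrite ger0_norm ?exprn_ge0 //.
  by rewrite (le_trans _ (ltW r1)) // exprn_ile1.
Qed.

Lemma moment_approx (nu : {finite_measure set R -> \bar R}) (B : set R) q (s t : R) :
  measurable B -> 0 <= s -> t <= 1 -> B `<=` `[s, t]%classic ->
  `|\int[nu]_(x in B) x ^+ q - s ^+ q * fine (nu B)| <= q%:R * (t - s) * fine (nu B).
Proof.
move=> mB s0 t1 Bst.
have B01 : B `<=` I01.
  move=> x /Bst /=; rewrite !in_itv /= => /andP[sx xt].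
  by rewrite (le_trans s0 sx) (le_trans xt t1).
have ix := integrable_expr nu q mB B01.
have ic (c : R) : nu.-integrable B (EFin \o cst c).
  apply: measurable_bounded_integrable => //; last exact: bounded_cst.
  by have := fin_num_measure nu B mB; rewrite ge0_fin_numE.
rewrite -!Rintegral_cst // -RintegralB //; last exact: ic.
rewrite ger0_norm; last first.
  apply: Rintegral_ge0 => x /Bst /=; rewrite in_itv /= => /andP[sx xt].
  by rewrite subr_ge0 lerXn2r ?nnegrE // (le_trans s0).
apply: le_Rintegral => //; [|exact: ic|].
  exact: (integrableB mB ix (ic _)).
move=> x /Bst /=; rewrite in_itv /= => /andP[sx xt].
exact: expr_lipschitz.
Qed.

Variables (F : finType) (nu : F -> {finite_measure set R -> \bar R}).
Variables (q : F -> nat) (c : F -> R).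
Hypothesis pos : forall (B : set R) (y : R), measurable B -> B `<=` I01 ->
  0 <= y <= 1 -> 0 <= \sum_f c f * y ^+ q f * fine (nu f B).

Let Phi (B : set R) := \sum_f c f * \int[nu f]_(x in B) x ^+ q f.
(** Per unit of length of an interval containing [B], this bounds the error of freezing the powers;
    being additive in [B], it does not grow under subdivision. *)
Let tau (B : set R) := \sum_f `|c f| * (q f)%:R * fine (nu f B).

Let Phi_split (B : set R) m : measurable B -> B `<=` I01 ->
  Phi B = Phi (B `&` `]-oo, m]%classic) + Phi (B `&` `]m, +oo[%classic).
Proof.
move=> mB B01; rewrite /Phi -big_split /=; apply: eq_bigr => f _.
rewrite -mulrDr; congr (_ * _).
have eB : B = (B `&` `]-oo, m]%classic) `|` (B `&` `]m, +oo[%classic).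
  rewrite -setIUr (_ : _ `|` _ = setT) ?setIT //.
  apply/seteqP; split=> // x _ /=; rewrite !in_itv /= andbT.
  by case: (leP x m); [left|right].
rewrite {1}eB Rintegral_setU //; try exact: measurableI.
- by rewrite -eB; exact: integrable_expr.
- apply/disj_setPS => x [[_ /= x1] [_ /= x2]]; move: x1 x2.
  by rewrite !in_itv /= andbT => x1; rewrite ltNge x1.
Qed.

Let tau_split (B : set R) m : measurable B ->
  tau B = tau (B `&` `]-oo, m]%classic) + tau (B `&` `]m, +oo[%classic).
Proof.
move=> mB; rewrite /tau -big_split /=; apply: eq_bigr => f _.
rewrite -mulrDr; congr (_ * _).
have eB : B = (B `&` `]-oo, m]%classic) `|` (B `&` `]m, +oo[%classic).
  rewrite -setIUr (_ : _ `|` _ = setT) ?setIT //.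
  apply/seteqP; split=> // x _ /=; rewrite !in_itv /= andbT.
  by case: (leP x m); [left|right].
rewrite -fineD ?fin_num_measure //; try exact: measurableI.
rewrite -measureU //; [by rewrite -eB|exact: measurableI|exact: measurableI|].
apply/seteqP; split=> // x [[_ /= x1] [_ /= x2]]; move: x1 x2.
by rewrite !in_itv /= andbT => x1; rewrite ltNge x1.
Qed.

Let Phi_crude (B : set R) (s t : R) : measurable B -> 0 <= s -> s <= t -> t <= 1 ->
  B `<=` `[s, t]%classic -> - ((t - s) * tau B) <= Phi B.
Proof.
move=> mB s0 st t1 Bst.
have B01 : B `<=` I01.
  move=> x /Bst /=; rewrite !in_itv /= => /andP[sx xt].
  by rewrite (le_trans s0 sx) (le_trans xt t1).
have p := pos mB B01 (_ : 0 <= s <= 1).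
have {}p : 0 <= \sum_f c f * s ^+ q f * fine (nu f B).
  by apply: p; rewrite s0 (le_trans st).
rewrite lerNl -subr_ge0 opprK.
apply: (le_trans p); rewrite mulr_sumr -big_split /=.
apply: ler_sum => f _.
have := moment_approx (nu f) (q f) mB s0 t1 Bst.
set I := Rintegral _ _ _; set v := fine _ => h.
rewrite -lerBlDr -mulrA -mulrBr.
apply: (le_trans (ler_norm _)); rewrite normrM distrC.
apply: (le_trans (ler_wpM2l (normr_ge0 _) h)).
by rewrite le_eqVlt; apply/orP; left; apply/eqP; ring.
Qed.

(** Bisection: the length is halved at each level, while the two values of [tau] add up to the old
    one. *)
Let Phi_refined n (B : set R) (s t : R) : measurable B -> 0 <= s -> s <= t -> t <= 1 ->
  B `<=` `[s, t]%classic -> - ((t - s) / 2 ^+ n * tau B) <= Phi B.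
Proof.
elim: n B s t => [|n IH] B s t mB s0 st t1 Bst.
  by rewrite expr0 divr1; exact: Phi_crude.
pose m := (s + t) / 2.
have sm : s <= m by rewrite /m; lra.
have mt : m <= t by rewrite /m; lra.
have B01 : B `<=` I01.
  move=> x /Bst /=; rewrite !in_itv /= => /andP[sx xt].
  by rewrite (le_trans s0 sx) (le_trans xt t1).
rewrite (Phi_split m mB B01) (tau_split m mB) mulrDr opprD.
have e : (t - s) / 2 ^+ n.+1 = (m - s) / 2 ^+ n.
  by rewrite /m exprS invfM mulrA; congr (_ * _); field.
have e' : (t - s) / 2 ^+ n.+1 = (t - m) / 2 ^+ n.
  by rewrite /m exprS invfM mulrA; congr (_ * _); field.
apply: lerD; [rewrite e|rewrite e']; apply: IH => //.
- exact: measurableI.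
- exact: le_trans t1.
- move=> x [/Bst /=]; rewrite !in_itv /= => /andP[-> _] ->.
  by [].
- exact: measurableI.
- exact: le_trans sm.
- move=> x [/Bst /=]; rewrite !in_itv /= andbT => /andP[_ ->] /ltW ->.
  by [].
Qed.

(* Cutting [0, 1] into 2^n pieces and freezing the powers on each of them costs
   an error of order 2^-n. *)
Lemma moment_pos : 0 <= \sum_f c f * \int[nu f]_(x in I01) x ^+ q f.
Proof.
have h n : - (tau I01 / 2 ^+ n) <= Phi I01.
  have := @Phi_refined n I01 0 1 (measurable_itv _) (lexx _) ler01 (lexx _).
  by rewrite subr0 mul1r mulrC; apply.
have t0 : 0 <= tau I01.
  by apply: sumr_ge0 => f _; rewrite !mulr_ge0 ?fine_ge0.
rewrite -/(Phi I01) leNgt; apply/negP => P0.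
have P1 : 0 < - Phi I01 by rewrite oppr_gt0.
(* A negative value of [Phi] would be exceeded by the error at level [N], since N < 2^N. *)
have [N hN] : exists N : nat, tau I01 / - Phi I01 < N%:R.
  by exists (Num.bound (tau I01 / - Phi I01)); apply: archi_boundP; rewrite divr_ge0 // ltW.
have := h N; rewrite leNgt => /negP; apply.
rewrite ltrNr ltr_pdivrMr ?exprn_gt0 //.
move: hN; rewrite ltr_pdivrMr // mulrC => /lt_le_trans; apply.
by rewrite ler_pM2l // -natrX ler_nat ltnW // ltn_expl.
Qed.

End DiscretizedPositivity.

(** * Nonnegativity of the Hankel matrices of a matrix measure *)

Section MomentHankels.
Variables (R : realType) (p : nat).
Local Notation C := R[i].

Definition cmx4 (tau : 'I_4 -> 'I_p -> 'I_p -> R) : 'M[C]_p :=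
  \matrix_(i, j) Complex (tau 0 i j - tau 1 i j) (tau 2 i j - tau 3 i j).

Section Expansion.
Variables (m : nat) (v : 'cV[C]_(\sum_(i < m) p)).
Local Notation N := (\sum_(i < m) p)%N.
Local Notation F := ('I_N * 'I_N * 'I_4)%type.
Local Notation blk k := (nat_of_ord (@tagnat.sig1 m (fun=> p) k)).
Local Notation pos k := (@tagnat.sig2 m (fun=> p) k).

(** The coefficients that write the real part of a Hankel quadratic form as a real linear
    combination of the four real components of each entry, the shape required by [moment_pos]. *)
Definition hcoef (f : F) : R :=
  let z := conjc (v f.1.1 0) * v f.1.2 0 in
  match val f.2 with
  | 0 => complex.Re z | 1 => - complex.Re z | 2 => - complex.Im z | _ => complex.Im z
  end.

Lemma qform_hankr e (tau : nat -> 'I_4 -> 'I_p -> 'I_p -> R) :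
  complex.Re (qform (hankr m m e (fun q => cmx4 (tau q))) v) =
  \sum_(f : F) hcoef f *
    tau (blk f.1.1 + blk f.1.2 + e)%N f.2 (pos f.1.1) (pos f.1.2).
Proof.
rewrite -(pair_bigA _ (fun (kl : 'I_N * 'I_N) r => hcoef (kl, r) *
    tau (blk kl.1 + blk kl.2 + e)%N r (pos kl.1) (pos kl.2))) /=.
rewrite -(pair_bigA _ (fun k l => \sum_r hcoef ((k, l), r) *
    tau (blk k + blk l + e)%N r (pos k) (pos l))) /= exchange_big /=.
have ReS (I : finType) (G : I -> C) :
    complex.Re (\sum_i G i) = \sum_i complex.Re (G i).
  by elim/big_rec2 : _ => // i x y _ <-; case: (G i) y => [? ?] [? ?].
rewrite /qform mxE ReS; apply: eq_bigr => l _.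
rewrite mxE mulr_suml ReS; apply: eq_bigr => k _.
rewrite ctrE /hankr mxE /cmx4 mxE.
rewrite !big_ord_recl big_ord0 addr0 /hcoef /=.
have -> : lift ord0 (lift ord0 (lift ord0 ord0)) = 3 :> 'I_4 by apply: val_inj.
have -> : lift ord0 (lift ord0 ord0) = 2 :> 'I_4 by apply: val_inj.
have -> : lift ord0 ord0 = 1 :> 'I_4 by apply: val_inj.
have -> : ord0 = 0 :> 'I_4 by apply: val_inj.
rewrite mulrAC; move: (_ * v l 0) (tau _ 0 _ _) (tau _ 1 _ _) (tau _ 2 _ _) (tau _ 3 _ _).
by move=> [x y] t0 t1 t2 t3 /=; ring.
Qed.
End Expansion.

Lemma psd_Re_ge0 n (A : 'M[C]_n) v : psd A -> 0 <= complex.Re (qform A v).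
Proof. by case=> _ /(_ v); rewrite -/(qform A v) lecE => /andP[]. Qed.

Lemma psd_herm n (A : 'M[C]_n) : herm_mx A ->
  (forall v, 0 <= complex.Re (qform A v)) -> psd A.
Proof.
move=> hA h; split=> // v; rewrite -/(qform A v) lecE (h v) andbT /=.
have : conjc (qform A v) = qform A v.
  rewrite /qform -ctrE; congr (fun_of_matrix _ _ _).
  by rewrite !ctrM ctrK hA mulmxA.
case: (qform A v) => [x y] [] /eqP; rewrite eqNr => /eqP ->.
by rewrite eqxx.
Qed.

(** The Hankel matrix of a mass [M] at the point [y] is y^e W^* M W, with W the row of blocks
    y^j. *)
Lemma hankr_point m e (y : R) (M : 'M[C]_p) : 0 <= y -> psd M ->
  psd (hankr m m e (fun q => (y ^+ q)%:C%C *: M)).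
Proof.
move=> y0 pM.
pose W : 'M[C]_(p, \sum_(j < m) p) := \mxrow_(j < m) ((y ^+ j)%:C%C *: 1%:M).
have cW : ctr W = \mxcol_(j < m) ((y ^+ j)%:C%C *: 1%:M).
  apply/matrixP => i j; rewrite ctrE !mxE conjcM conjc_nat eq_sym.
  by congr (_ * _); apply/eqP; rewrite eq_complex /= oppr0 !eqxx.
suff -> : hankr m m e (fun q => (y ^+ q)%:C%C *: M) = (y ^+ e)%:C%C *: (ctr W *m M *m W).
  by apply: psdZ; [exact: exprn_ge0|exact: psd_congr].
rewrite cW mxcol_mul /W mul_mxcol_mxrow /hankr.
have E a b : (y ^+ (a + b + e))%:C%C *: M =
    (y ^+ e)%:C%C *: ((y ^+ a)%:C%C *: 1%:M *m M *m ((y ^+ b)%:C%C *: 1%:M)).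
  rewrite -!scalemxAl mul1mx -!scalemxAr mulmx1 !scalerA -!rmorphM /=.
  by congr (_%:C%C *: _); rewrite !exprD; ring.
by apply/matrixP => i j; rewrite mxE E mxE [in RHS]mxE [in RHS]mxE.
Qed.

Section OfMeasure.
Variable nu : 'I_4 -> 'I_p -> 'I_p -> {finite_measure set R -> \bar R}.
Hypothesis pnu : matrix_measure nu.

Let moment q r i j : R := \int[nu r i j]_(x in `[0, 1]%classic) x ^+ q.

Lemma cmx4_point (B : set R) (y : R) q :
  cmx4 (fun r i j => y ^+ q * fine (nu r i j B)) = (y ^+ q)%:C%C *: cmeas nu B.
Proof.
apply/matrixP => i j; rewrite !mxE.
by apply/eqP; rewrite eq_complex /=; apply/andP; split; apply/eqP; ring.
Qed.

(** [moment_pos] reduces this to powers frozen at a point [y] and the mass of a set [B], that is, to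
    [hankr_point]. *)
Lemma moment_hankr_ge0 m e v : 0 <= complex.Re (qform (hankr m m e (cmoment nu)) v).
Proof.
rewrite (qform_hankr v e moment).
apply: (@moment_pos R _ (fun f => nu f.2 _ _) (fun f => _ + _ + e)%N (hcoef v)).
move=> B y mB B01 /andP[y0 y1].
have := psd_Re_ge0 v (hankr_point m e y0 (pnu.1 B mB B01)).
have -> : (fun q => (y ^+ q)%:C%C *: cmeas nu B) =
  (fun q => cmx4 (fun r i j => y ^+ q * fine (nu r i j B))).
  by apply/funext => q; rewrite cmx4_point.
rewrite (qform_hankr v e (fun q r i j => y ^+ q * fine (nu r i j B))).
by under eq_bigr do rewrite mulrA.
Qed.

Lemma moment_hankr_dS_ge0 m e v :
  0 <= complex.Re (qform (hankr m m e (dS (cmoment nu))) v).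
Proof.
(* The boolean separates the two terms of [dS]: [true] is the subtracted moment, with exponent
   raised by one. With powers frozen at [y] they combine into the nonnegative factor 1 - y. *)
pose sg (b : bool) : R := if b then -1 else 1.
pose G := (bool * ('I_(\sum_(i < m) p) * 'I_(\sum_(i < m) p) * 'I_4))%type.
have ReB (A A' : 'M[C]_(\sum_(i < m) p)) :
    complex.Re (qform (A - A') v) = complex.Re (qform A v) - complex.Re (qform A' v).
  by rewrite qformD -scaleN1r qformZ mulN1r; case: (qform A v) (qform A' v) => [? ?] [].
have E (tau : nat -> 'I_4 -> 'I_p -> 'I_p -> R) :
    complex.Re (qform (hankr m m e (dS (fun q => cmx4 (tau q)))) v) =
    \sum_(g : G) sg g.1 * hcoef v g.2 *
      tau (@tagnat.sig1 m (fun=> p) g.2.1.1 + @tagnat.sig1 m (fun=> p) g.2.1.2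
           + (g.1 + e))%N g.2.2
        (@tagnat.sig2 m (fun=> p) g.2.1.1) (@tagnat.sig2 m (fun=> p) g.2.1.2).
  rewrite hankrB ReB (qform_hankr v e tau) (qform_hankr v e.+1 tau).
  rewrite -(pair_bigA _ (fun b f => sg b * hcoef v f *
      tau (@tagnat.sig1 m (fun=> p) f.1.1 + @tagnat.sig1 m (fun=> p) f.1.2
           + (b + e))%N f.2
        (@tagnat.sig2 m (fun=> p) f.1.1) (@tagnat.sig2 m (fun=> p) f.1.2))) /=.
  rewrite big_bool /= addrC -sumrN; congr (_ + _); apply: eq_bigr => f _.
    by rewrite mul1r add0n.
  by rewrite mulN1r mulNr add1n.
rewrite (E moment).
apply: (@moment_pos R G (fun g => nu g.2.2 _ _) (fun g => _ + _ + (g.1 + e))%N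
  (fun g => sg g.1 * hcoef v g.2)).
move=> B y mB B01 /andP[y0 y1].
have := E (fun q r i j => y ^+ q * fine (nu r i j B)).
under [X in _ = X -> _]eq_bigr do rewrite mulrA.
move=> <-.
have -> : (fun q => cmx4 (fun r i j => y ^+ q * fine (nu r i j B))) =
  (fun q => (y ^+ q)%:C%C *: cmeas nu B).
  by apply/funext => q; rewrite cmx4_point.
have pB := pnu.1 B mB B01.
have -> : dS (fun q => (y ^+ q)%:C%C *: cmeas nu B) =
   (fun q => (y ^+ q)%:C%C *: ((1 - y)%:C%C *: cmeas nu B)).
  apply/funext => q; rewrite /dS -scalerBl scalerA -!rmorphM -!rmorphB /=.
  by congr (_%:C%C *: _); rewrite exprS; ring.
have y1' : 0 <= 1 - y by rewrite subr_ge0.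
exact: (psd_Re_ge0 v (hankr_point m e y0 (psdZ y1' pB))).
Qed.

End OfMeasure.
End MomentHankels.

Section MomentSequences.
Variables (R : realType) (p n : nat).
Local Notation C := R[i].
Implicit Type x : 'I_n * ('I_p * 'I_p) -> R.

Lemma herm_Sseq x k : herm_mx (Sseq x k).
Proof.
case: k => [|k] /=; first exact: herm1.
by case: insubP => [i _ _|_]; [exact: herm_herm|exact: herm0].
Qed.

Lemma Sseq0 x : Sseq x 0 = 1%:M.
Proof. by []. Qed.

Lemma SseqE x (k : 'I_n) : Sseq x k.+1 = momS x k.
Proof. by rewrite /= insubT //= => h; congr (momS x _); apply: val_inj. Qed.

Lemma interior_interE x : interior_moments x <-> inter n (Sseq x).
Proof.
split=> [h k kn|h k]; last exact: h.
exact: (h (Ordinal kn)).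
Qed.

Lemma cmoment0 (nu : 'I_4 -> 'I_p -> 'I_p -> {finite_measure set R -> \bar R}) :
  cmoment nu 0 = cmeas nu `[0, 1]%classic.
Proof.
have E r i j : (\int[nu r i j]_(x in `[0%R, 1%R]) (x ^+ 0)%:E)%E = nu r i j `[0, 1]%classic.
  under eq_integral do rewrite expr0.
  by rewrite integral_cst // mul1e.
by apply/matrixP => i j; rewrite !mxE !E.
Qed.

Lemma moment_space_hankr x : moment_space x ->
  (forall m e, (m.*2 + e <= n)%N -> psd (hankr m.+1 m.+1 e (Sseq x))) /\
  (forall m e, (m.*2 + e < n)%N -> psd (hankr m.+1 m.+1 e (dS (Sseq x)))).
Proof.
move=> [nu [pnu mom]].
have SE k : (k <= n)%N -> Sseq x k = cmoment nu k.
  case: k => [_|k kn]; first by rewrite cmoment0 pnu.2.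
  by rewrite (SseqE x (Ordinal kn)) mom.
split=> m e me; apply: psd_herm.
- exact/ctr_hankr/herm_Sseq.
- move=> v; have -> : hankr m.+1 m.+1 e (Sseq x) = hankr m.+1 m.+1 e (cmoment nu).
    apply: eq_mxblock => i j; apply: SE.
    by have := (ltn_ord i, ltn_ord j) => -[]; lia.
  exact: moment_hankr_ge0.
- exact/ctr_hankr/herm_dS/herm_Sseq.
- move=> v; have -> : hankr m.+1 m.+1 e (dS (Sseq x)) = hankr m.+1 m.+1 e (dS (cmoment nu)).
    apply: eq_mxblock => i j.
    by rewrite /dS; congr (_ - _); apply: SE; have := (ltn_ord i, ltn_ord j) => -[]; lia.
  exact: moment_hankr_dS_ge0.
Qed.

End MomentSequences.

(** * Atomic matrix measures representing interior points *)

Section AtomicMeasures.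
Variables (R : realType) (N : nat) (lam : nat -> R) (w : nat -> {nonneg R}).

Definition atomic : set R -> \bar R :=
  msum (fun j => [the {measure set R -> \bar R} of mscale (w j) \d_(lam j)]) N.

HB.instance Definition _ := Measure.on atomic.

Lemma atomicE B : atomic B = (\sum_(j < N) (w j)%:num * \1_B (lam j))%:E.
Proof.
rewrite /atomic /msum /mscale -sumEFin; apply: eq_bigr => j _.
by rewrite EFinM.
Qed.

Let fin_atomic : fin_num_fun atomic.
Proof. by move=> B mB; rewrite atomicE. Qed.

HB.instance Definition _ := @Measure_isFinite.Build _ _ _ atomic fin_atomic.

Lemma atomic_moment q : (forall j, (j < N)%N -> 0 <= lam j <= 1) ->
  (\int[atomic]_(x in `[0%R, 1%R]) (x ^+ q)%:E = (\sum_(j < N) (w j)%:num * lam j ^+ q)%:E)%E.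
Proof.
move=> l01; have mq : measurable_fun (`[0, 1]%classic : set R) (fun x : R => (x ^+ q)%:E).
  by apply/measurable_EFinP; apply: measurable_funX.
have q0 (x : R) : `[0, 1]%classic x -> (0 <= (x ^+ q)%:E)%E.
  by rewrite /= in_itv /= lee_fin => /andP[x0 _]; exact: exprn_ge0.
rewrite /atomic ge0_integral_measure_sum // -sumEFin; apply: eq_bigr => j _.
rewrite /= ge0_integral_mscale // integral_dirac // diracE mem_set ?mul1e //=.
by rewrite in_itv /= l01.
Qed.

End AtomicMeasures.

Section Representation.
Variables (R : realType) (p : nat).
Local Notation C := R[i].

Lemma norm_add_ge0 (a : R) : 0 <= `|a| + a.
Proof. by rewrite -lerBlDr sub0r -normrN ler_norm. Qed.

(* [|a| + a] and [|a|] are nonnegative with difference [a]. *)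
Definition jordan_part (r : 'I_4) (z : C) : {nonneg R} :=
  match val r with
  | 0 => NngNum (norm_add_ge0 (complex.Re z)) | 1 => NngNum (normr_ge0 (complex.Re z))
  | 2 => NngNum (norm_add_ge0 (complex.Im z)) | _ => NngNum (normr_ge0 (complex.Im z))
  end.

Variables (N : nat) (lam : 'I_N -> R) (A : 'I_N -> 'M[C]_p).
Hypotheses (l01 : forall j, 0 <= lam j <= 1) (pA : forall j, psd (A j)).

(** Extends families over ['I_N] to all naturals, since [atomic] takes sequences. *)
Let ext (T : Type) (t0 : T) (f : 'I_N -> T) k := if insub k is Some i then f i else t0.

Let extE T (t0 : T) f (i : 'I_N) : ext t0 f i = f i.
Proof. by rewrite /ext valK. Qed.

Definition atomic_matrix r a b : {finite_measure set R -> \bar R} :=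
  atomic N (ext 0 lam) (fun k => jordan_part r (ext 0 A k a b)).

Lemma jordan_combine (f : 'I_N -> R) a b :
  Complex (\sum_(j < N) (jordan_part 0 (A j a b))%:num * f j -
           \sum_(j < N) (jordan_part 1 (A j a b))%:num * f j)
          (\sum_(j < N) (jordan_part 2 (A j a b))%:num * f j -
           \sum_(j < N) (jordan_part 3 (A j a b))%:num * f j) =
  \sum_j (f j)%:C%C * A j a b.
Proof.
have -> (G : 'I_N -> C) : \sum_j G j = Complex (\sum_j complex.Re (G j)) (\sum_j complex.Im (G j)).
  by elim/big_rec3 : _ => // i x y z _ ->; case: (G i).
rewrite -!sumrB; apply/eqP; rewrite eq_complex /=; apply/andP.
by split; apply/eqP/eq_bigr => j _; case: (A j a b) => u v /=; ring.
Qed.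

Lemma cmeas_atomic B : cmeas atomic_matrix B = \sum_j (\1_B (lam j))%:C%C *: A j.
Proof.
apply/matrixP => a b; rewrite summxE mxE.
have aE r : fine (atomic_matrix r a b B) =
    \sum_(j < N) (jordan_part r (A j a b))%:num * \1_B (lam j).
  rewrite (congr1 fine (atomicE _ _ _ B)) /=.
  by apply: eq_bigr => j _; rewrite !extE.
under [RHS]eq_bigr do rewrite mxE.
by rewrite -jordan_combine !aE.
Qed.

Lemma cmoment_atomic q : cmoment atomic_matrix q = \sum_j (lam j ^+ q)%:C%C *: A j.
Proof.
have h k : (k < N)%N -> 0 <= ext 0 lam k <= 1 by move=> kN; rewrite (extE 0 lam (Ordinal kN)).
apply/matrixP => a b; rewrite summxE mxE.
have aE r : fine (\int[atomic_matrix r a b]_(x in `[0%R, 1%R]) (x ^+ q)%:E)%E =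
    \sum_(j < N) (jordan_part r (A j a b))%:num * lam j ^+ q.
  rewrite (congr1 fine (atomic_moment _ q h)) /=.
  by apply: eq_bigr => j _; rewrite !extE.
under [RHS]eq_bigr do rewrite mxE.
by rewrite -jordan_combine !aE.
Qed.

Lemma psd_cmeas_atomic B : psd (cmeas atomic_matrix B).
Proof.
rewrite cmeas_atomic; elim/big_ind : _ => [|X Y|j _]; [exact: psd0|exact: psdD|].
by apply: psdZ (pA j); rewrite indicE.
Qed.

End Representation.

Lemma interior_moment_space (R : realType) p n (x : 'I_n * ('I_p * 'I_p) -> R) :
  interior_moments x -> moment_space x.
Proof.
move=> /interior_interE /(atoms (herm_Sseq x) (Sseq0 x))[N [lam [A [l01 pA mom]]]].
exists (atomic_matrix lam A); split.
  split=> [B _ _|]; first exact: psd_cmeas_atomic.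
  rewrite -cmoment0 cmoment_atomic // -mom //.
move=> k; rewrite cmoment_atomic // -mom //.
by rewrite SseqE.
Qed.

Lemma indic_le (R : realType) (T T' : Type) (A : set T) (B : set T') x y : (A x -> B y) ->
  ((\1_A x)%:E <= (\1_B y)%:E :> \bar R)%E.
Proof.
move=> AB; rewrite lee_fin !indicE ler_nat.
by case: (boolP (x \in A)) => // /set_mem/AB yB; rewrite mem_set.
Qed.

(** The limit e -> 0 made explicit by Bernoulli's inequality. An infinite [u] has to be treated, as
    the volume of the moment space is not yet known to be finite. *)
Lemma limit_pow_le (R : realType) (N : nat) (u V : \bar R) : (0 <= u)%E ->
  (forall e : R, 0 < e < 1 -> (((1 - e) ^+ N)%:E * u <= V)%E) -> (u <= V)%E.
Proof.
move=> u0 h; have V0 : (0 <= V)%E.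
  apply: le_trans (h (2^-1) _); last by apply/andP; split; lra.
  by rewrite mule_ge0 // lee_fin exprn_ge0 //; lra.
case: V h V0 => [v|//|//] h V0; last by rewrite leey.
case: u u0 h => [u|//|//] u0 h; last first.
  have : (((1 - 2^-1) ^+ N)%:E * +oo <= v%:E)%E by apply: h; apply/andP; split; lra.
  by rewrite gt0_muley ?leye_eq // lte_fin exprn_gt0 //; lra.
rewrite lee_fin; rewrite lee_fin in u0.
apply/ler_addgt0Pl => d d0.
have uN : 0 <= u * N%:R by rewrite mulr_ge0.
have [e [e0 e1 ed]] : exists e : R, [/\ 0 < e, e < 1 & u * N%:R * e <= d].
  (* The summand 1 avoids a division by zero, and the bound 1/2 keeps [e] below 1. *)
  exists (Num.min (d / (1 + u * N%:R)) 2^-1); split.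
  - by rewrite lt_min divr_gt0 //; lra.
  - by apply: (@le_lt_trans _ _ 2^-1); [rewrite ge_min lexx orbT|lra].
  - apply: (@le_trans _ _ (u * N%:R * (d / (1 + u * N%:R)))).
      by apply: ler_wpM2l => //; rewrite ge_min lexx.
    rewrite mulrCA ler_piMr //; [exact: ltW|rewrite ler_pdivrMr; lra].
have := h e; rewrite e0 e1 lee_fin => /(_ isT) he.
have B : 1 - N%:R * e <= (1 - e) ^+ N.
  elim: N {uN ed he h} => [|k IH]; first by rewrite mul0r subr0 expr0.
  rewrite exprS; apply: (@le_trans _ _ ((1 - e) * (1 - k%:R * e))); last first.
    by apply: ler_wpM2l => //; lra.
  have k0 : 0 <= k%:R * e ^+ 2 by rewrite mulr_ge0 // sqr_ge0.
  by rewrite -natr1; lra.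
have := ler_wpM2l u0 B; move: he; rewrite [_ * u]mulrC => he h2.
by have := le_trans h2 he; lra.
Qed.

(** * Contraction into the interior and equality of volumes *)

Section InteriorConvexity.
Variables (R : realType) (p n : nat).
Local Notation C := R[i].
Local Notation J := ('I_n * ('I_p * 'I_p))%type.
Implicit Type x c : J -> R.

(** The homothety of center [c] and ratio [1 - e]. *)
Definition cvx (e : R) c x : J -> R := fun j => (1 - e) * x j + e * c j.

Lemma Sseq_cvx e c x k :
  Sseq (cvx e c x) k = (1 - e)%:C%C *: Sseq x k + e%:C%C *: Sseq c k.
Proof.
case: k => [|k] /=.
  by rewrite -scalerDl -rmorphD /= subrK scale1r.
case: insubP => [i _ _|_]; last by rewrite !scaler0 addr0.
apply/matrixP => a b; rewrite /momS /cvx !mxE.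
by case: ifP => _; [|case: ifP => _]; apply/eqP; rewrite eq_complex /=;
  apply/andP; split; apply/eqP; ring.
Qed.

Lemma hankr_lin m e (a b : C) (S T : nat -> 'M[C]_p) :
  hankr m m e (fun k => a *: S k + b *: T k) =
  a *: hankr m m e S + b *: hankr m m e T.
Proof. by apply/matrixP => i j; rewrite !mxE. Qed.

Lemma dS_lin (a b : C) (S T : nat -> 'M[C]_p) :
  dS (fun k => a *: S k + b *: T k) = fun k => a *: dS S k + b *: dS T k.
Proof. by apply/funext => k; rewrite /dS opprD addrACA !scalerBr. Qed.

(** The Hankel matrices are affine in the moments: a nonnegative one, from [x], plus a positive
    definite one, from [c]. *)
Lemma interior_cvx e c x : 0 < e < 1 -> interior_moments c -> moment_space x ->
  interior_moments (cvx e c x).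
Proof.
move=> /andP[e0 e1] /interior_interE ic mx; apply/interior_interE.
have [cl cu] := (inter_hankP (herm_Sseq c) (Sseq0 c) n).1 ic.
have [xl xu] := moment_space_hankr mx.
have e1' : 0 <= 1 - e by rewrite subr_ge0 ltW.
have -> : Sseq (cvx e c x) = fun k => (1 - e)%:C%C *: Sseq x k + e%:C%C *: Sseq c k.
  by apply/funext => k; exact: Sseq_cvx.
have hS k : herm_mx ((1 - e)%:C%C *: Sseq x k + e%:C%C *: Sseq c k).
  by apply: hermD; apply: hermZ; exact: herm_Sseq.
apply/(inter_hankP hS); first by rewrite -Sseq_cvx.
split=> m b mb.
  rewrite hankr_lin addrC.
  exact: (pdD (pdZ e0 (cl m b mb)) (psdZ e1' (xl m b mb))).
rewrite dS_lin hankr_lin addrC.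
exact: (pdD (pdZ e0 (cu m b mb)) (psdZ e1' (xu m b mb))).
Qed.

Lemma bset_interior : bset (@interior_moments R p n).
Proof.
move=> d W phi mphi.
have mS k : mmf (fun w => Sseq (phi w) k).
  case: k => [|k] /=; first exact: mmf_cst.
  case: insubP => [i _ _|_]; last exact: mmf_cst.
  by apply: mmf_herm => ij; exact: mphi.
have mdS k : mmf (fun w => dS (Sseq (phi w)) k) by apply: mmfB.
have mH m e (S : W -> nat -> 'M[C]_p) : (forall k, mmf (fun w => S w k)) ->
    (forall w k, herm_mx (S w k)) -> measurable [set w | pd (hankr m m e (S w))].
  move=> mS' hS; apply: measurable_pd => [i j|w]; last exact: ctr_hankr.
  by rewrite /hankr; under eq_fun do rewrite mxE; exact: mS'.
(* The pairs (m, e) of [inter_hankP] are coded by k = 2m + e, which gives countable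
   intersections. *)
have -> : [set w | interior_moments (phi w)] =
    (\bigcap_k [set w | (k <= n)%N -> pd (hankr k./2.+1 k./2.+1 (odd k) (Sseq (phi w)))]) `&`
    (\bigcap_k [set w | (k < n)%N -> pd (hankr k./2.+1 k./2.+1 (odd k) (dS (Sseq (phi w))))]).
  apply/seteqP; split=> w /=.
    move=> /interior_interE/(inter_hankP (herm_Sseq _) (Sseq0 _))[hl hu].
    by split=> k _ kn; [apply: hl|apply: hu]; rewrite addnC odd_double_half.
  move=> [hl hu]; apply/interior_interE/(inter_hankP (herm_Sseq _) (Sseq0 _)).
  split=> m e mn; [have := hl (m.*2 + e)%N I mn|have := hu (m.*2 + e)%N I mn];
    by rewrite half_bit odd_bit.
apply: measurableI; apply: bigcapT_measurable => k.
  case: (boolP (k <= n)%N) => kn; last first.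
    by rewrite (_ : [set w | _] = setT) //; apply/seteqP; split.
  rewrite (_ : [set w | _] = [set w | pd (hankr k./2.+1 k./2.+1 (odd k) (Sseq (phi w)))]).
    by apply: mH => // w j; exact: herm_Sseq.
  by apply/seteqP; split=> w /=; [apply|].
case: (boolP (k < n)%N) => kn; last first.
  by rewrite (_ : [set w | _] = setT) //; apply/seteqP; split.
rewrite (_ : [set w | _] = [set w | pd (hankr k./2.+1 k./2.+1 (odd k) (dS (Sseq (phi w))))]).
  by apply: mH => // w j; apply/herm_dS/herm_Sseq.
by apply/seteqP; split=> w /=; [apply|].
Qed.

(** The substitution is made in the measurable indicator of the interior; the indicator of the
    moment space enters only through [lebint_le]. *)
Lemma vol_moment_space c : interior_moments c ->
  lebint (fun x => (\1_(@moment_space R p n) x)%:E) =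
  lebint (fun x => (\1_(@interior_moments R p n) x)%:E).
Proof.
move=> ic; apply/eqP; rewrite eq_le; apply/andP; split; last first.
  apply: lebint_le => x; first by rewrite lee_fin indicE.
  by apply: indic_le; exact: interior_moment_space.
set V := lebint (fun x => (\1_(@interior_moments R p n) x)%:E).
have V0 : (0 <= V)%E by apply: lebint_ge0 => x; rewrite lee_fin indicE.
have le e : 0 < e < 1 ->
    (((1 - e) ^+ #|{: J}|)%:E * lebint (fun x => (\1_(@moment_space R p n) x)%:E) <= V)%E.
  move=> e01; have /andP[e0 e1] := e01.
  have e1' : 0 < 1 - e by rewrite subr_gt0.
  have mI : bmeas (fun x => (\1_(@interior_moments R p n) x)%:E : \bar R).
    exact/bmeas_indic/bset_interior.
  have mT : bmeas ((fun x => (\1_(@interior_moments R p n) x)%:E : \bar R) \o cvx e c).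
    move=> d W phi mphi; apply: (mI _ _ (fun w => cvx e c (phi w))) => j.
    by apply: measurable_funD => //; apply: measurable_funM.
  rewrite -lee_pdivlMl ?exprn_gt0 //.
  have := @lebint_triangular R J (fun j => enum_rank j) (fun=> 1 - e) (cvx e c)
     (fun x => (\1_(@interior_moments R p n) x)%:E) mI _ mT (fun=> e1').
  rewrite prodr_const exprVn => <-.
  - apply: lebint_le => x; first by rewrite lee_fin indicE.
    by apply: indic_le; exact: interior_cvx.
  - by move=> x; rewrite lee_fin indicE.
  - by move=> i x t; rewrite /cvx /upd eqxx mulr0 add0r.
  - by move=> i j x t ji _; rewrite /cvx /upd (negPf ji).
apply: limit_pow_le le.
by apply: lebint_ge0 => x; rewrite lee_fin indicE.
Qed.
End InteriorConvexity.

(** * Integration block by block *)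

Section Standardization.
Variables (R : realType) (p : nat).
Local Notation C := R[i].
Variable D : 'M[C]_p.
Hypothesis pD : pd D.
Local Notation Q := (minvsqrt D).

Lemma msqrt_unit : msqrt D \in unitmx.
Proof. exact: pd_unit (msqrt_pd pD).1. Qed.

Lemma ctr_minvsqrt : ctr Q = Q.
Proof. exact: herm_inv (msqrt_pd pD).1.1. Qed.

Lemma minvsqrt_unit : Q \in unitmx.
Proof. by rewrite unitmx_inv msqrt_unit. Qed.

Lemma pd_standardize X : pd (Q *m X *m Q) <-> pd X.
Proof. by have := pd_congr_unit X minvsqrt_unit; rewrite ctr_minvsqrt. Qed.

Lemma standardizeK Y : Q *m (msqrt D *m Y *m msqrt D) *m Q = Y.
Proof.
rewrite -(mulmxA (msqrt D)) (mulmxA Q) (mulVmx msqrt_unit) mul1mx.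
by rewrite -mulmxA (mulmxV msqrt_unit) mulmx1.
Qed.

Lemma standardize_compl X : 1%:M - Q *m X *m Q = Q *m (D - X) *m Q.
Proof.
rewrite mulmxBr mulmxBl; congr (_ - _).
by have := standardizeK 1%:M; rewrite mulmx1 (msqrt_pd pD).2.
Qed.

Lemma det_standardize X : \det (Q *m X *m Q) * \det D = \det X.
Proof.
rewrite !det_mulmx det_inv -(det_msqrt pD).
have : \det (msqrt D) \is a GRing.unit by rewrite -unitmxE msqrt_unit.
by move: (\det (msqrt D)) (\det X) => d x ud; rewrite expr2 mulrA divrK // [d^-1 * x]mulrC divrK.
Qed.

Lemma rdet_standardize X : pd X -> rdet (Q *m X *m Q) * rdet D = rdet X.
Proof.
move=> pX; have := det_standardize X.
have pQ := (pd_standardize X).2 pX.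
by rewrite (rdetE pD) (rdetE pX) (rdetE pQ) -rmorphM => /complexI.
Qed.

End Standardization.

Lemma lebint0 (R : realType) (I : finType) : lebint (fun _ : I -> R => 0%E) = 0%E.
Proof.
have z0 (s : seq I) z : itint s (fun=> 0%E) z = 0%E :> \bar R.
  by elim: s z => //= i s IH z; apply: integral0_eq => t _; exact: IH.
exact: z0.
Qed.

Section BlockIntegration.
Variables (R : realType) (p n : nat) (B : 'I_n -> set 'M[R[i]]_p).
Hypothesis bB : forall k, herm_borel (B k).
Local Notation C := R[i].
Local Notation IJ := ('I_p * 'I_p)%type.
Local Notation J := ('I_n * IJ)%type.
Implicit Type x : J -> R.

(** Unnormalized beta density restricted to the event [B k]. As [k] counts from 0, the parameter is
    p (n - k) and the exponent p (n - k) - p. *)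
Definition wgt (k : 'I_n) (X : 'M[C]_p) : R :=
  \1_(B k) X * bw (p * (n - k.+1)) (p * (n - k.+1)) X.

Definition wmass (k : 'I_n) : R := fine (lebint (fun y => (wgt k (herm y))%:E)).

Definition past j x : Prop := forall k : 'I_n, (k < j)%N ->
  (pd (Sseq x k.+1 - Sminus (Sseq x) k.+1) /\
   pd (Splus (Sseq x) k.+1 - Sseq x k.+1)) /\ B k (canonical_moments x k).

Definition gap x k := Splus (Sseq x) k - Sminus (Sseq x) k.

(* The value of the iterated integral over the blocks k >= j, as a function of
   the remaining coordinates (see itint_future). *)
Definition future j x : \bar R :=
  if `[< past j x >] then
    (rdet (gap x j.+1) ^+ (p * (n - j)) * \prod_(k < n | (j <= k)%N) wmass k)%:E
  else 0%E.

Lemma wgt_ge0 k X : 0 <= wgt k X.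
Proof. by rewrite mulr_ge0 ?bw_ge0 // indicE. Qed.

Lemma measurable_wgt k d (W : measurableType d) (M : W -> 'M[C]_p) :
  mmf M -> (forall w, herm_mx (M w)) -> measurable_fun setT (fun w => wgt k (M w)).
Proof.
move=> mM hM; apply: measurable_funM; last exact: measurable_bw.
rewrite (_ : (fun _ => _) = \1_[set w | B k (herm (unherm (M w)))]); last first.
  apply/funext => w; rewrite !indicE; congr ((nat_of_bool _)%:R).
  by apply/idP/idP => /set_mem h; apply: mem_set; move: h => /=; rewrite unhermK.
apply: measurable_indic; apply: (bset_borelI (bB k)).
exact: measurable_unherm.
Qed.

Lemma bmeas_wgt k : bmeas (fun y : IJ -> R => (wgt k (herm y))%:E).
Proof.
move=> d W phi mphi; apply/measurable_EFinP/measurable_wgt; first exact: mmf_herm.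
by move=> w; exact: herm_herm.
Qed.

(** Finiteness comes from the full beta integral as an upper bound. *)
Lemma wmassE k : lebint (fun y : IJ -> R => (wgt k (herm y))%:E) = (wmass k)%:E.
Proof.
rewrite /wmass fineK // ge0_fin_numE; last first.
  by apply: lebint_ge0 => y; rewrite lee_fin wgt_ge0.
apply: (@le_lt_trans _ _ (betaC R p (p * (n - k.+1)) (p * (n - k.+1)))%:E);
  last exact: ltry.
rewrite -matrix_beta; apply: lebint_le => y; rewrite lee_fin ?wgt_ge0 //.
by rewrite ler_piMl ?bw_ge0 // indicE lern1 leq_b1.
Qed.

Lemma wmass_ge0 k : 0 <= wmass k.
Proof. by apply: fine_ge0; apply: lebint_ge0 => y; rewrite lee_fin wgt_ge0. Qed.

Lemma eq_past j x x' : (forall i, (i <= j)%N -> Sseq x i = Sseq x' i) ->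
  past j x -> past j x'.
Proof.
move=> h px k kj; have := px k kj.
have e i : (i < k.+1)%N -> Sseq x i = Sseq x' i by move=> ik; apply: h; lia.
rewrite /canonical_moments /canU (eq_Sminus e) (eq_Splus e) (h k.+1 kj).
by [].
Qed.

Lemma past_inter j x : (j <= n)%N -> past j x -> inter j (Sseq x).
Proof.
by move=> jn px k kj; have [] := px (Ordinal (leq_trans kj jn)) kj.
Qed.

Lemma past_next (j : 'I_n) x : past j.+1 x <-> past j x /\
  (pd (Sseq x j.+1 - Sminus (Sseq x) j.+1) /\
   pd (Splus (Sseq x) j.+1 - Sseq x j.+1)) /\ B j (canonical_moments x j).
Proof.
split=> [h|[h hj] k].
  by split=> [k kj|]; apply: h => //; exact: ltnW.
by rewrite ltnS leq_eqVlt => /orP[/eqP/val_inj ->|/h].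
Qed.

Section Block.
Variables (j : 'I_n) (x : J -> R).

Lemma pair_inj : injective (pair j : IJ -> J).
Proof. by move=> a b []. Qed.

Lemma Sseq_ovr_low y k : (k <= j)%N -> Sseq (ovr (pair j) x y) k = Sseq x k.
Proof.
case: k => [//|k] kj; have kn : (k < n)%N by have := ltn_ord j; lia.
rewrite (SseqE _ (Ordinal kn)) (SseqE x (Ordinal kn)) /momS; congr herm.
apply/funext => ij; apply: ovr_out => l; apply/eqP => -[] e _.
by have := congr1 val e => /=; lia.
Qed.

Lemma Sseq_ovr y : Sseq (ovr (pair j) x y) j.+1 = herm y.
Proof.
rewrite SseqE /momS; congr herm; apply/funext => ij.
exact: (ovr_in _ _ _ pair_inj).
Qed.

Let D := gap x j.+1.
Let A0 := Sminus (Sseq x) j.+1.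
Let a := (p * (n - j.+1))%N.
Let P := \prod_(k < n | (j.+1 <= k)%N) wmass k.
Let Psi (M : 'M[C]_p) : \bar R :=
  ((rdet D ^+ a * P) * wgt j (minvsqrt D *m (M - A0) *m minvsqrt D))%:E.

Lemma past_ovr y : past j (ovr (pair j) x y) <-> past j x.
Proof. by split; apply: eq_past => i ij; rewrite Sseq_ovr_low. Qed.

Hypothesis px : past j x.

Lemma gap_past_pd : pd D.
Proof.
apply: (gap_pd (herm_Sseq x) (Sseq0 x)).
by apply: past_inter => //; exact: ltnW.
Qed.

(** Given the past, block [j] enters only through its canonical moment U: [gap_det], standardized by
    [D], says that the next gap has determinant det D det U det (1 - U). *)
Lemma future_block y : future j.+1 (ovr (pair j) x y) = Psi (herm y).
Proof.
have pD := gap_past_pd.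
have e i : (i < j.+1)%N -> Sseq (ovr (pair j) x y) i = Sseq x i.
  by move=> ij; exact: Sseq_ovr_low.
have eD : gap (ovr (pair j) x y) j.+1 = D.
  by rewrite /gap (eq_Sminus e) (eq_Splus e).
have eA : Sminus (Sseq (ovr (pair j) x y)) j.+1 = A0 by rewrite (eq_Sminus e).
have eP : Splus (Sseq (ovr (pair j) x y)) j.+1 - herm y = D - (herm y - A0).
  by rewrite -eD -eA /gap opprB addrA subrK.
have eU : canonical_moments (ovr (pair j) x y) j =
    minvsqrt D *m (herm y - A0) *m minvsqrt D.
  by rewrite /canonical_moments /canU -/(gap _ _) eD eA Sseq_ovr.
set U := minvsqrt D *m (herm y - A0) *m minvsqrt D in eU.
have pU := pd_standardize pD (herm y - A0).
have pU1 : pd (1%:M - U) <-> pd (D - (herm y - A0)).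
  by rewrite /U (standardize_compl pD); exact: (pd_standardize pD).
rewrite /future /Psi /wgt -/U -/a -/P; case: asboolP => h; last first.
  (* If the past does not extend, either U misses [B j] or one of U, 1 - U is not positive definite,
     and the weight vanishes. *)
  rewrite indicE; case: (boolP (U \in B j)) => [/set_mem BU|]; last by rewrite mul0r mulr0.
  have h0 : ~ (pd U /\ pd (1%:M - U)).
    move=> [/pU p1 /pU1 p2]; apply: h; apply/(past_next j); split.
      exact/past_ovr.
    by rewrite eU eA Sseq_ovr eP; exact: (conj (conj p1 p2) BU).
  by rewrite (bw0 a a h0) !mulr0.
have /past_next[_ [[]]] := h; rewrite eU eA Sseq_ovr eP => p1 p2 BU.
have q1 := pU.2 p1; have q2 := pU1.2 p2.
rewrite indicE (mem_set BU) mul1r (bwE _ _ q1 q2).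
suff -> : rdet (gap (ovr (pair j) x y) j.+2) = rdet D * (rdet U * rdet (1%:M - U)).
  by congr EFin; rewrite !exprMn [LHS]mulrAC.
have int := past_inter (ltn_ord j) h.
have := gap_det (herm_Sseq _) (Sseq0 _) int.
rewrite -!/(gap _ _) eD eA Sseq_ovr eP.
have pD' := gap_pd (herm_Sseq _) (Sseq0 _) int; rewrite -/(gap _ _) in pD'.
rewrite (rdetE pD) (rdetE p1) (rdetE p2) (rdetE pD') -!rmorphM => /complexI E.
(* Each factor on the right of [E] is det D times a standardized determinant, so one factor det D
   cancels. *)
apply: (mulIf (lt0r_neq0 (rdet_gt0 pD))); rewrite E.
rewrite -(rdet_standardize pD p1) -(rdet_standardize pD p2) -/U.
by rewrite -(standardize_compl pD) -/U; ring.
Qed.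

Lemma lebint_block : lebint (Psi \o @herm R p) =
  (rdet D ^+ (p * (n - j)) * \prod_(k < n | (j <= k)%N) wmass k)%:E.
Proof.
have pD := gap_past_pd.
have rD := rdet_gt0 pD.
have P0 : 0 <= rdet D ^+ a * P.
  apply: mulr_ge0; first by rewrite exprn_ge0 // ltW.
  by apply: prodr_ge0 => k _; exact: wmass_ge0.
have mPsi : bmeas (Psi \o @herm R p).
  move=> d W phi mphi; apply/measurable_EFinP; apply: measurable_funM => //.
  apply: measurable_wgt => [|w].
    apply: mmfM; [apply: mmfM|]; [exact: mmf_cst| |exact: mmf_cst].
    by apply: mmfB; [exact: mmf_herm|exact: mmf_cst].
  rewrite -{1}(ctr_minvsqrt pD); apply: herm_congr.
  by apply: hermB; [exact: herm_herm|exact/herm_Sminus/herm_Sseq].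
have Psi0 M : (0 <= Psi M)%E by rewrite lee_fin mulr_ge0 // wgt_ge0.
have E := lebint_msqrt_congr mPsi Psi0 pD (herm_Sminus (herm_Sseq x) j.+1).
rewrite -/A0 -/(rdet D) in E; rewrite -[LHS]mul1e.
(* Prepares the use of [lebint_msqrt_congr] from right to left; the factor (det D)^p left outside
   raises the exponent from p (n - j - 1) to p (n - j). *)
rewrite -[1%E](_ : ((rdet D ^+ p)%:E * (rdet D ^- p)%:E)%E = 1%E); last first.
  by rewrite -EFinM mulfV // expf_neq0 // lt0r_neq0.
rewrite -muleA -E.
have -> : lebint (fun y => Psi (msqrt D *m herm y *m msqrt D + A0)) =
    lebint (fun y => (rdet D ^+ a * P)%:E * (wgt j (herm y))%:E)%E.
  by apply: eq_lebint => y; rewrite /Psi addrK (standardizeK pD) EFinM.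
rewrite lebintZ //; last 2 first.
- exact: bmeas_wgt.
- by move=> y; rewrite lee_fin wgt_ge0.
rewrite wmassE -!EFinM; congr EFin.
rewrite [in RHS](bigD1 j) //= (_ : \prod_(k < n | _) _ = P); last first.
  by apply: eq_bigl => k; rewrite ltn_neqAle andbC eq_sym.
have -> : (p * (n - j))%N = (p + a)%N.
  by rewrite /a -mulnS; congr muln; have := ltn_ord j; lia.
by rewrite exprD; ring.
Qed.

End Block.

Lemma future_step (j : 'I_n) x :
  lebint (fun y => future j.+1 (ovr (pair j) x y)) = future j x.
Proof.
case: (pselect (past j x)) => px.
  rewrite {2}/future asboolT // -lebint_block //.
  by apply: eq_lebint => y; exact: future_block.
rewrite {2}/future asboolF //.
rewrite -(@lebint0 R IJ); apply: eq_lebint => y.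
by rewrite /future asboolF // => /past_next[/past_ovr].
Qed.

Lemma itint_future m : (m <= n)%N -> forall x,
  itint (flatten [seq map (pair k) (enum {: IJ}) | k <- drop (n - m) (enum 'I_n)])
    (future n) x = future (n - m) x.
Proof.
elim: m => [_ x|m IH mn x].
  by rewrite subn0 drop_oversize ?size_enum_ord.
have jn : (n - m.+1 < n)%N by lia.
pose j := Ordinal jn.
rewrite (drop_nth j) ?size_enum_ord // (_ : nth j (enum 'I_n) (n - m.+1) = j); last first.
  by apply: val_inj; exact: nth_enum_ord.
rewrite -subSn // subSS map_cons /flatten /= -/(flatten _) itint_cat.
rewrite (itint_codom _ _ (@pair_inj j)) -[RHS](future_step j).
apply: eq_lebint => y; rewrite IH; last exact: ltnW.
by rewrite /j /= -subSn // subSS.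
Qed.

Lemma lebint_interior : lebint (fun x : J -> R =>
    (\1_[set x | interior_moments x /\ forall k, B k (canonical_moments x k)] x)%:E) =
  (\prod_(k < n) wmass k)%:E.
Proof.
have E x : (\1_[set x | interior_moments x /\ forall k, B k (canonical_moments x k)] x)%:E
    = future n x.
  rewrite indicE /future subnn muln0 expr0 mul1r big1; last first.
    by move=> k; rewrite leqNgt ltn_ord.
  case: asboolP => h; [rewrite mem_set //|rewrite memNset //].
    by split=> k; have [] := h k (ltn_ord k).
  by move=> [h1 h2]; apply: h => k _; split; [exact: h1|exact: h2].
rewrite (eq_lebint E) /lebint.
(* The enumeration of the product type runs block by block, so the last block is the innermost
   integral. *)
have -> : enum {: J} = flatten [seq map (pair k) (enum {: IJ}) | k <- drop (n - n) (enum 'I_n)].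
  by rewrite subnn drop0 enumT unlock.
(* The recursion ends at the first gap, which is the identity matrix of determinant 1. *)
rewrite itint_future // subnn /future asboolT // subn0 /gap /= subr0.
by rewrite /rdet det1 expr1n mul1r.
Qed.

End BlockIntegration.

(** * Normalizing constants and the volume of the interior *)

Section UniformLaw.
Variable R : realType.
Local Notation C := R[i].

Lemma Gamma2_nat p a :
  Gamma2 p (a + p)%:R = pi ^+ 'C(p, 2) * \prod_(i < p) (a + i)`!%:R :> R.
Proof.
rewrite /Gamma2; congr (_ * _).
  have -> : (p * (p - 1))%:R / 2 = 'C(p, 2)%:R :> R.
    have := bin_ffact p 2; rewrite ffactnS ffactn1 /= -subn1 => <-.
    by rewrite natrM mulfK.
  by rewrite powR_mulrn // pi_ge0.
(* Reversing the product turns the decreasing arguments a + p - i of [Gamma] into the increasing a +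
   i + 1. *)
rewrite (reindex_inj rev_ord_inj) /=; apply: eq_bigr => i _.
rewrite -natrB; last by have := ltn_ord i; lia.
have -> : (a + p - (p - i.+1))%N = (a + i).+1 by have := ltn_ord i; lia.
exact: Gamma_nat.
Qed.

Lemma Beta2const_nat p a : Beta2const p (a + p)%:R (a + p)%:R = betaC R p a a.
Proof.
rewrite /Beta2const -natrD (_ : (a + p + (a + p))%N = (a + a + p + p)%N); last lia.
rewrite !Gamma2_nat /betaC !big_split /= prodfV.
have : pi ^+ 'C(p, 2) != 0 :> R by rewrite expf_neq0 // lt0r_neq0 // pi_gt0.
have : \prod_(i < p) (a + a + p + i)`!%:R != 0 :> R.
  by apply/prodf_neq0 => i _; rewrite pnatr_eq0 -lt0n fact_gt0.
move: (\prod_i _) (\prod_i _) (pi ^+ _) => x y z x0 z0.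
by field; rewrite x0.
Qed.

Lemma beta2_probE p n (B : 'I_n -> set 'M[C]_p) (k : 'I_n) :
  (forall l, herm_borel (B l)) ->
  beta2_prob (p * (n - k))%:R (p * (n - k))%:R (B k) =
  wmass B k / betaC R p (p * (n - k.+1)) (p * (n - k.+1)).
Proof.
move=> bB; set a := (p * (n - k.+1))%N.
have -> : (p * (n - k))%N = (a + p)%N.
  by rewrite /a addnC -mulnS; congr muln; have := ltn_ord k; lia.
have b0 := betaC_gt0 R p a a.
rewrite /beta2_prob.
transitivity (fine (lebint (fun y => ((betaC R p a a)^-1)%:E * (wgt B k (herm y))%:E)%E)).
  congr fine; apply: eq_lebint => y; rewrite -EFinM; congr EFin.
  rewrite /wgt -/a /beta2_density Beta2const_nat natrD addrK !indicE.
  case: (pselect (pd (herm y) /\ pd (1%:M - herm y))) => [[p1 p2]|h]; last first.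
    rewrite (bw0 _ _ h) mulr0 mulr0 memNset ?mul0r //= /lowner_lt subr0 => -[_].
    exact: h.
  rewrite (bwE _ _ p1 p2) !powR_mulrn ?ltW ?rdet_gt0 //.
  rewrite [RHS]mulrC mulrA; congr (_ * _ / _); congr ((nat_of_bool _)%:R).
  apply/idP/idP => /set_mem h; apply: mem_set; first by case: h.
  split; first exact: h.
  by split; [rewrite /lowner_lt subr0; exact: p1|exact: p2].
rewrite lebintZ.
- by rewrite (wmassE B) -EFinM /= mulrC.
- exact: (bmeas_wgt bB).
- by move=> y; rewrite lee_fin wgt_ge0.
- by rewrite invr_ge0 ltW.
Qed.

Lemma borelI_setT (I : finType) : borelI ([set: I -> R]).
Proof.
rewrite -setC0 -setTD; apply: sigma_algebraCD; exact: sigma_algebra0.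
Qed.

Lemma lebint_all_interior p n :
  lebint (fun x => (\1_(@interior_moments R p n) x)%:E) =
  (\prod_(k < n) betaC R p (p * (n - k.+1)) (p * (n - k.+1)))%:E.
Proof.
have bT (k : 'I_n) : herm_borel ([set: 'M[C]_p]) by exact: borelI_setT.
have := lebint_interior bT.
rewrite (_ : [set x | _] = @interior_moments R p n); last first.
  by apply/seteqP; split=> [x []|].
move=> ->; congr EFin; apply: eq_bigr => k _.
rewrite /wmass -[RHS]/(fine (betaC R p _ _)%:E) -matrix_beta; congr fine.
by apply: eq_lebint => y; rewrite /wgt indicT mul1r.
Qed.

End UniformLaw.

(* Joint law of (U_{1,n},...,U_{n,n}) under the uniform distribution on M_n(C)
   equals the product of Beta^{(2)}_p(p(n-k+1), p(n-k+1)) laws (k = 1..n);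
   here the index k : 'I_n stands for the paper's k+1, so n-(k+1)+1 = n-k. *)
Theorem theorem5p1 (R : realType) (p n : nat) (hp : (0 < p)%N)
  (B : 'I_n -> set 'M[R[i]]_p) :
  (forall k : 'I_n, herm_borel (B k)) ->
  unif_moment_prob
    [set x : 'I_n * ('I_p * 'I_p) -> R |
       interior_moments x /\ forall k : 'I_n, B k (canonical_moments x k)]
  = \prod_(k < n) beta2_prob (p * (n - k))%:R (p * (n - k))%:R (B k).
Proof.
move=> bB; rewrite /unif_moment_prob.
set E := [set x | _].
have -> : E `&` @moment_space R p n = E.
  (* The event requires an interior point, hence lies in the moment space. *)
  by apply/setIidPl => x [/interior_moment_space].
rewrite (lebint_interior bB).
pose V : R := \prod_(k < n) betaC R p (p * (n - k.+1)) (p * (n - k.+1)).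
have V0 : 0 < V by apply: prodr_gt0 => k _; exact: betaC_gt0.
(* An empty interior would have volume 0, against the positive product of beta constants. *)
have [c ic] : exists c, @interior_moments R p n c.
  apply: contrapT => /forallNP h.
  have := lebint_all_interior R p n.
  rewrite (_ : (fun x => _) = fun=> 0%:E); last first.
    by apply/funext => x; rewrite indicE memNset.
  rewrite lebint0 => -[] /esym/eqP; rewrite gt_eqF //.
rewrite (vol_moment_space ic) lebint_all_interior /=.
under [RHS]eq_bigr do rewrite beta2_probE //.
by rewrite [RHS]big_split /= prodfV.
Qed.
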